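(* Let $\mathbf J$ be the minimal block Jacobi operator in $l^2(\mathbb N_0;\mathbb C^p)$ with diagonal entries $\mathcal A_n=\mathcal A_n^*\in\mathbb C^{p\times p}$ and invertible off-diagonal entries $\mathcal B_n\in\mathbb C^{p\times p}$, $n\in\mathbb N_0$. Let $\mathcal A:=\mathrm{diag}\{\mathcal A_0,\mathcal A_1,\ldots,\mathcal A_n,\ldots\}$, $\ker\mathcal A=\{0\}$, and assume that $\mathcal A^{-1}\in\mathcal S_q(l^2(\mathbb N_0;\mathbb C^p))$ for some $q\in(0,\infty]$. Let, for some $N\in\mathbb N_0$, $$a_1(N):=\sup_{n\ge N}\big(\|\mathcal A_n^{-1}\mathcal B_n\|+\|\mathcal A_n^{-1}\mathcal B_{n-1}^*\|\big)<\infty,\qquad a_2(N):=\sup_{n\ge N}\big(\|\mathcal A_n^{-1}\mathcal B_n\|+\|\mathcal A_{n+2}^{-1}\mathcal B_{n+1}^*\|\big)<\infty,$$ wherever these quantities are used. Assume that at least one of the following conditions is satisfied: (i) $a_1(N)a_2(N)<1$ for some $N\in\mathbb N_0$; (ii) for some $N\in\mathbb N_0$: $a_1(N)\le1$ and $a_2(N)<1$ (or $a_1(N)<1$ and $a_2(N)\le1$); (iii) for some $N\in\mathbb N_0$ and $s\in[1,+\infty)$: $\ \sup_{n\ge N}\big(\|\mathcal A_n^{-1}\mathcal B_n\|^s+\|\mathcal A_n^{-1}\mathcal B_{n-1}^*\|^s\big)<\frac1{2^{s-1}}$; (iv) for some $N\in\mathbb N_0$ and $s\in[1,+\infty)$: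 $\ \sup_{n\ge N}\big(\|\mathcal A_n^{-1}\mathcal B_n\|^s+\|\mathcal A_{n+2}^{-1}\mathcal B_{n+1}^*\|^s\big)<\frac1{2^{s-1}}$; (v) for some $N\in\mathbb N_0$: $\ \sup_{n\ge N}\|\mathcal A_n^{-1}\mathcal B_n\|<\frac12$ and $\sup_{n\ge N}\|\mathcal A_n^{-1}\mathcal B_{n-1}^*\|<\frac12$. Then the operator $\mathbf J$ is selfadjoint and $\mathbf J^{-1}\in\mathcal S_q(l^2(\mathbb N_0;\mathbb C^p))$.
   Context: Let $p\in\mathbb N$ and $\mathbb N_0=\mathbb N\cup\{0\}$. The block Jacobi matrix acts by $(\mathbf Jf)_n=\mathcal B_{n-1}^*f_{n-1}+\mathcal A_nf_n+\mathcal B_nf_{n+1}$ (with the term containing $f_{-1}$ omitted for $n=0$). The minimal operator $\mathbf J$ is the closure in $l^2(\mathbb N_0;\mathbb C^p)$ of this map restricted to finitely supported sequences. The diagonal operator $\mathcal A$ is taken on its maximal domain. $\mathcal S_q(\mathfrak H)$ denotes the Neumann–Schatten ideal of order $q$ in $\mathfrak H$ for $q\in(0,\infty)$, and $\mathcal S_\infty(\mathfrak H)$ the ideal of compact operators. Norms of matrices are operator norms. Convention: $\mathcal B_{-1}:=0$.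
   Formalization: J^{-1} in S_q is claimed only when ker J = {0}: the conditions restrict only n ≥ N, so the remaining entries can make 0 an eigenvalue of J. It is added that (J − z)^{-1} is in S_q for every complex z with J − z injective. *)

(* Defs.v *)
From HB Require Import structures.
From mathcomp Require Import all_boot all_order all_algebra complex.
From mathcomp Require Import all_classical all_reals all_analysis.
From mathcomp Require Import ring lra.
Set Implicit Arguments.
Unset Strict Implicit.
Unset Printing Implicit Defensive.
Import Order.TTheory GRing.Theory Num.Theory.
Import numFieldNormedType.Exports.
Local Open Scope classical_set_scope.
Local Open Scope ring_scope.
Local Open Scope complex_scope.
Local Open Scope sesquilinear_scope.

(* Inner products are linear in the first argument. *)
Definition vdot (R : realType) (p : nat) (u v : 'cV[R[i]]_p) : R[i] :=
  \sum_(i < p) u i 0 * (v i 0)^*.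

Definition vnorm (R : realType) (p : nat) (u : 'cV[R[i]]_p) : R :=
  Num.sqrt (complex.Re (vdot u u)).

Definition opnorm (R : realType) (p : nat) (M : 'M[R[i]]_p) : R :=
  sup [set vnorm (M *m u) | u in [set u : 'cV[R[i]]_p | vnorm u <= 1]].

Section vnorm_theory.
Variables (R : realType) (p : nat).
Implicit Types (u v : 'cV[R[i]]_p) (c : R[i]).

Lemma vdotxxE u : complex.Re (vdot u u) =
  \sum_(i < p) (complex.Re (u i 0) ^+ 2 + complex.Im (u i 0) ^+ 2).
Proof.
rewrite raddf_sum; apply: eq_bigr => i _.
by case: (u i 0) => a b /=; ring.
Qed.

Lemma sqr_vnorm u : vnorm u ^+ 2 = complex.Re (vdot u u).
Proof.
rewrite sqr_sqrtr// vdotxxE sumr_ge0// => i _.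
by rewrite addr_ge0 ?sqr_ge0.
Qed.

Lemma vnorm_eq0 u : vnorm u = 0 -> u = 0.
Proof.
move=> u0; apply/colP => i; rewrite mxE; have := sqr_vnorm u.
rewrite u0 expr0n/= vdotxxE => /esym/eqP.
rewrite psumr_eq0; last by move=> j _; rewrite addr_ge0 ?sqr_ge0.
move=> /allP /(_ i (mem_index_enum _)) /=.
case: (u i 0) => a b /=.
by rewrite paddr_eq0 ?sqr_ge0// !sqrf_eq0 => /andP[/eqP -> /eqP ->].
Qed.

Lemma sqr_vnormZ c u :
  vnorm (c *: u) ^+ 2 = (complex.Re c ^+ 2 + complex.Im c ^+ 2) * vnorm u ^+ 2.
Proof.
rewrite !sqr_vnorm !vdotxxE mulr_sumr; apply: eq_bigr => i _; rewrite mxE.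
by case: c (u i 0) => a b [x y] /=; ring.
Qed.

Lemma sqr_vnormD_le u v (t : R) : 0 < t ->
  vnorm (u + v) ^+ 2 <= (1 + t) * vnorm u ^+ 2 + (1 + t^-1) * vnorm v ^+ 2.
Proof.
move=> t0; have tV : t * t^-1 = 1 by rewrite mulfV ?gt_eqF.
have tV0 : 0 < t^-1 by rewrite invr_gt0.
have le (a b : R) :
    (a + b) ^+ 2 <= (1 + t) * a ^+ 2 + (1 + t^-1) * b ^+ 2.
  rewrite -subr_ge0.
  suff -> : (1 + t) * a ^+ 2 + (1 + t^-1) * b ^+ 2 - (a + b) ^+ 2 =
      t^-1 * (t * a - b) ^+ 2 by rewrite mulr_ge0 ?sqr_ge0 ?ltW.
  by field; rewrite gt_eqF.
rewrite !sqr_vnorm !vdotxxE !mulr_sumr -big_split/=; apply: ler_sum => i _.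
rewrite mxE; case: (u i 0) (v i 0) => a b [c d] /=.
by have := le a c; have := le b d; lra.
Qed.

End vnorm_theory.

Definition l2energy (R : realType) (p : nat) (f : nat -> 'cV[R[i]]_p) : \bar R :=
  (\sum_(0 <= n <oo) (vnorm (f n) ^+ 2)%:E)%E.

Definition l2_pred (R : realType) (p : nat) : {pred nat -> 'cV[R[i]]_p} :=
  fun f => (l2energy f < +oo)%E.
Arguments l2_pred : clear implicits.

Section l2_closed.
Variables (R : realType) (p : nat).
Implicit Types (f g : nat -> 'cV[R[i]]_p) (c : R[i]).

Lemma l2energy_ge0 f : (0 <= l2energy f)%E.
Proof. by apply: nneseries_ge0 => n _ _; rewrite lee_fin sqr_ge0. Qed.

Lemma l2energyZ c f : l2energy (c *: f)%R =
  ((complex.Re c ^+ 2 + complex.Im c ^+ 2)%:E * l2energy f)%E.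
Proof.
rewrite /l2energy -nneseriesZl; last by move=> n _; rewrite lee_fin sqr_ge0.
by apply: eq_eseriesr => n _; rewrite -EFinM -sqr_vnormZ.
Qed.

Lemma l2energyD_le f g (t : R) : 0 < t ->
  (l2energy (f + g)%R <=
     (1 + t)%:E * l2energy f + (1 + t^-1)%:E * l2energy g)%E.
Proof.
move=> t0; have tV0 : 0 < t^-1 by rewrite invr_gt0.
rewrite /l2energy -!nneseriesZl; try by move=> n _; rewrite lee_fin sqr_ge0.
rewrite -nneseriesD.
- apply: lee_nneseries => n _; first by rewrite lee_fin sqr_ge0.
  by rewrite -!EFinM -EFinD lee_fin; exact: sqr_vnormD_le.
- move=> n _ _; rewrite -EFinM lee_fin mulr_ge0 ?sqr_ge0//; lra.
- move=> n _ _; rewrite -EFinM lee_fin mulr_ge0 ?sqr_ge0//; lra.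
Qed.

Lemma l2energy_eq0 f : l2energy f = 0%E -> f = 0.
Proof.
move=> f0; apply/funext => n; apply: vnorm_eq0; apply/eqP.
rewrite -sqrf_eq0 eq_le sqr_ge0 andbT.
have h m : (0 <= (vnorm (f m) ^+ 2)%:E)%E by rewrite lee_fin sqr_ge0.
have := @nneseries_lim_ge R (fun m => (vnorm (f m) ^+ 2)%:E) xpredT 0 n.+1
  (fun m _ _ => h m).
rewrite -/(l2energy f) f0 big_nat_recr//= => le0.
rewrite -lee_fin; apply: le_trans le0.
by rewrite leeDr// sume_ge0.
Qed.

Lemma l2_submod_closed : submod_closed (l2_pred R p).
Proof.
split=> [|c f g f2 g2].
  rewrite unfold_in /l2energy eseries0 ?ltry// => n _ _.
  by rewrite sqr_vnorm vdotxxE big1// => i _; rewrite mxE /= expr0n addr0.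
rewrite unfold_in; apply: le_lt_trans (l2energyD_le (c *: f) g ltr01) _.
rewrite l2energyZ.
have := l2energy_ge0 f; have := l2energy_ge0 g.
move: f2 g2; rewrite !unfold_in.
by case: (l2energy f) (l2energy g) => [a| |] [b| |]//= _ _ _ _; rewrite ltry.
Qed.

End l2_closed.

HB.instance Definition _ (R : realType) (p : nat) :=
  GRing.isSubmodClosed.Build _ _ (l2_pred R p) (@l2_submod_closed R p).

Record l2 (R : realType) (p : nat) := L2 {
  l2val :> nat -> 'cV[R[i]]_p;
  l2valP : l2val \in l2_pred R p }.

HB.instance Definition _ (R : realType) (p : nat) :=
  [isSub for @l2val R p].
HB.instance Definition _ (R : realType) (p : nat) :=
  [Choice of l2 R p by <:].
HB.instance Definition _ (R : realType) (p : nat) :=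
  [SubChoice_isSubLmodule of l2 R p by <:].

Definition l2norm (R : realType) (p : nat) (f : l2 R p) : R :=
  Num.sqrt (fine (l2energy f)).

Section l2_normed.
Variables (R : realType) (p : nat).
Implicit Types (f g : l2 R p).

Lemma l2energy_fin f : l2energy f \is a fin_num.
Proof. by rewrite ge0_fin_numE ?l2energy_ge0//; exact: (l2valP f). Qed.

Lemma sqr_l2norm f : (l2norm f ^+ 2)%:E = l2energy f.
Proof.
by rewrite sqr_sqrtr ?fine_ge0 ?l2energy_ge0// fineK ?l2energy_fin.
Qed.

Lemma l2norm_eq0 f : l2norm f = 0 -> f = 0.
Proof.
move=> f0; apply/val_inj/l2energy_eq0.
by rewrite -sqr_l2norm f0 expr0n.
Qed.

Lemma l2normZ (c : R[i]) f : l2norm (c *: f) =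
  Num.sqrt (complex.Re c ^+ 2 + complex.Im c ^+ 2) * l2norm f.
Proof.
rewrite /l2norm [in LHS]l2energyZ fineM ?l2energy_fin//= sqrtrM//.
by rewrite addr_ge0 ?sqr_ge0.
Qed.

Lemma l2normMn f n : l2norm (f *+ n) = l2norm f *+ n.
Proof.
rewrite -scaler_nat l2normZ !raddfMn/= mul0rn expr0n addr0 sqrtr_sqr.
by rewrite ger0_norm// mulr_natl.
Qed.

Lemma l2normN f : l2norm (- f) = l2norm f.
Proof.
by rewrite -scaleN1r l2normZ/= oppr0 expr0n addr0 sqrrN expr1n sqrtr1 mul1r.
Qed.

Lemma ler_l2normD f g : l2norm (f + g) <= l2norm f + l2norm g.
Proof.
have [f0|f0] := eqVneq (l2norm f) 0; first by rewrite f0 (l2norm_eq0 f0) !add0r.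
have [g0|g0] := eqVneq (l2norm g) 0; first by rewrite g0 (l2norm_eq0 g0) !addr0.
have {}f0 : 0 < l2norm f by rewrite lt_neqAle eq_sym f0 sqrtr_ge0.
have {}g0 : 0 < l2norm g by rewrite lt_neqAle eq_sym g0 sqrtr_ge0.
have := @l2energyD_le R p f g (l2norm g / l2norm f) (divr_gt0 g0 f0).
rewrite -[(l2val f + l2val g)]/(l2val (f + g)) -!sqr_l2norm -!EFinM -EFinD lee_fin.
suff -> : (1 + l2norm g / l2norm f) * l2norm f ^+ 2 +
    (1 + (l2norm g / l2norm f)^-1) * l2norm g ^+ 2 = (l2norm f + l2norm g) ^+ 2.
  by rewrite ler_pXn2r// nnegrE ?sqrtr_ge0// addr_ge0 ?ltW.
by field; rewrite !gt_eqF.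
Qed.

End l2_normed.

(* The scalars are complex but the norm is real-valued, so that [l2 R p] is a
   left module over [R[i]] and a pseudometric normed group over [R]. *)
HB.instance Definition _ (R : realType) (p : nat) :=
  Num.Zmodule_isNormed.Build R (l2 R p)
    (@ler_l2normD R p) (@l2norm_eq0 R p) (@l2normMn R p) (@l2normN R p).
HB.instance Definition _ (R : realType) (p : nat) :=
  PseudoMetric.copy (l2 R p) (pseudoMetric_normed (l2 R p)).
HB.instance Definition _ (R : realType) (p : nat) := isPointed.Build (l2 R p) 0.
HB.instance Definition _ (R : realType) (p : nat) :=
  NormedZmod_PseudoMetric_eq.Build R (l2 R p) erefl.

Definition l2dot (R : realType) (p : nat) (f g : l2 R p) : R[i] :=
  limn (series (fun n => complex.Re (vdot (f n) (g n)))) +i*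
  limn (series (fun n => complex.Im (vdot (f n) (g n)))).

(* Possibly unbounded operators are represented by their graphs. *)
Section operators.
Variables (R : realType) (p : nat).
Local Notation H := (l2 R p).
Implicit Types (G : set (H * H)) (K : {linear H -> H}).

Definition op_graph K : set (H * H) := [set z : H * H | z.2 = K z.1].

Definition op_domain G : set H := [set f | exists g, G (f, g)].

Definition op_kernel G : set H := [set f | G (f, 0)].

Definition op_inverse G : set (H * H) := [set z : H * H | G (z.2, z.1)].

(* G - z *)
Definition op_shift G (z : R[i]) : set (H * H) :=
  [set w : H * H | G (w.1, w.2 + z *: w.1)].

Definition op_adjoint G : set (H * H) :=
  [set z : H * H | forall w, G w -> l2dot w.2 z.1 = l2dot w.1 z.2].

Definition selfadjoint G : Prop := dense (op_domain G) /\ op_adjoint G = G.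

Definition compact_operator K : Prop :=
  precompact (K @` [set f : H | `|f| <= 1]).

Definition orthonormal (e : nat -> H) : Prop :=
  forall j k, l2dot (e j) (e k) = (j == k)%:R.

(* [s] lists the singular values of [K], i.e. the eigenvalues of the square
   root of K^* K, counted with multiplicity: [e] is an orthonormal family with
   K^* K e_n = s_n^2 e_n, and it exhausts the orthogonal complement of ker K.
   Zeros may be inserted in the list; they do not contribute to the sums. *)
Definition singular_values K (s : nat -> R) : Prop :=
  exists e : nat -> H,
    [/\ orthonormal e,
        forall n, 0 <= s n,
        forall n, op_adjoint (op_graph K) (K (e n), (s n ^+ 2)%:C *: e n) &
        forall f, (forall n, l2dot f (e n) = 0) -> K f = 0].

(* Used for 0 < q only. *)
Definition schatten (q : \bar R) K : Prop :=
  compact_operator K /\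
  if q is r%:E then
    exists2 s : nat -> R, singular_values K s &
      (\sum_(0 <= n <oo) (s n `^ r)%:E < +oo)%E
  else True.

(* Membership of an operator given by its graph includes that it is everywhere
   defined and single-valued. *)
Definition in_schatten (q : \bar R) G : Prop :=
  exists2 K : {linear H -> H}, G = op_graph K & schatten q K.

End operators.

Section jacobi.
Variables (R : realType) (p : nat).
Local Notation H := (l2 R p).
Implicit Types (A B : nat -> 'M[R[i]]_p).

(* B_(n-1), with B_(-1) = 0. *)
Definition Bpred B (n : nat) : 'M[R[i]]_p := if n is m.+1 then B m else 0.

Definition diag_operator A : set (H * H) :=
  [set z : H * H | forall n, z.2 n = A n *m z.1 n].

(* At n = 0 the junk term [f 0.-1] is multiplied by B_(-1) = 0. *)
Definition jacobi_action A B (f : nat -> 'cV[R[i]]_p) (n : nat) : 'cV[R[i]]_p :=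
  (Bpred B n)^t* *m f n.-1 + A n *m f n + B n *m f n.+1.

Definition finitely_supported (f : nat -> 'cV[R[i]]_p) : Prop :=
  exists N : nat, forall n, (N <= n)%N -> f n = 0.

Definition preminimal_jacobi A B : set (H * H) :=
  [set z : H * H |
    finitely_supported z.1 /\ forall n, z.2 n = jacobi_action A B z.1 n].

Definition minimal_jacobi A B : set (H * H) := closure (preminimal_jacobi A B).

Definition supge (N : nat) (u : nat -> R) : \bar R :=
  ereal_sup [set (u n)%:E | n in [set n | (N <= n)%N]].

Definition nAB A B (n : nat) : R := opnorm (invmx (A n) *m B n).

Definition nABpred A B (n : nat) : R :=
  opnorm (invmx (A n) *m (Bpred B n)^t*).

Definition a1 A B (N : nat) : \bar R :=
  supge N (fun n => nAB A B n + nABpred A B n).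

(* [nABpred A B n.+2] is the norm of A_(n+2)^-1 B_(n+1)^*. *)
Definition a2 A B (N : nat) : \bar R :=
  supge N (fun n => nAB A B n + nABpred A B n.+2).

Definition cond_i A B : Prop := exists N : nat,
  [/\ (a1 A B N < +oo)%E, (a2 A B N < +oo)%E & (a1 A B N * a2 A B N < 1)%E].

Definition cond_ii A B : Prop := exists N : nat,
  (a1 A B N <= 1)%E /\ (a2 A B N < 1)%E \/
  (a1 A B N < 1)%E /\ (a2 A B N <= 1)%E.

Definition cond_iii A B : Prop := exists (N : nat) (s : R),
  1 <= s /\
  (supge N (fun n => (nAB A B n `^ s + nABpred A B n `^ s)%R)
     < ((2 `^ (s - 1))^-1)%:E)%E.

Definition cond_iv A B : Prop := exists (N : nat) (s : R),
  1 <= s /\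
  (supge N (fun n => (nAB A B n `^ s + nABpred A B n.+2 `^ s)%R)
     < ((2 `^ (s - 1))^-1)%:E)%E.

Definition cond_v A B : Prop := exists N : nat,
  (supge N (nAB A B) < (2^-1)%:E)%E /\ (supge N (nABpred A B) < (2^-1)%:E)%E.

End jacobi.

(* Main.v *)
Require Import Defs.
From HB Require Import structures.
From mathcomp Require Import all_boot all_order all_algebra complex.
From mathcomp Require Import all_classical all_reals all_analysis.
From mathcomp Require Import ring lra.
Set Implicit Arguments.
Unset Strict Implicit.
Unset Printing Implicit Defensive.
Import Order.TTheory GRing.Theory Num.Theory.
Import numFieldNormedType.Exports.
Import Normc.
Local Open Scope classical_set_scope.
Local Open Scope ring_scope.
Local Open Scope complex_scope.
Local Open Scope sesquilinear_scope.

(** Split [J] into its diagonal [A] and its off-diagonal part [Off], and let [x_n]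
    and [y_n] be the norms of [A_n^-1 B_n] and [A_n^-1 B_(n-1)^*], that is, of the
    blocks in row [n] of [A^-1 Off].  Each of the five conditions implies that from
    some index on either the row sums [x_n + y_n] or the column sums
    [x_n + y_(n+2)] stay below a constant [c < 1]: in (i) and (ii) because a product
    below [1] has a factor below [1], in (iii) and (iv) by the inequality between
    power means ([conditions_dominated]).  Replacing finitely many diagonal blocks by
    a large multiple of the identity makes this dominance hold from the first index
    on ([scalar_head_dominated]); it is a bounded perturbation supported on finitely
    many sites, so it changes neither the domain of [J] nor whether [J] is
    selfadjoint ([minimal_eq_maximal_perturb]).

    The dominance has two consequences.  The first is a lower bound for the form of
    [J]: with the sign of [A_n] as a multiplier,
    [(1 - c) |||A|^(1/2) f||^2 <= ||J f|| ||f||] ([minimal_form]).  Indeed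
    [|A_n|^(-1/2) B_n |A_(n+1)|^(-1/2)] has norm at most [sqrt (x_n y_(n+1))]
    ([Re_vdot_absqrt_le]), and the geometric mean is split among the two sites so that
    the row sums, or the column sums, appear.  As [A^-1] is compact, [|A_n|] tends to
    infinity; so the elements of the domain that are bounded in the graph norm have
    uniformly small tails, and form a precompact set ([tight_precompact]).  The second
    is that a square-summable solution of the recurrence [J u = 0] vanishes
    ([maximal_kernel]), because [|u_n| <= x_n |u_(n+1)| + y_n |u_(n-1)|].

    The form bound alone does not make [J] selfadjoint, but the two together do.  The
    adjoint of the minimal operator is the maximal one ([adjoint_minimal]), which is
    injective, so the range of the minimal operator is dense; it is closed by the a
    priori bound that compactness provides; and a surjective restriction of an
    injective operator is equal to it ([minimal_eq_maximal]).  Hence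
    [K = (J - z)^-1] is everywhere defined and compact as soon as [J - z] is injective,
    with adjoint the inverse of [J] minus the conjugate of [z]
    ([selfadjoint_resolvent]).

    For finite [q] the singular values [s_0 >= s_1 >= ...] of [K] come from successive
    maximization ([spectral_sequence]), and they are compared with the singular values
    [sg_i] of [A^-1] by a dimension count.  If [t] is a set of indices, then among the
    combinations of the images of the first [N p + |t| + 1] singular vectors of [K]
    there is one that vanishes on the first [N] sites and is orthogonal to the
    singular vectors of [A^-1] with index in [t].  On it [J] is at most
    [1 / s_(N p + |t|) + |z|], while the form bound makes [J] at least a multiple of
    the inverse of the largest [sg_i] with [i] outside [t].  So some such [sg_i] is at
    least a constant times [s_(N p + |t|)] ([singular_value_counting]), and choosing
    such indices one after the other bounds the sum of the [s_n^q] by that of the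
    [sg_i^q] ([injective_domination]). *)

(** * Complex vectors and operator norms *)

Section Vectors.
Variables (R : realType) (p : nat).
Local Notation C := R[i].
Implicit Types (u v w : 'cV[C]_p) (M N : 'M[C]_p) (c : C).

Lemma vdotE u v : vdot u v = (v^t* *m u) 0 0.
Proof.
by rewrite /vdot mxE; apply: eq_bigr => i _; rewrite !mxE mulrC.
Qed.

Lemma vdotDl u v w : vdot (u + v) w = vdot u w + vdot v w.
Proof. by rewrite !vdotE mulmxDr mxE. Qed.

Lemma vdotZl c u w : vdot (c *: u) w = c * vdot u w.
Proof. by rewrite !vdotE -scalemxAr mxE. Qed.

Lemma vdotC u v : vdot u v = (vdot v u)^*%R.
Proof.
rewrite /vdot rmorph_sum; apply: eq_bigr => i _.
by rewrite rmorphM /= Num.Theory.conjCK mulrC.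
Qed.

Lemma vdotDr u v w : vdot w (u + v) = vdot w u + vdot w v.
Proof. by rewrite vdotC vdotDl rmorphD /= -!(vdotC w). Qed.

Lemma vdotZr c u w : vdot w (c *: u) = c^*%R * vdot w u.
Proof. by rewrite vdotC vdotZl rmorphM /= -(vdotC w). Qed.

Lemma vdotNl u w : vdot (- u) w = - vdot u w.
Proof. by rewrite -scaleN1r vdotZl mulN1r. Qed.

Lemma vdotNr u w : vdot w (- u) = - vdot w u.
Proof. by rewrite -scaleN1r vdotZr rmorphN1 mulN1r. Qed.

Lemma vdotBr u v w : vdot w (u - v) = vdot w u - vdot w v.
Proof. by rewrite vdotDr vdotNr. Qed.

Lemma vdot0l w : vdot 0 w = 0.
Proof. by rewrite -(scale0r 0) vdotZl mul0r. Qed.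

Lemma vdot0r w : vdot w 0 = 0.
Proof. by rewrite -(scale0r 0) vdotZr rmorph0 mul0r. Qed.

Lemma vdot_mulmxl M u v : vdot (M *m u) v = vdot u (M^t* *m v).
Proof. by rewrite !vdotE trmx_mul map_mxM trmxCK mulmxA. Qed.

Lemma vdot_mulmxr M u v : vdot u (M *m v) = vdot (M^t* *m u) v.
Proof. by rewrite vdot_mulmxl trmxCK. Qed.

Lemma vnorm_ge0 u : 0 <= vnorm u. Proof. exact: sqrtr_ge0. Qed.

Lemma vdotxx u : vdot u u = (vnorm u ^+ 2)%:C.
Proof.
rewrite sqr_vnorm; apply/eqP; rewrite eq_complex /= eqxx /=.
rewrite raddf_sum big1// => i _.
by case: (u i 0) => a b /=; ring.
Qed.

Lemma vnorm0 : vnorm (0 : 'cV[C]_p) = 0.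
Proof. by rewrite /vnorm vdot0l sqrtr0. Qed.

Lemma vnormE u t : 0 <= t -> vnorm u ^+ 2 = t ^+ 2 -> vnorm u = t.
Proof.
by move=> t0 /eqP; rewrite eqrXn2 ?vnorm_ge0// => /eqP.
Qed.

Lemma vnormZ c u : vnorm (c *: u) = normc c * vnorm u.
Proof.
apply: vnormE; first by rewrite mulr_ge0 ?vnorm_ge0//; case: c => a b; exact: sqrtr_ge0.
rewrite sqr_vnormZ exprMn; congr (_ * _).
by case: c => a b /=; rewrite sqr_sqrtr// addr_ge0 ?sqr_ge0.
Qed.

Lemma vnormN u : vnorm (- u) = vnorm u.
Proof. by rewrite -scaleN1r vnormZ normcN normc1 mul1r. Qed.

Lemma Re_vdot_weighted u v (t : R) : 0 < t ->
  2 * complex.Re (vdot u v) <= t * vnorm u ^+ 2 + t^-1 * vnorm v ^+ 2.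
Proof.
move=> t0; rewrite !sqr_vnorm !vdotxxE raddf_sum !mulr_sumr -big_split /=.
apply: ler_sum => i _; case: (u i 0) (v i 0) => a b [x y] /=.
rewrite -subr_ge0.
have -> : t * (a ^+ 2 + b ^+ 2) + t^-1 * (x ^+ 2 + y ^+ 2) - 2 * (a * x - b * - y) =
  t^-1 * ((t * a - x) ^+ 2 + (t * b - y) ^+ 2) by field; rewrite gt_eqF.
by apply: mulr_ge0; rewrite ?invr_ge0 ?(ltW t0) ?addr_ge0 ?sqr_ge0.
Qed.

Lemma Re_vdot_le u v : complex.Re (vdot u v) <= vnorm u * vnorm v.
Proof.
have [u0|u0] := eqVneq (vnorm u) 0.
  by rewrite u0 (vnorm_eq0 u0) vdot0l mul0r.
have [v0|v0] := eqVneq (vnorm v) 0.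
  by rewrite v0 (vnorm_eq0 v0) vdot0r mulr0.
have {}u0 : 0 < vnorm u by rewrite lt_neqAle eq_sym u0 vnorm_ge0.
have {}v0 : 0 < vnorm v by rewrite lt_neqAle eq_sym v0 vnorm_ge0.
have := @Re_vdot_weighted u v (vnorm v / vnorm u) (divr_gt0 v0 u0).
have -> : vnorm v / vnorm u * vnorm u ^+ 2 + (vnorm v / vnorm u)^-1 * vnorm v ^+ 2 =
  2 * (vnorm u * vnorm v) by field; rewrite !gt_eqF.
by rewrite ler_pM2l.
Qed.

Lemma vnormD u v : vnorm (u + v) <= vnorm u + vnorm v.
Proof.
rewrite -(@ler_pXn2r _ 2%N) ?nnegrE ?addr_ge0 ?vnorm_ge0//.
rewrite sqr_vnorm vdotDl !vdotDr !raddfD /= -!sqr_vnorm.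
rewrite [X in _ + (complex.Re X + _)]vdotC.
have := Re_vdot_le u v; case: (vdot u v) => a b /=; lra.
Qed.

Lemma vnorm_delta (i : 'I_p) : vnorm (delta_mx i 0 : 'cV[C]_p) = 1.
Proof.
apply: vnormE => //; rewrite sqr_vnorm vdotxxE (bigD1 i)//= big1 => [|j ji].
  by rewrite mxE !eqxx /=; lra.
by rewrite mxE (negbTE ji) /=; lra.
Qed.

Lemma vnorm_coord u (i : 'I_p) :
  complex.Re (u i 0) ^+ 2 + complex.Im (u i 0) ^+ 2 <= vnorm u ^+ 2.
Proof.
rewrite sqr_vnorm vdotxxE (bigD1 i)//= lerDl sumr_ge0// => j _.
by rewrite addr_ge0 ?sqr_ge0.
Qed.

Lemma vdot_ext u v : (forall w, vdot w u = vdot w v) -> u = v.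
Proof.
move=> uv; apply/eqP; rewrite -subr_eq0; apply/eqP/vnorm_eq0.
apply/eqP; rewrite -sqrf_eq0; have := uv (u - v).
move/eqP; rewrite -subr_eq0 -vdotBr vdotxx => /eqP/complexI ->.
by [].
Qed.

Lemma opnorm_bounded M : exists2 b : R, 0 <= b & forall u, vnorm (M *m u) <= b * vnorm u.
Proof.
exists (\sum_(i < p) vnorm (col i M)).
  by rewrite sumr_ge0// => i _; exact: vnorm_ge0.
move=> u.
have -> : M *m u = \sum_(i < p) u i 0 *: col i M.
  apply/colP => k; rewrite mxE summxE; apply: eq_bigr => i _.
  by rewrite !mxE mulrC.
have h : forall (s : seq 'I_p), vnorm (\sum_(i <- s) u i 0 *: col i M) <=
   (\sum_(i <- s) vnorm (col i M)) * vnorm u.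
  elim=> [|i s IH]; first by rewrite !big_nil vnorm0 mul0r.
  rewrite !big_cons mulrDl (le_trans (vnormD _ _))// lerD// vnormZ mulrC.
  rewrite ler_wpM2l ?vnorm_ge0//.
  rewrite -(@ler_pXn2r _ 2%N) ?nnegrE ?vnorm_ge0//; last by case: (u i 0) => a b; exact: sqrtr_ge0.
  apply: le_trans (vnorm_coord u i).
  by case: (u i 0) => a b /=; rewrite sqr_sqrtr// addr_ge0 ?sqr_ge0.
exact: h.
Qed.

Lemma opnorm_has_sup M :
  has_sup [set vnorm (M *m u) | u in [set u : 'cV[C]_p | vnorm u <= 1]].
Proof.
split; first by exists (vnorm (M *m 0)), 0 => //=; rewrite vnorm0.
have [b b0 Mb] := opnorm_bounded M; exists b => _ [u /= u1 <-].
by rewrite (le_trans (Mb u))// ler_piMr.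
Qed.

Lemma opnorm_ge0 M : 0 <= opnorm M.
Proof.
rewrite /opnorm; apply: ub_le_sup => /=; first exact: (opnorm_has_sup M).2.
by exists 0; rewrite /= ?vnorm0// mulmx0 vnorm0.
Qed.

Lemma vnorm_mulmx M u : vnorm (M *m u) <= opnorm M * vnorm u.
Proof.
have [u0|u0] := eqVneq (vnorm u) 0.
  by rewrite u0 (vnorm_eq0 u0) mulmx0 vnorm0 mulr0.
have {}u0 : 0 < vnorm u by rewrite lt_neqAle eq_sym u0 vnorm_ge0.
have nc : normc ((vnorm u)^-1%:C) = (vnorm u)^-1 :> R.
  by rewrite /= expr0n addr0 sqrtr_sqr ger0_norm ?invr_ge0 ?vnorm_ge0.
rewrite -ler_pdivrMr// mulrC.
rewrite /opnorm; apply: ub_le_sup => /=; first exact: (opnorm_has_sup M).2.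
exists ((vnorm u)^-1%:C *: u); rewrite /= ?vnormZ ?nc ?mulVf ?gt_eqF//.
by rewrite -scalemxAr vnormZ nc.
Qed.

End Vectors.

(** * Functional calculus of a hermitian matrix *)

(** Sealed, because otherwise unification unfolds every function of a matrix into
    products of matrices. *)
HB.lock Definition undiag (R : realType) (p : nat) (P : 'M[R[i]]_p) (d : 'rV[R[i]]_p) :
  'M[R[i]]_p := P^t* *m diag_mx d *m P.

Lemma undiagE (R : realType) (p : nat) (P : 'M[R[i]]_p) d :
  undiag P d = P^t* *m diag_mx d *m P.
Proof. by rewrite undiag.unlock. Qed.

Section Spectral.
Variables (R : realType) (p : nat).
Local Notation C := R[i].
Implicit Types (u v w : 'cV[C]_p) (A B T : 'M[C]_p).

Definition eigval A (j : 'I_p) : R := complex.Re (spectral_diag A 0 j).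

Definition eigvec A (j : 'I_p) : 'cV[C]_p := (spectralmx A)^t* *m delta_mx j 0.

Definition specfun A (h : R -> R) : 'M[C]_p :=
  undiag (spectralmx A) (\row_j (h (eigval A j))%:C).

Lemma spectralmxK A : (spectralmx A)^t* *m spectralmx A = 1%:M.
Proof.
rewrite -(invmx_unitary (spectral_unitarymx A)) mulVmx//.
exact: spectral_unit.
Qed.

Lemma spectralmxKV A : spectralmx A *m (spectralmx A)^t* = 1%:M.
Proof. exact/unitarymxP/spectral_unitarymx. Qed.

Lemma specfunM A h k : specfun A h *m specfun A k = specfun A (fun a => h a * k a).
Proof.
rewrite /specfun 2!undiagE !mulmxA -(mulmxA _ (spectralmx A) (_^t*)) spectralmxKV.
rewrite mulmx1 -(mulmxA (_ ^t*)) mulmx_diag -(undiagE _ _); congr undiag.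
by apply/rowP => j; rewrite !mxE rmorphM.
Qed.

Lemma specfun_herm A h : (specfun A h)^t* = specfun A h.
Proof.
rewrite /specfun {1}undiagE !trmx_mul !map_mxM /= tr_diag_mx map_diag_mx.
rewrite mulmxA trmxCK -(undiagE _ _); congr undiag.
by apply/rowP => j; rewrite !mxE; exact: conjc_real.
Qed.

Lemma specfun1 A : specfun A (fun=> 1) = 1%:M.
Proof.
rewrite /specfun undiagE (_ : diag_mx _ = 1%:M) ?mulmx1 ?spectralmxK//.
by apply/matrixP => i j; rewrite !mxE.
Qed.

Lemma eq_specfun A h k : (forall j, h (eigval A j) = k (eigval A j)) ->
  specfun A h = specfun A k.
Proof.
move=> hk; congr undiag.
by apply/rowP => j; rewrite !mxE hk.
Qed.

Lemma specfun_id A : A^t* = A -> specfun A id = A.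
Proof.
move=> hA; have Ah : A \is hermsymmx.
  by apply/is_hermitianmxP; rewrite expr0 scale1r hA.
have /orthomx_spectralP := hermitian_normalmx Ah.
rewrite (invmx_unitary (spectral_unitarymx A)) => {2}->.
rewrite -(undiagE _ _); congr undiag; apply/rowP => j; rewrite mxE.
apply: RRe_real; have /mxOverP := hermitian_spectral_diag_real Ah; exact.
Qed.

Lemma vnorm_spectralmx A u : vnorm (spectralmx A *m u) = vnorm u.
Proof.
apply: vnormE; rewrite ?vnorm_ge0// !sqr_vnorm vdot_mulmxl mulmxA spectralmxK.
by rewrite mul1mx.
Qed.

Lemma vnorm_eigvec A j : vnorm (eigvec A j) = 1.
Proof.
rewrite -(vnorm_spectralmx A) /eigvec mulmxA spectralmxKV mul1mx.
exact: vnorm_delta.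
Qed.

Lemma specfun_eigvec A h j :
  specfun A h *m eigvec A j = (h (eigval A j))%:C *: eigvec A j.
Proof.
rewrite /specfun undiagE /eigvec -!mulmxA (mulmxA (spectralmx A)) spectralmxKV mul1mx.
rewrite scalemxAr; congr (_ *m _); apply/colP => k.
rewrite mul_diag_mx !mxE; case: eqVneq => [->//|_] /=.
by rewrite !mulr0.
Qed.

Lemma mulmx_eigvec A j : A^t* = A -> A *m eigvec A j = (eigval A j)%:C *: eigvec A j.
Proof. by move=> hA; rewrite -{1}(specfun_id hA) specfun_eigvec. Qed.

Lemma eigval_neq0 A j : A^t* = A -> A \in unitmx -> eigval A j != 0.
Proof.
move=> hA uA; apply/eqP => a0.
have := mulmx_eigvec j hA; rewrite a0 scale0r => /(congr1 (mulmx (invmx A))).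
rewrite mulmxA mulVmx// mul1mx mulmx0 => e0.
by have := vnorm_eigvec A j; rewrite e0 vnorm0 => /eqP; rewrite eq_sym oner_eq0.
Qed.

Lemma vdot_eigvec A u j : vdot u (eigvec A j) = (spectralmx A *m u) j 0.
Proof.
rewrite /eigvec vdot_mulmxr trmxCK /vdot (bigD1 j)//= big1 => [|k kj].
  by rewrite [delta_mx _ _ _ _]mxE !eqxx rmorph1 mulr1 addr0.
by rewrite [delta_mx _ _ _ _]mxE (negbTE kj) rmorph0 mulr0.
Qed.

Definition sqmod (z : C) : R := complex.Re z ^+ 2 + complex.Im z ^+ 2.

Lemma Re_vdot_specfun A h u : complex.Re (vdot (specfun A h *m u) u) =
  \sum_(j < p) h (eigval A j) * sqmod (vdot u (eigvec A j)).
Proof.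
rewrite /specfun undiagE -!mulmxA vdot_mulmxl trmxCK raddf_sum; apply: eq_bigr => j _.
rewrite vdot_eigvec /sqmod mul_diag_mx !mxE.
by set z := \sum_j0 _; case: z => a b /=; ring.
Qed.

Lemma sqr_vnorm_eigvec A u :
  vnorm u ^+ 2 = \sum_(j < p) sqmod (vdot u (eigvec A j)).
Proof.
rewrite sqr_vnorm -{1}[u]mul1mx -(specfun1 A) Re_vdot_specfun.
by apply: eq_bigr => j _; rewrite mul1r.
Qed.

Lemma sqmod_ge0 z : 0 <= sqmod z.
Proof. by rewrite addr_ge0 ?sqr_ge0. Qed.

(** For hermitian [A], [absqrt A] is [|A|^(1/2)] and [sgmx A] is the unitary factor
    of the polar decomposition [A = |A| sgmx A]. *)
Definition absqrt A := specfun A (fun a => Num.sqrt `|a|).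
Definition sgmx A := specfun A Num.sg.

Lemma absqrt_herm A : (absqrt A)^t* = absqrt A.
Proof. exact: specfun_herm. Qed.

Lemma absqrtK A : A^t* = A -> absqrt A *m absqrt A *m sgmx A = A.
Proof.
move=> hA; rewrite !specfunM -[RHS](specfun_id hA); apply: eq_specfun => j.
by rewrite -expr2 sqr_sqrtr// mulrC -numEsg.
Qed.

(** The condition need only be checked on the eigenvectors that meet [u], since both
    sides are diagonal in the eigenbasis. *)
Lemma vnorm_absqrt_ge A u (t : R) :
  (forall j, t <= `|eigval A j| \/ vdot u (eigvec A j) = 0) ->
  t * vnorm u ^+ 2 <= vnorm (absqrt A *m u) ^+ 2.
Proof.
move=> tu; rewrite [leRHS]sqr_vnorm vdot_mulmxr specfun_herm mulmxA specfunM.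
rewrite Re_vdot_specfun (sqr_vnorm_eigvec A) mulr_sumr; apply: ler_sum => j _.
rewrite -expr2 sqr_sqrtr//; case: (tu j) => [tj|->].
  by rewrite ler_wpM2r ?sqmod_ge0.
by rewrite /sqmod /= expr0n addr0 !mulr0.
Qed.

Section Unit.
Variable A : 'M[C]_p.
Hypotheses (hA : A^t* = A) (uA : A \in unitmx).

Lemma sgmxK : sgmx A *m sgmx A = 1%:M.
Proof.
rewrite specfunM -(specfun1 A); apply: eq_specfun => j.
by rewrite -expr2 sqr_sg (eigval_neq0 j hA uA).
Qed.

Lemma vnorm_sgmx u : vnorm (sgmx A *m u) = vnorm u.
Proof.
apply: vnormE; rewrite ?vnorm_ge0// !sqr_vnorm vdot_mulmxl specfun_herm mulmxA sgmxK.
by rewrite mul1mx.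
Qed.

Definition invabsqrt := specfun A (fun a => (Num.sqrt `|a|)^-1).

Lemma invabsqrt_herm : invabsqrt^t* = invabsqrt.
Proof. exact: specfun_herm. Qed.

Lemma sqrt_eigval_neq0 j : Num.sqrt `|eigval A j| != 0.
Proof. by rewrite gt_eqF// sqrtr_gt0 normr_gt0 eigval_neq0. Qed.

Lemma invabsqrtK : invabsqrt *m absqrt A = 1%:M.
Proof.
rewrite specfunM -(specfun1 A); apply: eq_specfun => j.
by rewrite mulVf ?sqrt_eigval_neq0.
Qed.

Lemma absqrtVK : absqrt A *m invabsqrt = 1%:M.
Proof.
rewrite specfunM -(specfun1 A); apply: eq_specfun => j.
by rewrite mulfV ?sqrt_eigval_neq0.
Qed.

Lemma invabsqrt2 : invabsqrt *m invabsqrt = sgmx A *m invmx A.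
Proof.
apply: (can_inj (mulmxK uA)); rewrite mulmxKV// -[X in _ *m X](specfun_id hA) !specfunM.
apply: eq_specfun => j; rewrite -expr2 exprVn sqr_sqrtr//.
by rewrite {2}[eigval A j]numEsg mulrCA mulVf ?mulr1// normr_eq0 eigval_neq0.
Qed.

Lemma vnorm_invabsqrt2 u :
  vnorm (invabsqrt *m (invabsqrt *m u)) = vnorm (invmx A *m u).
Proof. by rewrite mulmxA invabsqrt2 -mulmxA vnorm_sgmx. Qed.

Lemma vnorm_absqrt_sgmx u : vnorm (absqrt A *m (sgmx A *m u)) = vnorm (absqrt A *m u).
Proof.
have e : absqrt A *m sgmx A = sgmx A *m absqrt A.
  by rewrite /absqrt /sgmx !specfunM; apply: eq_specfun => j; rewrite mulrC.
by rewrite mulmxA e -mulmxA vnorm_sgmx.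
Qed.

Lemma Re_vdot_sgmx u :
  complex.Re (vdot (A *m u) (sgmx A *m u)) = vnorm (absqrt A *m u) ^+ 2.
Proof.
rewrite -vnorm_absqrt_sgmx sqr_vnorm -{1}(absqrtK hA) -!mulmxA.
by rewrite [in LHS]vdot_mulmxl absqrt_herm.
Qed.

End Unit.

(** This is the bound [sqrt (x * y)] for the norm of
    [M = |A|^(-1/2) B |A'|^(-1/2)].  The square of that norm is the largest eigenvalue of
    [M M^*], and [|A|^(1/2)] conjugates [M M^*] into [|A|^-1 B |A'|^-1 B^*], whose
    eigenvalues are at most [x * y] because [|A|^-1] and [A^-1] differ by a unitary
    factor. *)
Lemma Re_vdot_absqrt_le (A A' B : 'M[C]_p) (x y : R) :
  A^t* = A -> A \in unitmx -> A'^t* = A' -> A' \in unitmx -> 0 <= x -> 0 <= y ->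
  (forall u, vnorm (invmx A *m (B *m u)) <= x * vnorm u) ->
  (forall u, vnorm (invmx A' *m (B^t* *m u)) <= y * vnorm u) ->
  forall f g, complex.Re (vdot (B *m f) g) <=
    Num.sqrt (x * y) * vnorm (absqrt A' *m f) * vnorm (absqrt A *m g).
Proof.
move=> hA uA hA' uA' x0 y0 Bx By f g.
have [Q [QC QK QV Qn]] : exists Q, [/\ Q^t* = Q, Q *m absqrt A = 1%:M,
    absqrt A *m Q = 1%:M & forall u, vnorm (Q *m (Q *m u)) = vnorm (invmx A *m u)].
  exists (invabsqrt A); split; [exact: invabsqrt_herm|exact: invabsqrtK|
    exact: absqrtVK|exact: vnorm_invabsqrt2].
have [Q' [QC' QK' Qn']] : exists Q, [/\ Q^t* = Q, Q *m absqrt A' = 1%:M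
    & forall u, vnorm (Q *m (Q *m u)) = vnorm (invmx A' *m u)].
  exists (invabsqrt A'); split; [exact: invabsqrt_herm|exact: invabsqrtK|
    exact: vnorm_invabsqrt2].
have [M ME MCE] : exists2 M : 'M[C]_p, forall u, M *m u = Q *m (B *m (Q' *m u)) &
    forall u, M^t* *m u = Q' *m (B^t* *m (Q *m u)).
  exists (Q *m B *m Q') => u; first by rewrite -!mulmxA.
  by rewrite !trmx_mul !map_mxM /= QC QC' -!mulmxA.
have [T hT TE] : exists2 T : 'M[C]_p, T^t* = T & forall u, T *m u = M *m (M^t* *m u).
  by exists (M *m M^t*) => [|u]; rewrite ?mulmxA// trmx_mul map_mxM /= trmxCK.
have Tle j : eigval T j <= x * y.
  have [v v1 Tv] : exists2 v, vnorm v = 1 & T *m v = (eigval T j)%:C *: v.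
    by exists (eigvec T j); [exact: vnorm_eigvec|exact: mulmx_eigvec].
  have [w wE] : exists w, w = Q *m v by exists (Q *m v).
  have vE : v = absqrt A *m w by rewrite wE mulmxA QV mul1mx.
  have w0 : 0 < vnorm w.
    rewrite lt_neqAle vnorm_ge0 andbT eq_sym; apply/eqP => /vnorm_eq0 w0.
    by move: v1 => /eqP; rewrite vE w0 mulmx0 vnorm0 eq_sym oner_eq0.
  have e : Q *m (Q *m (B *m (Q' *m (Q' *m (B^t* *m w))))) = (eigval T j)%:C *: w.
    by move: Tv; rewrite TE MCE ME -wE => /(congr1 (mulmx Q)); rewrite -scalemxAr -wE.
  have : vnorm ((eigval T j)%:C *: w) <= x * y * vnorm w.
    by rewrite -e Qn (le_trans (Bx _))// -mulrA ler_wpM2l// Qn'.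
  rewrite vnormZ ler_pM2r//= expr0n addr0 sqrtr_sqr; apply: le_trans.
  exact: ler_norm.
have MCle h : vnorm (M^t* *m h) <= Num.sqrt (x * y) * vnorm h.
  rewrite -(@ler_pXn2r _ 2%N) ?nnegrE ?mulr_ge0 ?vnorm_ge0 ?sqrtr_ge0//.
  rewrite exprMn (sqr_sqrtr (mulr_ge0 x0 y0)) sqr_vnorm vdot_mulmxr trmxCK -TE.
  rewrite -{1}(specfun_id hT) Re_vdot_specfun (sqr_vnorm_eigvec T) mulr_sumr.
  by apply: ler_sum => j _; rewrite ler_wpM2r ?sqmod_ge0.
have -> : vdot (B *m f) g = vdot (absqrt A' *m f) (M^t* *m (absqrt A *m g)).
  rewrite vdot_mulmxr trmxCK ME (mulmxA Q') QK' mul1mx.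
  by rewrite [RHS]vdot_mulmxl QC (mulmxA Q) QK mul1mx.
by rewrite (le_trans (Re_vdot_le _ _))// -mulrA mulrCA ler_wpM2l ?vnorm_ge0.
Qed.

End Spectral.

(** * The Hilbert space of square-summable sequences *)

Section SquareSummable.
Variables (R : realType) (p : nat).
Local Notation C := R[i].
Local Notation H := (l2 R p).
Implicit Types (f g h u w : H) (c : C).

Lemma l2_addE f g n : (f + g) n = f n + g n. Proof. by []. Qed.
Lemma l2_oppE f n : (- f) n = - f n. Proof. by []. Qed.
Lemma l2_subE f g n : (f - g) n = f n - g n. Proof. by []. Qed.
Lemma l2_scaleE c f n : (c *: f) n = c *: f n. Proof. by []. Qed.
Lemma l2_0E n : (0 : H) n = 0. Proof. by []. Qed.

Lemma l2_ext f g : (forall n, f n = g n) -> f = g.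
Proof. by move=> fg; apply/val_inj/funext. Qed.

Lemma l2_sumE (I : Type) (s : seq I) (F : I -> H) n :
  (\sum_(i <- s) F i) n = \sum_(i <- s) F i n.
Proof. by elim/big_rec2: _ => // i x y _ <-. Qed.

Lemma l2energy_partial (f : nat -> 'cV[C]_p) M :
  ((\sum_(n < M) vnorm (f n) ^+ 2)%:E <= l2energy f)%E.
Proof.
rewrite -sumEFin -(big_mkord xpredT (fun n => (vnorm (f n) ^+ 2)%:E)).
by apply: nneseries_lim_ge => n _ _; rewrite lee_fin sqr_ge0.
Qed.

Lemma l2energy_le (f : nat -> 'cV[C]_p) b :
  (forall M, \sum_(n < M) vnorm (f n) ^+ 2 <= b) -> (l2energy f <= b%:E)%E.
Proof.
move=> fb; apply: lime_le.
  by apply: is_cvg_nneseries => n _ _; rewrite lee_fin sqr_ge0.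
by apply: nearW => M; rewrite sumEFin lee_fin big_mkord.
Qed.

Lemma l2_predP (f : nat -> 'cV[C]_p) b :
  (forall M, \sum_(n < M) vnorm (f n) ^+ 2 <= b) -> f \in l2_pred R p.
Proof. by move=> /l2energy_le fb; rewrite unfold_in (le_lt_trans fb) ?ltry. Qed.

Lemma partial_le_norm f M : \sum_(n < M) vnorm (f n) ^+ 2 <= `|f| ^+ 2.
Proof.
by rewrite -lee_fin (le_trans (l2energy_partial _ _))// -sqr_l2norm.
Qed.

Lemma norm_le_partial f b :
  (forall M, \sum_(n < M) vnorm (f n) ^+ 2 <= b) -> `|f| ^+ 2 <= b.
Proof. by move=> /l2energy_le; rewrite -sqr_l2norm lee_fin. Qed.

Lemma vnorm_le_norm f n : vnorm (f n) <= `|f|.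
Proof.
rewrite -(@ler_pXn2r _ 2%N) ?nnegrE ?vnorm_ge0//.
apply: le_trans (partial_le_norm f n.+1).
by rewrite big_ord_recr /= lerDr sumr_ge0// => i _; rewrite sqr_ge0.
Qed.

Lemma l2_normZ c f : `|c *: f| = normc c * `|f|.
Proof. by rewrite -[LHS]/(l2norm _) l2normZ; case: c. Qed.

(** The weighted inequality [2 a b <= t a^2 + b^2 / t], summed, with [t] the ratio of
    the two norms. *)
Lemma sum_vnormM_le f g M :
  \sum_(n < M) vnorm (f n) * vnorm (g n) <= `|f| * `|g|.
Proof.
have [->|f0] := eqVneq f 0.
  by rewrite normr0 mul0r big1// => i _; rewrite l2_0E vnorm0 mul0r.
have [->|g0] := eqVneq g 0.
  by rewrite normr0 mulr0 big1// => i _; rewrite l2_0E vnorm0 mulr0.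
have {}f0 : 0 < `|f| by rewrite normr_gt0.
have {}g0 : 0 < `|g| by rewrite normr_gt0.
pose t := `|g| / `|f|; have t0 : 0 < t by rewrite divr_gt0.
have h : 2 * \sum_(n < M) vnorm (f n) * vnorm (g n) <=
    t * \sum_(n < M) vnorm (f n) ^+ 2 + t^-1 * \sum_(n < M) vnorm (g n) ^+ 2.
  rewrite !mulr_sumr -big_split /=; apply: ler_sum => i _.
  move: (vnorm (f i)) (vnorm (g i)) => a b; rewrite -subr_ge0.
  have -> : t * a ^+ 2 + t^-1 * b ^+ 2 - 2 * (a * b) = t^-1 * (t * a - b) ^+ 2.
    by field; rewrite gt_eqF.
  by rewrite mulr_ge0 ?sqr_ge0// invr_ge0 ltW.
rewrite -(@ler_pM2l _ 2)//; apply: (le_trans h).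
have -> : 2 * (`|f| * `|g|) = t * `|f| ^+ 2 + t^-1 * `|g| ^+ 2.
  by rewrite /t; field; rewrite !gt_eqF.
by rewrite lerD// ler_wpM2l ?invr_ge0 ?(ltW t0)// partial_le_norm.
Qed.

Lemma is_cvg_series_abs (a : R^nat) b :
  (forall M, \sum_(n < M) `|a n| <= b) -> cvgn (series a).
Proof.
move=> ab; apply: normed_cvg; apply: nondecreasing_is_cvgn.
  by apply: nondecreasing_series => n _ _; exact: normr_ge0.
exists b => _ [M _ <-].
by have := ab M; rewrite -(big_mkord xpredT (fun n => `|a n|)).
Qed.

Lemma Re_vdot_abs (x y : 'cV[C]_p) : `|complex.Re (vdot x y)| <= vnorm x * vnorm y.
Proof.
rewrite ler_norml Re_vdot_le andbT lerNl -[vnorm x]vnormN.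
by apply: le_trans (Re_vdot_le _ _); rewrite vdotNl raddfN.
Qed.

(** Reduces estimates of imaginary parts to estimates of real parts. *)
Lemma ImE (z : C) : complex.Im z = complex.Re ((0 -i* 1) * z).
Proof. by case: z => a b /=; lra. Qed.

Lemma normc_i : normc (0 -i* 1 : C) = 1.
Proof. by rewrite /= expr0n add0r sqrrN expr1n sqrtr1. Qed.

Lemma Im_vdot_abs (x y : 'cV[C]_p) : `|complex.Im (vdot x y)| <= vnorm x * vnorm y.
Proof.
rewrite ImE -vdotZl; apply: (le_trans (Re_vdot_abs _ _)).
by rewrite vnormZ normc_i mul1r.
Qed.

Lemma cvg_Re_l2dot f g :
  series (fun n => complex.Re (vdot (f n) (g n))) @ \oo --> complex.Re (l2dot f g).
Proof.
apply: (@is_cvg_series_abs _ (`|f| * `|g|)) => M.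
by apply: le_trans (sum_vnormM_le f g M); apply: ler_sum => i _; exact: Re_vdot_abs.
Qed.

Lemma cvg_Im_l2dot f g :
  series (fun n => complex.Im (vdot (f n) (g n))) @ \oo --> complex.Im (l2dot f g).
Proof.
apply: (@is_cvg_series_abs _ (`|f| * `|g|)) => M.
by apply: le_trans (sum_vnormM_le f g M); apply: ler_sum => i _; exact: Im_vdot_abs.
Qed.

Lemma l2dot_unique f g z :
  series (fun n => complex.Re (vdot (f n) (g n))) @ \oo --> complex.Re z ->
  series (fun n => complex.Im (vdot (f n) (g n))) @ \oo --> complex.Im z ->
  l2dot f g = z.
Proof.
move=> Rez Imz; rewrite /l2dot (cvg_lim _ Rez)// (cvg_lim _ Imz)//.
by case: z {Rez Imz}.
Qed.

Lemma seriesDE (a b : R^nat) : series (fun n => a n + b n) = series a \+ series b.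
Proof. by apply/funext => n; rewrite /series /= big_split. Qed.

Lemma seriesZE (k : R) (a : R^nat) : series (fun n => k * a n) = (fun n => k * series a n).
Proof. by apply/funext => n; rewrite /series /= mulr_sumr. Qed.

Lemma ReD (x y : C) : complex.Re (x + y) = complex.Re x + complex.Re y.
Proof. by case: x y => a b [c d]. Qed.

Lemma ImD (x y : C) : complex.Im (x + y) = complex.Im x + complex.Im y.
Proof. by case: x y => a b [c d]. Qed.

Lemma l2dotDl f g h : l2dot (f + g) h = l2dot f h + l2dot g h.
Proof.
apply: l2dot_unique.
  rewrite ReD (_ : (fun n => _) =
    (fun n => complex.Re (vdot (f n) (h n)) + complex.Re (vdot (g n) (h n)))).
    by rewrite seriesDE; apply: cvgD; exact: cvg_Re_l2dot.
  by apply/funext => n; rewrite l2_addE vdotDl ReD.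
rewrite ImD (_ : (fun n => _) =
  (fun n => complex.Im (vdot (f n) (h n)) + complex.Im (vdot (g n) (h n)))).
  by rewrite seriesDE; apply: cvgD; exact: cvg_Im_l2dot.
by apply/funext => n; rewrite l2_addE vdotDl ImD.
Qed.

Lemma l2dotZl c f h : l2dot (c *: f) h = c * l2dot f h.
Proof.
have ReM (z : C) : complex.Re (c * z) =
    complex.Re c * complex.Re z + (- complex.Im c) * complex.Im z.
  by case: (c) z => a b [x y] /=; ring.
have ImM (z : C) : complex.Im (c * z) =
    complex.Re c * complex.Im z + complex.Im c * complex.Re z.
  by case: (c) z => a b [x y] /=; ring.
apply: l2dot_unique.
  rewrite ReM (_ : (fun n => _) =
    (fun n => complex.Re c * complex.Re (vdot (f n) (h n)) +
              (- complex.Im c) * complex.Im (vdot (f n) (h n)))).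
    rewrite seriesDE !seriesZE.
    by apply: cvgD; apply: cvgMr; [exact: cvg_Re_l2dot|exact: cvg_Im_l2dot].
  by apply/funext => n; rewrite l2_scaleE vdotZl ReM.
rewrite ImM (_ : (fun n => _) =
  (fun n => complex.Re c * complex.Im (vdot (f n) (h n)) +
            complex.Im c * complex.Re (vdot (f n) (h n)))).
  rewrite seriesDE !seriesZE.
  by apply: cvgD; apply: cvgMr; [exact: cvg_Im_l2dot|exact: cvg_Re_l2dot].
by apply/funext => n; rewrite l2_scaleE vdotZl ImM.
Qed.

Lemma ReJ (z : C) : complex.Re (z^*%R) = complex.Re z. Proof. by case: z. Qed.

Lemma ImJ (z : C) : complex.Im (z^*%R) = (-1) * complex.Im z.
Proof. by case: z => a b; rewrite mulN1r. Qed.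

Lemma l2dotC f g : l2dot f g = (l2dot g f)^*%R.
Proof.
apply: l2dot_unique.
  rewrite ReJ (_ : (fun n => _) = (fun n => complex.Re (vdot (g n) (f n)))).
    exact: cvg_Re_l2dot.
  by apply/funext => n; rewrite vdotC ReJ.
rewrite ImJ (_ : (fun n => _) = (fun n => (-1) * complex.Im (vdot (g n) (f n)))).
  by rewrite seriesZE; apply: cvgMr; exact: cvg_Im_l2dot.
by apply/funext => n; rewrite vdotC ImJ.
Qed.

Lemma l2dotDr f g h : l2dot h (f + g) = l2dot h f + l2dot h g.
Proof. by rewrite l2dotC l2dotDl rmorphD /= -!(l2dotC h). Qed.

Lemma l2dotZr c f h : l2dot h (c *: f) = c^*%R * l2dot h f.
Proof. by rewrite l2dotC l2dotZl rmorphM /= -(l2dotC h). Qed.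

Lemma l2dotNl f h : l2dot (- f) h = - l2dot f h.
Proof. by rewrite -scaleN1r l2dotZl mulN1r. Qed.

Lemma l2dotNr f h : l2dot h (- f) = - l2dot h f.
Proof. by rewrite l2dotC l2dotNl rmorphN /= -(l2dotC h). Qed.

Lemma l2dotBl f g h : l2dot (f - g) h = l2dot f h - l2dot g h.
Proof. by rewrite l2dotDl l2dotNl. Qed.

Lemma l2dotBr f g h : l2dot h (f - g) = l2dot h f - l2dot h g.
Proof. by rewrite l2dotDr l2dotNr. Qed.

Lemma l2dot0l h : l2dot 0 h = 0.
Proof. by rewrite -(scale0r 0) l2dotZl mul0r. Qed.

Lemma l2dot0r h : l2dot h 0 = 0.
Proof. by rewrite l2dotC l2dot0l rmorph0. Qed.

Lemma l2dot_suml (I : Type) (s : seq I) (F : I -> H) h :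
  l2dot (\sum_(i <- s) F i) h = \sum_(i <- s) l2dot (F i) h.
Proof.
by elim: s => [|i s IH]; rewrite ?big_nil ?l2dot0l// !big_cons l2dotDl IH.
Qed.

Lemma l2dot_sumr (I : Type) (s : seq I) (F : I -> H) h :
  l2dot h (\sum_(i <- s) F i) = \sum_(i <- s) l2dot h (F i).
Proof.
by elim: s => [|i s IH]; rewrite ?big_nil ?l2dot0r// !big_cons l2dotDr IH.
Qed.

Lemma l2dotxx f : l2dot f f = (`|f| ^+ 2)%:C.
Proof.
apply: l2dot_unique => /=.
  rewrite (_ : (fun n => _) = (fun n => vnorm (f n) ^+ 2)); last first.
    by apply/funext => n; rewrite sqr_vnorm.
  have cv : (fun n => \sum_(0 <= i < n) (vnorm (f i) ^+ 2)%:E)%E @ \oo -->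
      (`|f| ^+ 2)%:E.
    rewrite sqr_l2norm; apply: is_cvg_nneseries => n _ _.
    by rewrite lee_fin sqr_ge0.
  rewrite (_ : series _ = fine \o (fun n => \sum_(0 <= i < n) (vnorm (f i) ^+ 2)%:E)%E).
    exact: fine_cvg cv.
  by apply/funext => n /=; rewrite sumEFin.
rewrite (_ : (fun n => _) = (fun n => 0 * 0)).
  by rewrite seriesZE (_ : (fun n => _) = cst 0) ?mul0r//; [exact: cvg_cst|apply/funext => n; rewrite mul0r].
by apply/funext => n; rewrite vdotxx mul0r.
Qed.
End SquareSummable.

(** * Finitely supported sequences, tails and closures *)

Section RealSums.
Variable R : realType.
Implicit Types (a : nat -> R).

Lemma sum_le_widen a M M' : (forall n, 0 <= a n) -> (M <= M')%N ->
  \sum_(n < M) a n <= \sum_(n < M') a n.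
Proof.
move=> a0 MM'; rewrite -!(big_mkord xpredT a) (@big_cat_nat _ _ _ M 0 M')//=.
by rewrite lerDl sumr_ge0.
Qed.

Lemma sum_vanish (V : nmodType) (a : nat -> V) N M :
  (forall n, (N <= n)%N -> a n = 0) -> (N <= M)%N ->
  \sum_(n < M) a n = \sum_(n < N) a n.
Proof.
move=> a0 NM; rewrite -!(big_mkord xpredT a) (@big_cat_nat _ _ _ N 0 M)//=.
by rewrite [X in _ + X]big_nat_cond [X in _ + X]big1 ?addr0// => n /andP[/andP[/a0]].
Qed.

Lemma sum_tailE a m M : (m <= M)%N ->
  \sum_(m <= n < M) a n = \sum_(n < M) a n - \sum_(n < m) a n.
Proof.
move=> mM; rewrite -!(big_mkord xpredT a) (@big_cat_nat _ _ _ m 0 M)//=.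
by rewrite addrAC subrr add0r.
Qed.

Lemma sum_split_nat a m M : (m <= M)%N ->
  \sum_(n < M) a n = \sum_(n < m) a n + \sum_(m <= n < M) a n.
Proof. by move=> mM; rewrite sum_tailE// addrC subrK. Qed.

Lemma sum_tail_le a b m M : (forall n, (m <= n)%N -> a n <= b n) ->
  \sum_(m <= n < M) a n <= \sum_(m <= n < M) b n.
Proof.
move=> ab; rewrite big_nat_cond [leRHS]big_nat_cond.
by apply: ler_sum => n /andP[/andP[/ab]].
Qed.

Lemma le_of_eps (x y : R) : (forall e, 0 < e -> x <= y + e) -> x <= y.
Proof. by move=> h; apply/ler_addgt0Pr. Qed.
End RealSums.

Section L2More.
Variables (R : realType) (p : nat).
Local Notation C := R[i].
Local Notation H := (l2 R p).
Implicit Types (f g h u w : H) (c : C).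

Lemma l2dot_fin f g M : (forall n, (M <= n)%N -> vdot (f n) (g n) = 0) ->
  l2dot f g = \sum_(n < M) vdot (f n) (g n).
Proof.
move=> fg0; apply: l2dot_unique; apply: cvg_near_cst; exists M => // k /= Mk.
  rewrite /series /= big_mkord (@sum_vanish _ (fun n => complex.Re (vdot (f n) (g n))) M)//.
    by elim/big_rec2: _ => // i x y _ ->; rewrite ReD.
  by move=> n Mn; rewrite fg0.
rewrite /series /= big_mkord (@sum_vanish _ (fun n => complex.Im (vdot (f n) (g n))) M)//.
  by elim/big_rec2: _ => // i x y _ ->; rewrite ImD.
by move=> n Mn; rewrite fg0.
Qed.

Lemma finitely_supported_l2 (f : nat -> 'cV[C]_p) :
  finitely_supported f -> f \in l2_pred R p.
Proof.
move=> [N fN]; apply: (@l2_predP _ _ _ (\sum_(n < N) vnorm (f n) ^+ 2)) => M.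
rewrite -(@sum_vanish R (fun n => vnorm (f n) ^+ 2) N (maxn M N)) ?leq_maxr// => [|n Nn].
  by apply: (@sum_le_widen R (fun n => vnorm (f n) ^+ 2)); rewrite ?leq_maxl// => n; rewrite sqr_ge0.
by rewrite fN// vnorm0 expr0n.
Qed.

Definition fin_l2 (f : nat -> 'cV[C]_p) (hf : finitely_supported f) : H := L2 (finitely_supported_l2 hf).

Definition single (n : nat) (v : 'cV[C]_p) (m : nat) : 'cV[C]_p :=
  if m == n then v else 0.

Lemma single_fin n v : finitely_supported (single n v).
Proof. by exists n.+1 => m nm; rewrite /single gtn_eqF. Qed.

Definition unit_l2 n v : H := fin_l2 (single_fin n v).

Lemma l2dot_unitl n v g : l2dot (unit_l2 n v) g = vdot v (g n).
Proof.
rewrite (@l2dot_fin _ _ n.+1) => [|m nm]; last by rewrite /= /single gtn_eqF// vdot0l.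
rewrite big_ord_recr big1 /= ?/single ?eqxx ?add0r// => i _.
by rewrite ltn_eqF// vdot0l.
Qed.

Lemma norm_unit n v : `|unit_l2 n v| = vnorm v.
Proof.
apply/eqP; rewrite -(@eqrXn2 _ 2%N)// ?vnorm_ge0//; apply/eqP/complexI.
by rewrite -l2dotxx l2dot_unitl -vdotxx /= /single eqxx.
Qed.

Definition trunc_fun f M n : 'cV[C]_p := if (n < M)%N then f n else 0.

Lemma trunc_fin f M : finitely_supported (trunc_fun f M).
Proof. by exists M => n; rewrite /trunc_fun leqNgt; case: ltnP. Qed.

Definition trunc f M : H := fin_l2 (trunc_fin f M).

Lemma truncE f M n : trunc f M n = if (n < M)%N then f n else 0.
Proof. by []. Qed.

Lemma unit_l2E n v m : unit_l2 n v m = if m == n then v else 0.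
Proof. by []. Qed.

Lemma l2_tail f (e : R) : 0 < e -> exists m, forall M,
  \sum_(m <= n < M) vnorm (f n) ^+ 2 <= e.
Proof.
move=> e0; apply: contrapT => /forallNP h.
suff : `|f| ^+ 2 <= `|f| ^+ 2 - e by lra.
apply: norm_le_partial => M; have /existsNP[M' /negP] := h M; rewrite -ltNge => eM.
have MM' : (M <= M')%N.
  by rewrite leqNgt; apply/negP => M'M; move: eM; rewrite big_geq ?ltNge ?ltW// ltnW.
have := partial_le_norm f M'; rewrite sum_tailE// in eM; lra.
Qed.

Lemma trunc_approx f (e : R) : 0 < e -> exists M, `|f - trunc f M| < e.
Proof.
move=> e0; have [M fM] := l2_tail f (divr_gt0 (exprn_gt0 2 e0) (ltr0Sn R 1)).
exists M; rewrite -(@ltr_pXn2r _ 2%N) ?nnegrE ?(ltW e0)//.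
apply: (@le_lt_trans _ _ (e ^+ 2 / 2)); last by have := exprn_gt0 2 e0; lra.
apply: norm_le_partial => M'; apply: le_trans (fM (maxn M M')).
have h0 n : 0 <= vnorm ((f - trunc f M) n) ^+ 2 by rewrite sqr_ge0.
rewrite (le_trans (@sum_le_widen R (fun n => vnorm ((f - trunc f M) n) ^+ 2) _ _ h0 (leq_maxr M M')))//.
rewrite (@sum_split_nat R (fun n => vnorm ((f - trunc f M) n) ^+ 2) _ _ (leq_maxl M M')) big1 ?add0r.
  by apply: sum_tail_le => n Mn; rewrite l2_subE truncE ltnNge Mn /= subr0.
by move=> n _; rewrite l2_subE truncE ltn_ord subrr vnorm0 expr0n.
Qed.

Lemma Re_l2dot_le f g : complex.Re (l2dot f g) <= `|f| * `|g|.
Proof.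
have cv := @cvg_Re_l2dot _ _ f g; rewrite -(cvg_lim _ cv)//.
apply: limr_le; first by apply/cvg_ex; eexists; exact: cv.
apply: nearW => M; rewrite /series /= big_mkord; apply: le_trans (sum_vnormM_le f g M).
by apply: ler_sum => i _; exact: Re_vdot_le.
Qed.

(** Rotating [f] by the conjugate of [l2dot f g] makes the inner product real, so the
    bound for real parts suffices. *)
Lemma normc_l2dot_le f g : normc (l2dot f g) <= `|f| * `|g|.
Proof.
set z := l2dot f g; have [->|z0] := eqVneq z 0; first by rewrite normc0 mulr_ge0.
have nz : 0 < normc z.
  rewrite lt_neqAle eq_sym; apply/andP; split; last by case: (z) => a b; exact: sqrtr_ge0.
  by apply: contra z0 => /eqP/eq0_normc ->.
rewrite -(ler_pM2l nz).
have := Re_l2dot_le (z^*%R *: f) g; rewrite l2dotZl l2_normZ -/z -mulrA.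
have -> : normc (z^*%R) = normc z by case: (z) => a b /=; rewrite sqrrN.
apply: le_trans; case: (z) => a b /=; rewrite -expr2 sqr_sqrtr ?addr_ge0 ?sqr_ge0//.
by lra.
Qed.

Lemma sqr_norm_Re f : `|f| ^+ 2 = complex.Re (l2dot f f).
Proof. by rewrite l2dotxx. Qed.

Lemma ReN (z : C) : complex.Re (- z) = - complex.Re z. Proof. by case: z. Qed.

Lemma Re_l2dotC f g : complex.Re (l2dot f g) = complex.Re (l2dot g f).
Proof. by rewrite l2dotC ReJ. Qed.

Lemma sqr_normB f g :
  `|f - g| ^+ 2 = `|f| ^+ 2 - 2 * complex.Re (l2dot f g) + `|g| ^+ 2.
Proof.
rewrite !sqr_norm_Re l2dotBl !l2dotBr !(ReD, ReN) (Re_l2dotC g f); ring.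
Qed.

Lemma l2_parallelogram f g : `|f + g| ^+ 2 + `|f - g| ^+ 2 = 2 * `|f| ^+ 2 + 2 * `|g| ^+ 2.
Proof.
have h1 := sqr_normB f (- g); rewrite opprK l2dotNr ReN normrN in h1.
have h2 := sqr_normB f g; move: h1 h2.
by set a := `|f + g|; set a' := `|f - g|; set b := `|f|; set b' := `|g|; lra.
Qed.

Lemma ball_l2E f (e : R) g : ball f e g = (`|f - g| < e) :> Prop.
Proof. by rewrite -ball_normE. Qed.

Lemma closure_pairP (G : set (H * H)) z : closure G z <->
  forall e : R, 0 < e -> exists w : H * H, [/\ G w, `|z.1 - w.1| < e & `|z.2 - w.2| < e].
Proof.
split=> [Gz e e0|Gz B /nbhs_ballP[e e0 eB]].
  have [w [Gw [w1 w2]]] := Gz _ (nbhsx_ballx z e e0).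
  by exists w; split; [exact: Gw|rewrite -ball_l2E; exact: w1|rewrite -ball_l2E; exact: w2].
have [w [Gw w1 w2]] := Gz e e0; exists w; split; first exact: Gw.
by apply: eB; split; rewrite ball_l2E; [exact: w1|exact: w2].
Qed.

Lemma closure_l2P (S : set H) f : closure S f <->
  forall e : R, 0 < e -> exists2 g, S g & `|f - g| < e.
Proof.
split=> [Gz e e0|Gz B /nbhs_ballP[e e0 eB]].
  have [w [Gw w1]] := Gz _ (nbhsx_ballx f e e0).
  by exists w; [exact: Gw|rewrite -ball_l2E; exact: w1].
have [w Gw w1] := Gz e e0; exists w; split; first exact: Gw.
by apply: eB; rewrite ball_l2E; exact: w1.
Qed.

End L2More.

(** * Compactness from uniformly small tails *)

Section Compactness.
Variables (R : realType) (p : nat).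
Local Notation C := R[i].
Local Notation H := (l2 R p).
Implicit Types (f g h u w : H) (c : C).

(** In [l2], a bounded set is precompact as soon as its tails are uniformly small. *)
Definition tight (S : set H) := forall e : R, 0 < e -> exists m, forall f, S f ->
  forall M, \sum_(m <= n < M) vnorm (f n) ^+ 2 <= e.

Lemma ultra_bounded_cvg (T : Type) (F : set_system T) (r : T -> R) (b : R) :
  UltraFilter F -> F [set x | `|r x| <= b] ->
  exists a, forall e, 0 < e -> F [set x | `|r x - a| < e].
Proof.
move=> FU Fb; have FF : ProperFilter (r @ F) by exact: fmap_proper_filter.
have [|a [_ ra]] := @segment_compact R (- b) b (r @ F) FF.
  by apply: filterS Fb => x xb; rewrite /= in_itv /= -ler_norml; exact: xb.
exists a => e e0; have [//|Fn] := in_ultra_setVsetC [set x | `|r x - a| < e] FU.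
have [y [/= y1 y2]] := ra [set y | ~ (`|y - a| < e)] _ Fn (nbhsx_ballx a e e0).
by exfalso; apply: y1; rewrite distrC.
Qed.

Lemma vnorm_le_of_coords (v : 'cV[C]_p) (e : R) : 0 <= e ->
  (forall i, `|complex.Re (v i 0)| <= e /\ `|complex.Im (v i 0)| <= e) ->
  vnorm v ^+ 2 <= (2 * p%:R) * e ^+ 2.
Proof.
move=> e0 h; rewrite sqr_vnorm vdotxxE.
apply: (@le_trans _ _ (\sum_(i < p) 2 * e ^+ 2)).
  apply: ler_sum => i _; have [h1 h2] := h i.
  rewrite -(real_normK (num_real (complex.Re _))) -(real_normK (num_real (complex.Im _))).
  by rewrite mulr2n mulrDl !mul1r lerD// ler_pXn2r// nnegrE.
by rewrite sumr_const card_ord -[_ *+ p]mulr_natl mulrCA mulrA.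
Qed.

(** Along an ultrafilter every coordinate converges.  The limits of the coordinates form
    an element of [l2] by Fatou's argument, and its tails inherit the uniform bound, so
    that convergence of finitely many coordinates gives convergence in norm. *)
Lemma tight_ultra (F : set_system H) (S : set H) (b : R) : UltraFilter F -> F S ->
  (forall f, S f -> `|f| <= b) -> tight S ->
  exists g, forall e, 0 < e -> F [set f | `|f - g| < e].
Proof.
move=> FU FS Sb St.
have coord n : exists v : 'cV[C]_p, forall e, 0 < e -> F [set f : H | vnorm (f n - v) ^+ 2 <= e].
  have bd f i : S f -> `|complex.Re (f n i 0)| <= b /\ `|complex.Im (f n i 0)| <= b.
    move=> Sf; have fb := le_trans (vnorm_le_norm f n) (Sb f Sf).
    have b0 : 0 <= b by apply: le_trans fb; exact: vnorm_ge0.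
    have h := vnorm_coord (f n) i.
    have h2 : vnorm (f n) ^+ 2 <= b ^+ 2 by rewrite ler_pXn2r// nnegrE ?vnorm_ge0.
    have s1 := sqr_ge0 (complex.Re (f n i 0)); have s2 := sqr_ge0 (complex.Im (f n i 0)).
    by split; rewrite -(@ler_pXn2r _ 2%N) ?nnegrE// real_normK ?num_real//; lra.
  have /choice[a aP] : forall i, exists a, forall e, 0 < e ->
      F [set f : H | `|complex.Re (f n i 0) - a| < e].
    move=> i; apply: (@ultra_bounded_cvg _ _ _ b) => //.
    by apply: filterS FS => f /(bd f i)[].
  have /choice[a' a'P] : forall i, exists a, forall e, 0 < e ->
      F [set f : H | `|complex.Im (f n i 0) - a| < e].
    move=> i; apply: (@ultra_bounded_cvg _ _ _ b) => //.
    by apply: filterS FS => f /(bd f i)[].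
  exists (\col_i (a i +i* a' i)) => e e0.
  have q0 : 0 < 2 * p%:R + 1 :> R by rewrite ltr_wpDl// mulr_ge0.
  pose d := Num.sqrt (e / (2 * p%:R + 1)).
  have d0 : 0 < d by rewrite sqrtr_gt0 divr_gt0.
  have Fd : F [set f : H | forall i : 'I_p, `|complex.Re (f n i 0) - a i| < d /\
      `|complex.Im (f n i 0) - a' i| < d].
    apply: (@filter_forall _ _ (fun (i : 'I_p) (f : H) => `|complex.Re (f n i 0) - a i| < d /\
      `|complex.Im (f n i 0) - a' i| < d)) => i.
    by apply: filterS2 (aP i d d0) (a'P i d d0).
  apply: filterS Fd => f /= fd; apply: (@le_trans _ _ ((2 * p%:R) * d ^+ 2)).
    apply: vnorm_le_of_coords => [|i]; first exact: ltW.
    have [f1 f2] := fd i; rewrite !mxE; case: (f n i 0) f1 f2 => x y /= f1 f2.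
    by rewrite !ltW.
  rewrite sqr_sqrtr; last by rewrite divr_ge0 ?ltW.
  rewrite mulrA ler_pdivrMr// mulrC ler_wpM2l ?ltW//; lra.
have {coord}/choice[g gP] := coord.
have sums (e : R) M : 0 < e -> F [set f : H | \sum_(n < M) vnorm (f n - g n) ^+ 2 <= e].
  move=> e0; elim: M e e0 => [|M IH] e e0.
    by apply: filterS FS => f _ /=; rewrite big_ord0 ltW.
  have e20 : 0 < e / 2 by rewrite divr_gt0.
  apply: filterS2 (IH _ e20) (gP M _ e20) => f /= f1 f2.
  by rewrite big_ord_recr /=; lra.
have sqB (x y : 'cV[C]_p) : vnorm (x - y) ^+ 2 <= 2 * vnorm x ^+ 2 + 2 * vnorm y ^+ 2.
  by have := @sqr_vnormD_le _ _ x (- y) 1 ltr01; rewrite vnormN invr1; lra.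
have sqE (x y : 'cV[C]_p) : vnorm y ^+ 2 <= 2 * vnorm x ^+ 2 + 2 * vnorm (x - y) ^+ 2.
  by have := sqB x (x - y); rewrite opprB addrC subrK.
have g2 : g \in l2_pred R p.
  apply: (@l2_predP _ _ _ (2 * b ^+ 2 + 2)) => M.
  have [f [/= fM Sf]] := filter_ex (filterI (sums 1 M ltr01) FS).
  apply: (@le_trans _ _ (\sum_(n < M) (2 * vnorm (f n) ^+ 2 + 2 * vnorm (f n - g n) ^+ 2))).
    by apply: ler_sum => n _; exact: sqE.
  rewrite big_split /= -!mulr_sumr lerD//; last by rewrite -[leRHS]mulr1 ler_wpM2l.
  have b0 : 0 <= b := le_trans (normr_ge0 f) (Sb f Sf).
  by rewrite ler_wpM2l// (le_trans (partial_le_norm _ _))// ler_pXn2r ?nnegrE// Sb.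
(* The error is at most [d] on the first [m] sites and [2 d + 8 d] beyond them. *)
exists (L2 g2) => e e0; pose d := e ^+ 2 / 16.
have d0 : 0 < d by rewrite divr_gt0// exprn_gt0.
have [m mP] := St d d0.
have gtail M : \sum_(m <= n < M) vnorm (g n) ^+ 2 <= 4 * d.
  have [f [/= fM Sf]] := filter_ex (filterI (sums d M d0) FS).
  have [Mm|mM] := leqP M m; first by rewrite big_geq// mulr_ge0 ?ltW.
  apply: (@le_trans _ _ (\sum_(m <= n < M) (2 * vnorm (f n) ^+ 2 + 2 * vnorm (f n - g n) ^+ 2))).
    by apply: sum_tail_le => n _; exact: sqE.
  rewrite big_split /= -!mulr_sumr; have := mP f Sf M.
  have := @sum_split_nat R (fun n => vnorm (f n - g n) ^+ 2) m M (ltnW mM).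
  have : 0 <= \sum_(n < m) vnorm (f n - g n) ^+ 2 by rewrite sumr_ge0// => i _; rewrite sqr_ge0.
  lra.
apply: filterS2 FS (sums d m d0) => f Sf /= fm.
rewrite -(@ltr_pXn2r _ 2%N) ?nnegrE ?(ltW e0)//.
apply: (@le_lt_trans _ _ (11 * d)); last by rewrite /d; have := exprn_gt0 2 e0; lra.
apply: norm_le_partial => M.
rewrite (le_trans (@sum_le_widen R (fun n => vnorm ((f - L2 g2) n) ^+ 2) _ _ _ (leq_maxr m M)))//.
  by move=> n; rewrite sqr_ge0.
rewrite (@sum_split_nat R (fun n => vnorm ((f - L2 g2) n) ^+ 2) _ _ (leq_maxl m M)).
have : \sum_(m <= n < maxn m M) vnorm ((f - L2 g2) n) ^+ 2 <=
   \sum_(m <= n < maxn m M) (2 * vnorm (f n) ^+ 2 + 2 * vnorm (g n) ^+ 2).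
  by apply: sum_tail_le => n _; exact: sqB.
rewrite big_split /= -!mulr_sumr; have := mP f Sf (maxn m M).
have := gtail (maxn m M); move: fm; set X := \sum_(n < m) _.
lra.
Qed.

Lemma bounded_closure (S : set H) b : (forall f, S f -> `|f| <= b) ->
  forall f, closure S f -> `|f| <= b.
Proof.
move=> Sb f /closure_l2P Sf; apply: le_of_eps => e e0.
have [g Sg fg] := Sf e e0; rewrite -(subrK g f) (le_trans (ler_normD _ _))// addrC.
by rewrite lerD ?Sb// ltW.
Qed.

Lemma tight_closure (S : set H) : tight S -> tight (closure S).
Proof.
move=> St e e0; have e4 : 0 < e / 4 by rewrite divr_gt0.
have [m mP] := St _ e4; exists m => f /closure_l2P Sf M.
have d0 : 0 < Num.sqrt (e / 4) by rewrite sqrtr_gt0.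
have [g Sg fg] := Sf _ d0.
have [Mm|mM] := leqP M m; first by rewrite big_geq// ltW.
apply: (@le_trans _ _ (\sum_(m <= n < M) (2 * vnorm (g n) ^+ 2 + 2 * vnorm ((f - g) n) ^+ 2))).
  apply: sum_tail_le => n _; have := @sqr_vnormD_le _ _ (g n) ((f - g) n) 1 ltr01.
  by rewrite invr1 l2_subE addrC subrK; lra.
rewrite big_split /= -!mulr_sumr; have := mP g Sg M.
have := @sum_split_nat R (fun n => vnorm ((f - g) n) ^+ 2) m M (ltnW mM).
have : 0 <= \sum_(n < m) vnorm ((f - g) n) ^+ 2 by rewrite sumr_ge0// => i _; rewrite sqr_ge0.
have := partial_le_norm (f - g) M.
have : `|f - g| ^+ 2 <= e / 4.
  by rewrite -[leRHS]sqr_sqrtr ?(ltW e4)// ler_pXn2r ?nnegrE ?(ltW d0)// ltW.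
lra.
Qed.

Lemma tight_precompact (S : set H) b : (forall f, S f -> `|f| <= b) -> tight S ->
  precompact S.
Proof.
move=> Sb St; rewrite precompactE compact_ultra => F FU FS.
have [g gP] := tight_ultra FU FS (bounded_closure Sb) (tight_closure St).
have Fg : F --> g.
  by apply/fcvgrPdist_lt => e e0; have := gP e e0; apply: filterS => f /=; rewrite distrC.
exists g; split=> //; apply: (closed_closure (A := S)).
move=> B /Fg FB; have [f [? ?]] := filter_ex (filterI FS FB); by exists f.
Qed.

(** Compactness enters all later arguments in this sequential form, which avoids the
    extraction of subsequences. *)
Lemma precompact_cluster (S : set H) (u : nat -> H) : precompact S ->
  (forall k, S (u k)) ->
  exists g, forall (e : R) k0, 0 < e -> exists2 k, (k0 <= k)%N & `|u k - g| < e.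
Proof.
rewrite precompactE => cS Su.
have [|g [_ ug]] := cS (u @ \oo) _.
  by exists 0%N => // k _ /=; exact: subset_closure.
exists g => e k0 e0.
have [|y [[k /= kk <-] gy]] := ug (u @` [set k | (k0 <= k)%N]) (ball g e) _ (nbhsx_ballx g e e0).
  by exists k0 => // k /= kk; exists k.
by exists k; [exact: kk|rewrite distrC -ball_l2E; exact: gy].
Qed.

Lemma tight_cluster (u : nat -> H) b : (forall k, `|u k| <= b) -> tight (range u) ->
  exists g, forall (e : R) k0, 0 < e -> exists2 k, (k0 <= k)%N & `|u k - g| < e.
Proof.
move=> ub ut; apply: (@precompact_cluster (range u)) => [|k]; last by exists k.
by apply: (@tight_precompact _ b) => // _ [k _ <-].
Qed.

End Compactness.

(** * Completeness and orthogonal complements *)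

Section Projection.
Variables (R : realType) (p : nat).
Local Notation C := R[i].
Local Notation H := (l2 R p).
Implicit Types (f g h u w : H) (c : C).

(** A Cauchy sequence is bounded and tight, hence has a cluster point, which is then its
    limit. *)
Lemma l2_complete (u : nat -> H) :
  (forall e : R, 0 < e -> exists k0, forall k l, (k0 <= k)%N -> (k0 <= l)%N ->
    `|u k - u l| < e) ->
  exists g, forall e : R, 0 < e -> exists k0, forall k, (k0 <= k)%N -> `|u k - g| < e.
Proof.
move=> uC.
have fin_bd K : exists b : R, forall k, (k < K)%N -> `|u k| <= b.
  elim: K => [|K [b bP]]; first by exists 0.
  exists (Num.max b `|u K|) => k; rewrite ltnS leq_eqVlt => /orP[/eqP->|/bP kb].
    by rewrite le_max lexx orbT.
  by rewrite le_max kb.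
have [b ub] : exists b, forall k, `|u k| <= b.
  have [k0 k0P] := uC 1 ltr01; have [b bP] := fin_bd k0.
  exists (Num.max b (`|u k0| + 1)) => k; have [kk|/bP kb] := leqP k0 k; last by rewrite le_max kb.
  rewrite le_max; apply/orP; right; rewrite -{1}(subrK (u k0) (u k)) addrC.
  by rewrite (le_trans (ler_normD _ _))// lerD// ltW// k0P.
have ut : tight (range u).
  move=> e e0.
  have fin_tail K : exists m, forall k, (k < K)%N -> forall M,
      \sum_(m <= n < M) vnorm (u k n) ^+ 2 <= e.
    elim: K => [|K [m mP]]; first by exists 0%N.
    have [m' m'P] := l2_tail (u K) e0.
    have mono (m1 m2 : nat) (v : H) : (m1 <= m2)%N ->
        (forall M, \sum_(m1 <= n < M) vnorm (v n) ^+ 2 <= e) ->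
        forall M, \sum_(m2 <= n < M) vnorm (v n) ^+ 2 <= e.
      move=> m12 h M; have [Mm|mM] := leqP M m2; first by rewrite big_geq// ltW.
      apply: le_trans (h M); rewrite (@big_cat_nat _ _ _ m2 m1)//=; last exact: ltnW.
      by rewrite lerDr sumr_ge0// => n _; rewrite sqr_ge0.
    exists (maxn m m') => k; rewrite ltnS leq_eqVlt => /orP[/eqP->|/mP kP] M.
      exact: (mono m') (leq_maxr _ _) m'P M.
    exact: (mono m) (leq_maxl _ _) kP M.
  have e4 : 0 < e / 4 by rewrite divr_gt0.
  have d0 : 0 < Num.sqrt (e / 4) by rewrite sqrtr_gt0.
  have [k0 k0P] := uC _ d0; have [m0 m0P] := fin_tail k0.
  have [m1 m1P] := l2_tail (u k0) e4.
  exists (maxn m0 m1) => _ [k _ <-] M.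
  have [Mm|mM] := leqP M (maxn m0 m1); first by rewrite big_geq// ltW.
  have [kk|kk] := leqP k0 k; last first.
    apply: le_trans (m0P k kk M).
    rewrite [leRHS](@big_cat_nat _ _ _ (maxn m0 m1) m0) ?leq_maxl//=; last exact: ltnW.
    by rewrite lerDr sumr_ge0// => n _; rewrite sqr_ge0.
  apply: (@le_trans _ _ (\sum_(m1 <= n < M) vnorm (u k n) ^+ 2)).
    rewrite [leRHS](@big_cat_nat _ _ _ (maxn m0 m1) m1) ?leq_maxr//=; last exact: ltnW.
    by rewrite lerDr sumr_ge0// => n _; rewrite sqr_ge0.
  have m1M : (m1 <= M)%N by rewrite (leq_trans _ (ltnW mM))// leq_maxr.
  apply: (@le_trans _ _ (\sum_(m1 <= n < M) (2 * vnorm (u k0 n) ^+ 2 +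
      2 * vnorm ((u k - u k0) n) ^+ 2))).
    apply: sum_tail_le => n _.
    have := @sqr_vnormD_le _ _ (u k0 n) ((u k - u k0) n) 1 ltr01.
    by rewrite invr1 l2_subE addrC subrK; lra.
  rewrite big_split /= -!mulr_sumr; have := m1P M.
  have := @sum_split_nat R (fun n => vnorm ((u k - u k0) n) ^+ 2) m1 M m1M.
  have : 0 <= \sum_(n < m1) vnorm ((u k - u k0) n) ^+ 2.
    by rewrite sumr_ge0// => i _; rewrite sqr_ge0.
  have := partial_le_norm (u k - u k0) M.
  have : `|u k - u k0| ^+ 2 <= e / 4.
    rewrite -[leRHS]sqr_sqrtr ?(ltW e4)// ler_pXn2r ?nnegrE ?(ltW d0)// ltW//.
    exact: k0P.
  set X := \sum_(m1 <= n < M) _; set Y := \sum_(m1 <= n < M) _; lra.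
have [g gP] := tight_cluster ub ut.
exists g => e e0; have e2 : 0 < e / 2 by rewrite divr_gt0.
have [k0 k0P] := uC _ e2; exists k0 => k kk.
have [l ll lg] := gP _ k0 e2.
rewrite [ltRHS]splitr; apply: le_lt_trans (ler_distD (u l) (u k) g) _.
by apply: ltrD; [exact: k0P|exact: lg].
Qed.

(** The parallelogram identity for two points [w], [w'] whose distances to [h] exceed
    the minimal distance [d] by at most [eta]: [x] is the square of
    [|(h - w) + (h - w')|], and [v] that of [|w - w'|]. *)
Lemma minimizing_arith (d eta e2 x y z v : R) : 0 < eta -> eta <= 1 ->
  eta * (8 * d + 5) <= e2 -> (2 * d) ^+ 2 <= x -> y <= (d + eta) ^+ 2 ->
  z <= (d + eta) ^+ 2 -> x + v = 2 * y + 2 * z -> v < e2.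
Proof.
move=> eta0 eta1.
have eta2 : eta ^+ 2 <= eta by rewrite expr2 ler_piMr// ltW.
have -> : (d + eta) ^+ 2 = d ^+ 2 + 2 * (d * eta) + eta ^+ 2 by ring.
have -> : (2 * d) ^+ 2 = 4 * d ^+ 2 by ring.
have -> : eta * (8 * d + 5) = 8 * (d * eta) + 5 * eta by ring.
lra.
Qed.

(** A point at minimal distance from [h] exists by completeness, and then
    [h] minus this point is orthogonal to [W]. *)
Lemma dense_of_orthogonal (W : set H) : W 0 ->
  (forall c f g, W f -> W g -> W (f + c *: g)) ->
  (forall u, (forall w, W w -> l2dot w u = 0) -> u = 0) ->
  forall h (e : R), 0 < e -> exists2 w, W w & `|h - w| < e.
Proof.
move=> W0 Wlin Worth h.
pose D := [set `|h - w| | w in W].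
have D0 : lbound D 0 by move=> _ [w _ <-]; exact: normr_ge0.
have Dinf : has_inf D by split; [exists `|h - 0|, 0|exists 0].
pose d := inf D.
have dle w : W w -> d <= `|h - w| by move=> Ww; apply: ge_inf => //; [exists 0|exists w].
have d0 : 0 <= d by apply: lb_le_inf => //; exact: Dinf.1.
have /choice[u uP] : forall k : nat, exists w, W w /\ `|h - w| < d + k.+1%:R^-1.
  move=> k; have k0 : 0 < (k.+1%:R^-1 : R) by rewrite invr_gt0.
  by have [_ [w Ww <-] wd] := inf_adherent k0 Dinf; exists w.
have Wu k : W (u k) := (uP k).1.
have half (w w' : H) : W w -> W w' -> 2 * d <= `|(h - w) + (h - w')|.
  move=> Ww Ww'; pose c : C := (2^-1)%:C.
  have c2 : c + c = 1.
    apply/eqP; rewrite eq_complex /= addr0 eqxx andbT; apply/eqP; lra.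
  have Wm : W ((0 + c *: w) + c *: w').
    exact: Wlin (Wlin c _ _ W0 Ww) Ww'.
  have := dle _ Wm; rewrite add0r.
  have -> : h - (c *: w + c *: w') = c *: ((h - w) + (h - w')).
    rewrite !scalerDr !scalerN addrACA -scalerDl c2 scale1r opprD //.
  rewrite l2_normZ /= expr0n addr0 sqrtr_sqr ger0_norm ?invr_ge0// => hd.
  by rewrite -ler_pdivlMl// mulrC.
have uC : forall e : R, 0 < e -> exists k0, forall k l, (k0 <= k)%N -> (k0 <= l)%N ->
    `|u k - u l| < e.
  move=> e e0.
  pose eta := Num.min 1 (e ^+ 2 / (8 * d + 5)).
  have q0 : 0 < 8 * d + 5 by lra.
  have eta0 : 0 < eta by rewrite lt_min ltr01 divr_gt0// exprn_gt0.
  have eta1 : eta <= 1 by rewrite ge_min lexx.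
  have etae : eta * (8 * d + 5) <= e ^+ 2 by rewrite -ler_pdivlMr// ge_min lexx orbT.
  pose k0 := Num.bound eta^-1; exists k0.
  have near_d k : (k0 <= k)%N -> `|h - u k| <= d + eta.
    move=> kk; apply: ltW; apply: (lt_le_trans (uP k).2); rewrite lerD2l.
    rewrite -[leRHS]invrK lef_pV2 ?posrE ?invr_gt0//.
    have := archi_boundP (ltW (_ : 0 < eta^-1)); rewrite invr_gt0 => /(_ eta0) /ltW h1.
    by apply: (le_trans h1); rewrite ler_nat (leq_trans kk).
  move=> k l kk ll.
  rewrite -(@ltr_pXn2r _ 2%N) ?nnegrE ?(ltW e0)//.
  have := l2_parallelogram (h - u k) (h - u l).
  have -> : (h - u k) - (h - u l) = u l - u k.
    by rewrite opprB addrC addrA subrK.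
  rewrite [`|u l - u k|]distrC.
  have sq (a b : R) : 0 <= a -> a <= b -> a ^+ 2 <= b ^+ 2.
    by move=> a0 ab; rewrite ler_pXn2r ?nnegrE// (le_trans a0).
  move=> par; apply: (minimizing_arith eta0 eta1 etae _ _ _ par).
  - exact: sq _ _ (mulr_ge0 (ler0n _ 2) d0) (half _ _ (Wu k) (Wu l)).
  - exact: sq _ _ (normr_ge0 _) (near_d k kk).
  - exact: sq _ _ (normr_ge0 _) (near_d l ll).
have [g gP] := l2_complete uC.
pose v := h - g.
have vle : `|v| <= d.
  apply: le_of_eps => e e0; have e2 : 0 < e / 2 by rewrite divr_gt0.
  have [k1 k1P] := gP _ e2.
  pose k := maxn k1 (Num.bound (e / 2)^-1).
  have h1 : `|h - u k| <= d + e / 2.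
    apply: ltW; apply: (lt_le_trans (uP k).2); rewrite lerD2l.
    rewrite -[leRHS]invrK lef_pV2 ?posrE ?invr_gt0//.
    have := archi_boundP (ltW (_ : 0 < (e/2)^-1)); rewrite invr_gt0 => /(_ e2) /ltW h1.
    by apply: (le_trans h1); rewrite ler_nat leqW// leq_maxr.
  have := k1P k (leq_maxl _ _); have := ler_distD (u k) h g; rewrite -/v.
  by move: h1; set a := `|v|; set b := `|h - u k|; set c := `|u k - g|; lra.
have vge c w : W w -> d <= `|v - c *: w|.
  move=> Ww; apply: le_of_eps => e e0; have [k0 /(_ k0 (leqnn _)) k0P] := gP e e0.
  have := dle _ (Wlin c _ _ (Wu k0) Ww).
  have -> : h - (u k0 + c *: w) = (v - c *: w) - (u k0 - g).
    by rewrite /v opprD addrA opprB [RHS]addrAC [X in _ = X - _]addrA subrK.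
  have := ler_normB (v - c *: w) (u k0 - g); move: k0P.
  by set a := `|u k0 - g|; set b := `|_ - _|; set b' := `|v - c *: w|; lra.
have vE : v = h - g by [].
clearbody v; have v0 : v = 0.
  apply: Worth => w Ww; set z := l2dot w v.
  have zP t : 0 < t -> 2 * normc z ^+ 2 <= t * (normc z ^+ 2 * `|w| ^+ 2).
    move=> t0; have h1 := le_trans vle (vge (t%:C * z^*%R) w Ww).
    have h2 : `|v| ^+ 2 <= `|v - (t%:C * z^*%R) *: w| ^+ 2.
      by apply: lerXn2r h1; rewrite nnegrE; exact: normr_ge0.
    have nE : `|(t%:C * z^*%R) *: w| = (t * normc z) * `|w|.
      rewrite l2_normZ normcM; congr (_ * _ * _).
        by rewrite /= expr0n addr0 sqrtr_sqr gtr0_norm.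
      by case: (z) => a b /=; rewrite sqrrN.
    have ReE : complex.Re ((t%:C * z^*%R)^*%R * l2dot v w) = t * normc z ^+ 2.
      rewrite l2dotC -/z; case: (z) => a b /=; rewrite sqr_sqrtr ?addr_ge0 ?sqr_ge0//.
      ring.
    move: h2; rewrite (sqr_normB v ((t%:C * z^*%R) *: w)) l2dotZr nE ReE.
    move: (`|v|) (`|w|) (normc z) => nv nw nz hh.
    have : t * (2 * nz ^+ 2) <= t * (t * (nz ^+ 2 * nw ^+ 2)).
      have -> : t * (t * (nz ^+ 2 * nw ^+ 2)) = (t * nz * nw) ^+ 2 by ring.
      by clear - hh; lra.
    by rewrite ler_pM2l.
  apply: eq0_normc; apply/eqP; rewrite -sqrf_eq0 eq_le sqr_ge0 andbT.
  set b := normc z ^+ 2 in zP *.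
  have b0 : 0 <= b by exact: sqr_ge0.
  rewrite leNgt; apply/negP => bp.
  have w1 : 0 < `|w| ^+ 2 + 1 by rewrite ltr_wpDl// sqr_ge0.
  have := zP (`|w| ^+ 2 + 1)^-1; rewrite invr_gt0 => /(_ w1).
  rewrite ler_pdivlMl//.
  have : 0 <= b * `|w| ^+ 2 by rewrite mulr_ge0// sqr_ge0.
  clear - bp; move: (`|w| ^+ 2) bp => W; clearbody b => bp; lra.
move=> e e0; have [k0 /(_ k0 (leqnn _)) k0P] := gP e e0; exists (u k0).
  exact: Wu.
suff -> : h = g by rewrite distrC; exact: k0P.
by apply/eqP; rewrite -subr_eq0 -vE v0.
Qed.

End Projection.

(** * Inverses of closed operators with tight graphs *)

Section Relations.
Variables (R : realType) (p : nat).
Local Notation C := R[i].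
Local Notation H := (l2 R p).
Implicit Types (f g h u w : H) (c : C) (G : set (H * H)).

Lemma invn_lt (e : R) : 0 < e -> exists k0, forall k, (k0 <= k)%N -> k.+1%:R^-1 < e.
Proof.
move=> e0; exists (Num.bound e^-1) => k kk.
have ei : 0 < e^-1 by rewrite invr_gt0.
rewrite -[ltRHS]invrK ltf_pV2 ?posrE ?invr_gt0//.
apply: (lt_le_trans (archi_boundP (ltW ei))).
by rewrite ler_nat ltnW.
Qed.

Definition linear_rel G := G (0, 0) /\
  forall c f g f' g', G (f, g) -> G (f', g') -> G (f + c *: f', g + c *: g').

(** Plays the role of compactness of the resolvent, but makes sense before an inverse is
    known to exist. *)
Definition tight_rel G := forall b : R,
  tight [set f : H | exists g, [/\ G (f, g), `|f| <= b & `|g| <= b]].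

Lemma linear_relZ G c f g : linear_rel G -> G (f, g) -> G (c *: f, c *: g).
Proof.
move=> [G0 Gl] Gf; rewrite -[c *: f]add0r -[c *: g]add0r; exact: Gl G0 Gf.
Qed.

Lemma linear_relB G f g f' g' : linear_rel G -> G (f, g) -> G (f', g') ->
  G (f - f', g - g').
Proof. by move=> [_ Gl] Gf Gf'; rewrite -(scaleN1r f') -(scaleN1r g'); exact: Gl. Qed.

Lemma closed_limit G (u v : nat -> H) f g : closure G `<=` G ->
  (forall k, G (u k, v k)) ->
  (forall e : R, 0 < e -> exists k, `|f - u k| < e /\ `|g - v k| < e) -> G (f, g).
Proof.
move=> Gc Guv lim; apply: Gc; apply/closure_pairP => e e0.
by have [k [k1 k2]] := lim e e0; exists (u k, v k); split; [exact: Guv|exact: k1|exact: k2].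
Qed.

(** The range is dense because nothing is orthogonal to it, and closed because of the
    bound on the inverse. *)
Lemma range_full G (b : R) : 0 <= b -> linear_rel G -> closure G `<=` G ->
  (forall f g, G (f, g) -> `|f| <= b * `|g|) ->
  (forall u, (forall f g, G (f, g) -> l2dot g u = 0) -> u = 0) ->
  forall h, exists f, G (f, h).
Proof.
move=> b0 Glin Gc Gb Go h.
pose W := [set g : H | exists f, G (f, g)].
have Wd : forall h (e : R), 0 < e -> exists2 w, W w & `|h - w| < e.
  apply: dense_of_orthogonal.
  - by exists 0; exact: Glin.1.
  - by move=> c g g' [f Gf] [f' Gf']; exists (f + c *: f'); exact: Glin.2 Gf Gf'.
  - by move=> u Wu; apply: Go => f g Gf; apply: Wu; exists f.
have /choice[u uP] : forall k : nat, exists z : H * H, G z /\ `|h - z.2| < k.+1%:R^-1.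
  move=> k; have k0 : 0 < (k.+1%:R^-1 : R) by rewrite invr_gt0.
  by have [g [f Gf] hg] := Wd h _ k0; exists (f, g).
have lim (e : R) : 0 < e -> exists k0, forall k, (k0 <= k)%N -> `|h - (u k).2| < e.
  move=> e0; have [k0 k0P] := invn_lt e0; exists k0 => k kk.
  exact: lt_trans (uP k).2 (k0P k kk).
have uG k : G ((u k).1, (u k).2) by rewrite -surjective_pairing; exact: (uP k).1.
have [f fP] : exists f, forall e : R, 0 < e -> exists k0, forall k, (k0 <= k)%N ->
    `|(u k).1 - f| < e.
  apply: l2_complete => e e0.
  pose d := e / (2 * (b + 1)).
  have b1 : 0 < 2 * (b + 1) by lra.
  have d0 : 0 < d by rewrite divr_gt0.
  have [k0 k0P] := lim d d0; exists k0 => k l kk ll.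
  have h1 := Gb _ _ (linear_relB Glin (uG k) (uG l)).
  have h2 := ler_distD h (u k).2 (u l).2.
  have h3 := k0P k kk; have h4 := k0P l ll.
  rewrite distrC in h3.
  apply: le_lt_trans h1 _.
  apply: (@le_lt_trans _ _ (b * (2 * d))).
    rewrite ler_wpM2l//; apply: le_trans h2 _; rewrite mulr2n mulrDl mul1r.
    by apply: lerD; apply: ltW; [exact: h3|exact: h4].
  have -> : e = 2 * (b + 1) * d by rewrite /d mulrC divfK// gt_eqF.
  clear - b0 d0; lra.
exists f; apply: (closed_limit Gc uG) => e e0.
have [k1 k1P] := fP e e0; have [k2 k2P] := lim e e0.
exists (maxn k1 k2); split; last exact: k2P (leq_maxr _ _).
by rewrite distrC; exact: k1P (leq_maxl _ _).
Qed.

(** Otherwise there are unit vectors [f_k] whose images tend to [0]; by tightness they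
    accumulate at a unit vector, which lies in the kernel because [G] is closed. *)
Lemma apriori_bound G : linear_rel G -> closure G `<=` G -> tight_rel G ->
  (forall f, G (f, 0) -> f = 0) ->
  exists2 b : R, 0 <= b & forall f g, G (f, g) -> `|f| <= b * `|g|.
Proof.
move=> Glin Gc Gt Ginj; apply: contrapT => nb.
have /choice[u uP] : forall k : nat, exists z : H * H,
    [/\ G z, `|z.1| = 1 & `|z.2| < k.+1%:R^-1].
  move=> k; apply: contrapT => nk; apply: nb; exists k.+1%:R; first exact: ler0n.
  move=> f g Gf; rewrite leNgt; apply/negP => fg; apply: nk.
  have f0 : 0 < `|f| by apply: le_lt_trans fg; rewrite mulr_ge0.
  have nc : normc ((`|f|^-1)%:C : C) = `|f|^-1.
    by rewrite /= expr0n addr0 sqrtr_sqr gtr0_norm ?invr_gt0.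
  exists ((`|f|^-1)%:C *: f, (`|f|^-1)%:C *: g); split.
  - exact: linear_relZ.
  - by rewrite (l2_normZ _ f) nc mulVf// gt_eqF.
  - rewrite (l2_normZ _ g) nc mulrC ltr_pdivrMr// mulrC ltr_pdivlMr// mulrC.
    exact: fg.
pose v k := (u k).1.
have v1 k : `|v k| = 1 by have [_ + _] := uP k.
have u2 k : `|(u k).2| <= 1.
  have [_ _ h] := uP k; apply: le_trans (ltW h) _.
  by rewrite invf_le1// ler1n.
have uG k : G (v k, (u k).2) by rewrite -surjective_pairing; have [+ _ _] := uP k.
have vt : tight (range v).
  move=> e e0; have [m mP] := Gt 1 e e0; exists m => _ [k _ <-] M; apply: mP.
  by exists (u k).2; split; [exact: uG|rewrite v1|exact: u2].
have vb k : `|v k| <= 1 by rewrite v1.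
have [f0 f0P] := tight_cluster vb vt.
have Gf0 : G (f0, 0).
  apply: (closed_limit Gc uG) => e e0.
  have [k0 k0P] := invn_lt e0; have [k kk kf] := f0P e k0 e0.
  exists k; split; first by rewrite distrC.
  by rewrite sub0r normrN; have [_ _ h] := uP k; apply: lt_trans h (k0P k kk).
have [k _ kf] := f0P 1 0%N ltr01.
by move: kf; rewrite (Ginj _ Gf0) subr0 v1 ltxx.
Qed.

Lemma graph_linear (k0 : H -> H) : (forall c f g, k0 (c *: f + g) = c *: k0 f + k0 g) ->
  exists K : {linear H -> H}, forall f, K f = k0 f.
Proof.
move=> lin.
pose L := GRing.isLinear.Build C H H *:%R k0 lin.
pose K : {linear H -> H} := HB.pack k0 L.
by exists K.
Qed.

Lemma compact_inverse G : linear_rel G -> closure G `<=` G -> tight_rel G ->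
  (forall f, G (f, 0) -> f = 0) ->
  (forall u, (forall f g, G (f, g) -> l2dot g u = 0) -> u = 0) ->
  exists K : {linear H -> H}, exists b : R,
    [/\ op_inverse G = op_graph K, forall h, G (K h, h),
        forall h, `|K h| <= b * `|h| & compact_operator K].
Proof.
move=> Glin Gc Gt Ginj Go; have [b b0 Gb] := apriori_bound Glin Gc Gt Ginj.
have /choice[k0 k0P] := range_full b0 Glin Gc Gb Go.
have Guniq f f' h : G (f, h) -> G (f', h) -> f = f'.
  move=> Gf Gf'; apply/eqP; rewrite -subr_eq0; apply/eqP/Ginj.
  by rewrite -(subrr h); exact: linear_relB.
have [|K KE] := @graph_linear k0.
  move=> c f g; apply: Guniq (k0P _) _; rewrite addrC [in X in G (_, X)]addrC.
  exact: Glin.2 (k0P g) (k0P f).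
have KG h : G (K h, h) by rewrite KE.
have Kb h : `|K h| <= b * `|h| by exact: Gb.
exists K, b; split; [|exact: KG|exact: Kb|].
  apply/seteqP; split=> -[f g]; rewrite /op_inverse /op_graph /=.
    by move=> Gf; exact: Guniq Gf (KG f).
  by move=> ->; exact: KG.
have ball_le h : `|h| <= 1 -> `|K h| <= b.
  by move=> h1; apply: le_trans (Kb h) _; rewrite -[leRHS]mulr1 ler_wpM2l.
apply: (@tight_precompact _ _ _ b) => [_ [h /= h1 <-]|]; first exact: ball_le.
move=> e e0; have [m mP] := Gt (b + 1) e e0.
exists m => _ [h /= h1 <-] M; apply: mP; exists h; split; first exact: KG.
  by apply: le_trans (ball_le h h1) _; rewrite lerDl.
by apply: le_trans h1 _; rewrite lerDr.
Qed.

End Relations.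

(** * Singular values of a compact operator *)

Lemma nontrivial_combination (F : fieldType) (m n : nat) (A : 'M[F]_(n, m)) : (m < n)%N ->
  exists2 u : 'rV[F]_n, u != 0 & u *m A = 0.
Proof.
move=> mn; have : kermx A != 0.
  rewrite -mxrank_eq0 mxrank_ker subn_eq0 -ltnNge.
  exact: leq_ltn_trans (rank_leq_col A) mn.
move=> /rowV0Pn[u /sub_kermxP uA u0]; by exists u.
Qed.

Lemma sum_single (V : nmodType) (I : finType) (F : I -> V) j :
  (forall k, k != j -> F k = 0) -> \sum_k F k = F j.
Proof. by move=> F0; rewrite (bigD1 j)//= big1 ?addr0. Qed.

Section SpectralTheorem.
Variables (R : realType) (p : nat).
Local Notation C := R[i].
Local Notation H := (l2 R p).
Implicit Types (f g h u w : H) (c : C).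

Lemma orthogonal_to_list (b : nat -> H) (l : seq H) : exists2 u : 'rV[C]_(size l).+1,
  u != 0 & forall x, x \in l -> l2dot (\sum_(k < (size l).+1) u 0 k *: b k) x = 0.
Proof.
have [u u0 uA] := @nontrivial_combination C (size l) (size l).+1
  (\matrix_(j, i) l2dot (b j) (nth 0 l i)) (ltnSn (size l)).
exists u => // x xl; rewrite l2dot_suml.
have ix : (index x l < size l)%N by rewrite index_mem.
have /rowP /(_ (Ordinal ix)) := uA; rewrite [LHS]mxE [RHS]mxE => sum0.
rewrite -[RHS]sum0; apply: eq_bigr => j _; rewrite l2dotZl; congr (_ * _).
by rewrite mxE /= nth_index.
Qed.

(** [size l] linear conditions on [size l + 1] coordinates have a nonzero solution. *)
Lemma l2_orth_exists (hp : (0 < p)%N) (l : seq H) :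
  exists2 f : H, f != 0 & forall x, x \in l -> l2dot f x = 0.
Proof.
pose v : 'cV[C]_p := delta_mx (Ordinal hp) 0.
pose b (j : nat) : H := unit_l2 j v.
have [u u0 ul] := orthogonal_to_list b l.
exists (\sum_(j < (size l).+1) u 0 j *: b j); last exact: ul.
apply: contra u0 => /eqP s0; apply/eqP/rowP => j; rewrite [RHS]mxE.
have : (\sum_(k < (size l).+1) u 0 k *: b k) j = 0 by rewrite s0.
rewrite l2_sumE (@sum_single _ _ _ j) => [|k kj]; last first.
  rewrite l2_scaleE unit_l2E ifN ?scaler0//.
  by apply: contra kj => /eqP jk; apply/eqP/val_inj.
rewrite l2_scaleE unit_l2E eqxx => /colP /(_ (Ordinal hp)).
by rewrite !mxE !eqxx mulr1.
Qed.

Variables (K K' : {linear H -> H}) (b : R).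
Hypothesis hp : (0 < p)%N.
Hypothesis KK' : forall f g, l2dot (K f) g = l2dot f (K' g).
Hypothesis Kb : forall f, `|K f| <= b * `|f|.
Hypothesis K'b : forall f, `|K' f| <= b * `|f|.
Hypothesis Kinj : forall f, K f = 0 -> f = 0.
Hypothesis Kcpt : compact_operator K.

Lemma adjoint_sym f g : l2dot (K' f) g = l2dot f (K g).
Proof. by rewrite l2dotC -KK' -l2dotC. Qed.

(** Closedness in terms of distances, so that it can be checked without topology. *)
Definition eps_closed (V : set H) := forall f, (forall e : R, 0 < e ->
  exists2 g, V g & `|f - g| < e) -> V f.

(** Let [s] be the supremum of [|K f|] over the unit ball of [V].  Since
    [|K' (K f) - s^2 f|^2 <= s^2 (s^2 - |K f|^2)], a maximizing sequence is almost an
    eigensequence of [K' K]; by compactness of [K] the vectors [K' (K f)] accumulate, and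
    dividing by [s^2] gives the maximizer. *)
Lemma maximizing_step (V : set H) :
  V 0 -> (forall c f, V f -> V (c *: f)) -> eps_closed V ->
  (forall f, V f -> V (K' (K f))) -> (exists2 f, V f & f != 0) ->
  exists e, exists s : R, [/\ V e, `|e| = 1, 0 < s, K' (K e) = (s ^+ 2)%:C *: e
    & forall f, V f -> `|K f| <= s * `|f|].
Proof.
move=> V0 VZ Vc VT [f1 Vf1 f10].
have normalize f : V f -> f != 0 -> [/\ V ((`|f|^-1)%:C *: f),
    `|(`|f|^-1)%:C *: f| = 1 & `|K ((`|f|^-1)%:C *: f)| = `|f|^-1 * `|K f|].
  move=> Vf f0; have nf : 0 < `|f| by rewrite normr_gt0.
  have nc : normc ((`|f|^-1)%:C : C) = `|f|^-1.
    by rewrite /= expr0n addr0 sqrtr_sqr gtr0_norm ?invr_gt0.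
  split; first exact: VZ.
    by rewrite (l2_normZ _ f) nc mulVf// gt_eqF.
  by rewrite linearZ /= (l2_normZ _ (K f)) nc.
pose D := [set `|K f| | f in [set f | V f /\ `|f| <= 1]].
have b0 : 0 <= b.
  have := le_trans (normr_ge0 _) (Kb f1); have : 0 < `|f1| by rewrite normr_gt0.
  by move=> h; rewrite pmulr_lge0.
have Dsup : has_sup D.
  split; first by exists `|K 0|, 0 => //=; split; [exact: V0|rewrite normr0].
  exists b => _ [f [Vf f1'] <-]; apply: le_trans (Kb f) _.
  by rewrite -[leRHS]mulr1 ler_wpM2l.
pose s := sup D.
have sP f : V f -> `|K f| <= s * `|f|.
  move=> Vf; have [->|f0] := eqVneq f 0; first by rewrite linear0 !normr0 mulr0.
  have [Vn n1 nK] := normalize f Vf f0.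
  have nf : 0 < `|f| by rewrite normr_gt0.
  have : `|f|^-1 * `|K f| <= s.
    rewrite -nK; apply: ub_le_sup; first exact: Dsup.2.
    by exists ((`|f|^-1)%:C *: f) => //; split; [exact: Vn|rewrite n1].
  by rewrite ler_pdivrMl// mulrC.
have s0 : 0 < s.
  have Kf1 : 0 < `|K f1|.
    by rewrite normr_gt0; apply: contra f10 => /eqP/Kinj/eqP.
  have := lt_le_trans Kf1 (sP f1 Vf1); rewrite pmulr_lgt0//.
  by rewrite normr_gt0.
have K'K f : V f -> `|K' (K f)| <= s * `|K f|.
  move=> Vf; set y := K' (K f).
  have [y0|y0] := eqVneq y 0; first by rewrite y0 normr0; apply: mulr_ge0; [exact: ltW|exact: normr_ge0].
  have ny : 0 < `|y| by rewrite normr_gt0.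
  have h : `|y| ^+ 2 <= `|K y| * `|K f|.
    rewrite sqr_norm_Re {1}/y adjoint_sym Re_l2dotC; exact: Re_l2dot_le.
  have h2 := sP y (VT f Vf).
  rewrite -(ler_pM2l ny) -expr2; apply: (le_trans h).
  rewrite mulrA; apply: ler_wpM2r; first exact: normr_ge0.
  by rewrite mulrC; exact: h2.
(* As [K' (K f)] is again in [V], its norm is at most [s |K f|]; expand the square. *)
have defect f : V f -> `|f| <= 1 ->
    `|K' (K f) - (s ^+ 2)%:C *: f| ^+ 2 <= s ^+ 2 * (s ^+ 2 - `|K f| ^+ 2).
  move=> Vf fl; rewrite (sqr_normB (K' (K f)) ((s ^+ 2)%:C *: f)).
  have -> : complex.Re (l2dot (K' (K f)) ((s ^+ 2)%:C *: f)) = s ^+ 2 * `|K f| ^+ 2.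
    rewrite l2dotZr adjoint_sym l2dotxx.
    by move: (`|K f| ^+ 2) (s ^+ 2) => x y /=; ring.
  have -> : `|(s ^+ 2)%:C *: f| = s ^+ 2 * `|f|.
    rewrite (l2_normZ _ f); congr (_ * _).
    by rewrite /= expr0n addr0 sqrtr_sqr ger0_norm// sqr_ge0.
  have h1 : `|K' (K f)| ^+ 2 <= s ^+ 2 * `|K f| ^+ 2.
    rewrite -exprMn; apply: lerXn2r (K'K f Vf); rewrite nnegrE; first exact: normr_ge0.
    by apply: mulr_ge0; [exact: ltW|exact: normr_ge0].
  have h2 : (s ^+ 2 * `|f|) ^+ 2 <= s ^+ 2 * s ^+ 2.
    have hh : s ^+ 2 * `|f| <= s ^+ 2 by apply: ler_piMr => //; exact: sqr_ge0.
    rewrite -(expr2 (s ^+ 2)); apply: lerXn2r hh; rewrite nnegrE; last exact: sqr_ge0.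
    by apply: mulr_ge0; [exact: sqr_ge0|exact: normr_ge0].
  move: h1 h2; move: (`|K' (K f)| ^+ 2) (`|K f| ^+ 2) ((s ^+ 2 * `|f|) ^+ 2) (s ^+ 2).
  by move=> x y z t h1 h2; lra.
have /choice[u uP] : forall k : nat, exists f, [/\ V f, `|f| <= 1 & s - k.+1%:R^-1 < `|K f|].
  move=> k; have k0 : 0 < (k.+1%:R^-1 : R) by rewrite invr_gt0.
  by have [_ [f [Vf fl] <-] sf] := sup_adherent k0 Dsup; exists f.
have [y yP] := @precompact_cluster _ _ _ (fun k => K (u k)) Kcpt
  (fun k => ltac:(by exists (u k) => //; have [] := uP k)).
have s2 : 0 < s ^+ 2 by rewrite exprn_gt0.
pose e := ((s ^+ 2)^-1)%:C *: K' y.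
have ey : (s ^+ 2)%:C *: e = K' y.
  by rewrite /e scalerA -rmorphM /= mulfV ?rmorph1 ?scale1r// gt_eqF.
have scale_s f : `|(s ^+ 2)%:C *: f| = s ^+ 2 * `|f|.
  rewrite (l2_normZ _ f); congr (_ * _).
  by rewrite /= expr0n addr0 sqrtr_sqr ger0_norm// ltW.
have approx (d : R) : 0 < d -> exists k, `|u k - e| < d /\ s - d < `|K (u k)|.
  move=> d0.
  pose eta := Num.min d (Num.min s (s * d ^+ 2 / 8)).
  have eta0 : 0 < eta.
    by rewrite !lt_min d0 s0 /= divr_gt0// mulr_gt0// exprn_gt0.
  have etad : eta <= d by rewrite ge_min lexx.
  have etas : eta <= s by rewrite !ge_min lexx orbT.
  have etasd : eta <= s * d ^+ 2 / 8 by rewrite !ge_min lexx !orbT.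
  have b1 : 0 < 2 * (b + 1) by lra.
  have q0 : 0 < s ^+ 2 * d / (2 * (b + 1)) by rewrite divr_gt0// mulr_gt0.
  have [k0 k0P] := invn_lt eta0; have [k kk ky] := yP _ k0 q0.
  have [Vk k1 sk] := uP k; have ek := k0P k kk.
  have Kk : s - eta < `|K (u k)|.
    by apply: lt_trans sk; rewrite ltrD2l ltrN2.
  exists k; split; last by apply: le_lt_trans Kk; rewrite lerD2l lerN2.
  have h1 : `|K' (K (u k)) - (s ^+ 2)%:C *: u k| <= s ^+ 2 * (d / 2).
    have nn : 0 <= s ^+ 2 * (d / 2) by rewrite mulr_ge0 ?divr_ge0 ?ltW.
    rewrite -(@ler_pXn2r _ 2%N) ?nnegrE//; apply: (le_trans (defect _ Vk k1)).
    have -> : (s ^+ 2 * (d / 2)) ^+ 2 = s ^+ 2 * (s ^+ 2 * (d / 2) ^+ 2) by ring.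
    rewrite ler_wpM2l ?(ltW s2)//.
    have : (s - eta) ^+ 2 <= `|K (u k)| ^+ 2.
      apply: lerXn2r (ltW Kk); rewrite nnegrE; last exact: normr_ge0.
      by rewrite subr_ge0.
    have h : 2 * (s * eta) <= s ^+ 2 * (d / 2) ^+ 2.
      have : s * eta <= s * (s * d ^+ 2 / 8) by apply: ler_wpM2l etasd; exact: ltW.
      have -> : s * (s * d ^+ 2 / 8) = (s ^+ 2 * (d / 2) ^+ 2) / 2 by field.
      by clear; move: (s * eta) (s ^+ 2 * (d / 2) ^+ 2) => x z; lra.
    have -> : (s - eta) ^+ 2 = s ^+ 2 - 2 * (s * eta) + eta ^+ 2 by ring.
    have := sqr_ge0 eta; move: h; clear.
    by move: (s ^+ 2 * (d / 2) ^+ 2) (s * eta) (eta ^+ 2) (`|K (u k)| ^+ 2) (s ^+ 2) => *; lra.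
  have h2 : `|K' (K (u k)) - K' y| < s ^+ 2 * (d / 2).
    rewrite -linearB; apply: le_lt_trans (K'b _) _.
    apply: (@le_lt_trans _ _ (b * (s ^+ 2 * d / (2 * (b + 1))))).
      by rewrite ler_wpM2l// ltW.
    rewrite mulrA ltr_pdivrMr//.
    have td : 0 < s ^+ 2 * d by rewrite mulr_gt0.
    by clear - td; move: (s ^+ 2) td => t td; lra.
  rewrite -(ltr_pM2l s2) -scale_s scalerBr ey.
  apply: le_lt_trans (ler_distD (K' (K (u k))) _ _) _.
  have -> : s ^+ 2 * d = s ^+ 2 * (d / 2) + s ^+ 2 * (d / 2) by field.
  by apply: ler_ltD; [rewrite distrC; exact: h1|exact: h2].
have Ve : V e.
  apply: Vc => d d0; have [k [k1 _]] := approx d d0; exists (u k).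
    by have [] := uP k.
  by rewrite distrC; exact: k1.
have e1 : `|e| <= 1.
  apply: le_of_eps => d d0; have [k [k1 _]] := approx d d0.
  have [_ uk _] := uP k; have := ler_distD (u k) e 0.
  rewrite !subr0 distrC => h; apply: (le_trans h); rewrite addrC.
  by apply: lerD; [exact: uk|exact: ltW].
have Ke : s <= `|K e|.
  apply: le_of_eps => d d0.
  have b2 : 0 < b + 2 by lra.
  have d1 : 0 < d / (b + 2) by rewrite divr_gt0.
  have [k [k1 k2]] := approx _ d1.
  have h : `|K (u k)| <= `|K e| + b * `|u k - e|.
    rewrite -[K (u k)](subrK (K e)) addrC; apply: le_trans (ler_normD _ _) _.
    by rewrite lerD2l -linearB; exact: Kb.
  have h2 : b * `|u k - e| <= b * (d / (b + 2)) by rewrite ler_wpM2l// ltW.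
  have h3 : d = (b + 2) * (d / (b + 2)) by rewrite mulrC divfK// gt_eqF.
  move: h h2 h3 k2 d1; clear; move: (d / (b + 2)) (`|K (u k)|) (b * `|u k - e|) (`|K e|).
  by move=> *; lra.
have ee : `|e| = 1.
  apply/eqP; rewrite eq_le e1 /= -(ler_pM2l s0) mulr1.
  exact: le_trans Ke (sP e Ve).
have KeE : `|K e| = s.
  by apply/eqP; rewrite eq_le Ke andbT; have := sP e Ve; rewrite ee mulr1.
exists e, s; split=> //.
have := defect e Ve e1; rewrite KeE subrr mulr0 => h.
have : `|K' (K e) - (s ^+ 2)%:C *: e| = 0.
  by apply/eqP; rewrite -sqrf_eq0 eq_le h sqr_ge0.
by move/eqP; rewrite normr_eq0 subr_eq0 => /eqP.
Qed.

End SpectralTheorem.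

Section SpectralSequence.
Variables (R : realType) (p : nat).
Local Notation C := R[i].
Local Notation H := (l2 R p).
Implicit Types (f g h u w : H) (c : C).

Variables (K K' : {linear H -> H}) (b : R).
Hypothesis hp : (0 < p)%N.
Hypothesis KK' : forall f g, l2dot (K f) g = l2dot f (K' g).
Hypothesis Kb : forall f, `|K f| <= b * `|f|.
Hypothesis K'b : forall f, `|K' f| <= b * `|f|.
Hypothesis Kinj : forall f, K f = 0 -> f = 0.
Hypothesis Kcpt : compact_operator K.

Lemma normc_gt0 (c : C) : c != 0 -> 0 < normc c.
Proof.
move=> c0; rewrite lt_neqAle eq_sym; apply/andP; split; last by case: (c) => x y; exact: sqrtr_ge0.
by apply: contra c0 => /eqP/eq0_normc ->.
Qed.

Lemma l2dot_closed (x : H) : eps_closed [set f : H | l2dot f x = 0].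
Proof.
move=> f fc /=; apply: contrapT => /eqP z0.
have nz := normc_gt0 z0.
have x1 : 0 < `|x| + 1 by rewrite ltr_wpDl.
have e0 : 0 < normc (l2dot f x) / (`|x| + 1) by rewrite divr_gt0.
have [g /= gx fg] := fc _ e0.
have : normc (l2dot f x) <= `|f - g| * `|x|.
  by rewrite -[l2dot f x]subr0 -gx -l2dotBl; exact: normc_l2dot_le.
have h1 : `|f - g| * `|x| <= `|f - g| * (`|x| + 1) by rewrite ler_wpM2l// lerDl.
move=> h; have := le_trans h h1; rewrite leNgt => /negP; apply.
by rewrite -ltr_pdivlMr.
Qed.

Let orth (l : seq H) : set H := [set f | forall x, x \in l -> l2dot f x = 0].
Let good (l : seq H) := forall x, x \in l -> exists t : R, K' (K x) = t%:C *: x.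

Let step (l : seq H) : exists z : H * R, good l ->
  [/\ orth l z.1, `|z.1| = 1, 0 < z.2, K' (K z.1) = (z.2 ^+ 2)%:C *: z.1
    & forall f, orth l f -> `|K f| <= z.2 * `|f|].
Proof.
have [gl|ngl] := pselect (good l); last by exists (0, 0).
have [] := @maximizing_step _ _ K K' b KK' Kb K'b Kinj Kcpt (orth l).
- by move=> x _; rewrite l2dot0l.
- by move=> c f fl x xl; rewrite l2dotZl (fl x xl) mulr0.
- move=> f fc x xl; apply: (@l2dot_closed x) => e e0.
  by have [g gl' fg] := fc e e0; exists g => //; exact: gl'.
- move=> f fl x xl; have [t tx] := gl x xl.
  by rewrite (adjoint_sym KK') KK' tx l2dotZr (fl x xl) mulr0.
- by have [f f0 fl] := l2_orth_exists hp l; exists f.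
by move=> e [s es]; exists (e, s).
Qed.

(** Apply the maximizing step to the orthogonal complement of the vectors found so far.
    If a nonzero [f] were orthogonal to all [e n], then [s n >= |K f| / |f|] for all [n],
    and the [K (e n)], which are orthogonal with norms [s n], could not accumulate. *)
Lemma spectral_sequence : exists (e : nat -> H) (s : nat -> R),
  [/\ Defs.orthonormal e, forall n, 0 < s n, forall n, s n.+1 <= s n,
      forall n, K' (K (e n)) = (s n ^+ 2)%:C *: e n
    & forall f, (forall n, l2dot f (e n) = 0) -> f = 0].
Proof.
have /choice[F FP] := step.
pose lst := fix lst n := if n is k.+1 then (F (lst k)).1 :: lst k else [::].
pose e n := (F (lst n)).1; pose s n := (F (lst n)).2.
have lstS n : lst n.+1 = e n :: lst n by [].
have glst n : good (lst n).
  elim: n => [|n IH] x; first by rewrite in_nil.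
  rewrite lstS inE => /orP[/eqP->|]; last exact: IH.
  by exists (s n ^+ 2); have [] := FP _ IH.
have FPn n := FP _ (glst n).
have e_in j k : (j < k)%N -> e j \in lst k.
  elim: k => // k IH; rewrite ltnS leq_eqVlt lstS inE => /orP[/eqP->|/IH ->].
    by rewrite eqxx.
  by rewrite orbT.
have eorth j k : (j < k)%N -> l2dot (e k) (e j) = 0.
  by move=> jk; have [h _ _ _ _] := FPn k; apply: h; exact: e_in.
have Ke n : `|K (e n)| = s n.
  have [_ e1 s0 T _] := FPn n; apply/eqP.
  rewrite -(@eqrXn2 _ 2%N)//; last exact: ltW.
  rewrite sqr_norm_Re KK' T l2dotZr l2dotxx e1 expr1n; apply/eqP.
  by rewrite /=; ring.
have smono n : s n.+1 <= s n.
  have [h1 e1 _ _ _] := FPn n.+1; have [_ _ _ _ h] := FPn n.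
  have := h (e n.+1); rewrite Ke e1 mulr1; apply => x xl.
  by apply: h1; rewrite lstS inE xl orbT.
exists e, s; split=> //.
- move=> j k; have [jk|kj|<-] := ltngtP j k.
  + by rewrite l2dotC eorth// rmorph0.
  + by rewrite eorth.
  + by rewrite l2dotxx; have [_ -> _ _ _] := FPn j; rewrite expr1n.
- by move=> n; have [] := FPn n.
- by move=> n; have [] := FPn n.
move=> f fe; apply: contrapT => /eqP f0.
have nf : 0 < `|f| by rewrite normr_gt0.
have nKf : 0 < `|K f| by rewrite normr_gt0; apply: contra f0 => /eqP/Kinj/eqP.
pose d := `|K f| / `|f|; have d0 : 0 < d by rewrite divr_gt0.
have ds n : d <= s n.
  have [_ _ _ _ h] := FPn n; rewrite ler_pdivrMr//; apply: h => x.
  suff : forall k, x \in lst k -> exists j, x = e j by move=> /[apply] -[j ->].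
  elim=> [|k IH]; first by rewrite in_nil.
  by rewrite lstS inE => /orP[/eqP->|/IH]; [exists k|].
have Keb n : [set K h | h in [set h : H | `|h| <= 1]] (K (e n)).
  by exists (e n) => //; have [_ e1 _ _ _] := FPn n; rewrite /= e1.
have [y yP] := @precompact_cluster _ _ _ (fun k => K (e k)) Kcpt Keb.
have d2 : 0 < d / 2 by rewrite divr_gt0.
have [j _ jy] := yP _ 0%N d2; have [k jk ky] := yP _ j.+1 d2.
have Kjk : complex.Re (l2dot (K (e k)) (K (e j))) = 0.
  have [_ _ _ T _] := FPn j.
  by rewrite KK' T l2dotZr eorth ?mulr0.
have := sqr_normB (K (e k)) (K (e j)); rewrite Kjk mulr0 subr0 !Ke => h.
have : `|K (e k) - K (e j)| < d.
  rewrite [ltRHS]splitr; apply: le_lt_trans (ler_distD y _ _) _.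
  by apply: ltrD; [exact: ky|rewrite distrC; exact: jy].
have sq x : d <= x -> d ^+ 2 <= x ^+ 2.
  by move=> dx; rewrite ler_pXn2r ?nnegrE ?(ltW d0)// (le_trans (ltW d0)).
rewrite -(@ltr_pXn2r _ 2%N) ?nnegrE ?(ltW d0)// h ltNge => /negP; apply.
apply: le_trans (sq _ (ds k)) _; rewrite lerDl; exact: sqr_ge0.
Qed.

End SpectralSequence.

(** * Minimal and maximal block Jacobi operators *)

Section Jacobi.
Variables (R : realType) (p : nat).
Local Notation C := R[i].
Local Notation H := (l2 R p).
Implicit Types (f g h u w : H) (c : C) (A B D : nat -> 'M[C]_p).

Lemma closure_linear_rel (G : set (H * H)) : linear_rel G -> linear_rel (closure G).
Proof.
move=> [G0 Gl]; split; first exact: subset_closure.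
move=> c f g f' g' /closure_pairP Gf /closure_pairP Gf'; apply/closure_pairP => e e0.
have nc : 0 < normc c + 1 by rewrite ltr_wpDl//; case: (c) => a b; exact: sqrtr_ge0.
have e2 : 0 < e / 2 by rewrite divr_gt0.
have e3 : 0 < e / 2 / (normc c + 1) by rewrite divr_gt0.
have scale_le (x : H) : `|x| < e / 2 / (normc c + 1) -> `|c *: x| <= e / 2.
  rewrite (ltr_pdivlMr _ _ nc) => xe; rewrite (l2_normZ c x); apply: le_trans (ltW xe).
  by rewrite mulrC ler_wpM2l// lerDl.
have [[f1 g1] [G1 /= f1e g1e]] := Gf _ e2.
have [[f2 g2] [G2 /= f2e g2e]] := Gf' _ e3.
exists (f1 + c *: f2, g1 + c *: g2); split; first exact: Gl.
- rewrite /= opprD addrACA -scalerBr [ltRHS]splitr.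
  by apply: le_lt_trans (ler_normD _ _) _; apply: ltr_leD; [exact: f1e|exact: scale_le f2e].
- rewrite /= opprD addrACA -scalerBr [ltRHS]splitr.
  by apply: le_lt_trans (ler_normD _ _) _; apply: ltr_leD; [exact: g1e|exact: scale_le g2e].
Qed.

Definition maximal_jacobi A B : set (H * H) :=
  [set z : H * H | forall n, z.2 n = jacobi_action A B z.1 n].

Lemma addr3ACA (V : nmodType) (a a' b b' d d' : V) :
  a + a' + (b + b') + (d + d') = a + b + d + (a' + b' + d').
Proof. by rewrite (addrACA a) (addrACA (a + b)). Qed.

Lemma jacobi_actionDZ A B c (f g : nat -> 'cV[C]_p) n :
  jacobi_action A B (fun m => f m + c *: g m) n =
  jacobi_action A B f n + c *: jacobi_action A B g n.
Proof.
rewrite /jacobi_action !mulmxDr -!scalemxAr !scalerDr.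
exact: addr3ACA.
Qed.

Lemma jacobi_actionB A B f g n :
  jacobi_action A B (f - g) n = jacobi_action A B f n - jacobi_action A B g n.
Proof. by rewrite /jacobi_action !l2_subE !mulmxBr addr3ACA !opprD. Qed.

Lemma maximal_linear A B : linear_rel (maximal_jacobi A B).
Proof.
split=> [n|c f g f' g' fg fg' n] /=.
  by rewrite /jacobi_action !mulmx0 !addr0.
by have := jacobi_actionDZ A B c f f' n; rewrite -(fg n) -(fg' n).
Qed.

Lemma preminimal_linear A B : linear_rel (preminimal_jacobi A B).
Proof.
split=> [|c f g f' g' [[N fN] fg] [[N' fN'] fg']].
  by split; [exists 0%N|exact: (maximal_linear A B).1].
split; last exact: (maximal_linear A B).2 fg fg'.
exists (maxn N N') => n; rewrite geq_max => /andP[Nn Nn'].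
by rewrite l2_addE l2_scaleE fN// fN'// scaler0 addr0.
Qed.

Lemma minimal_linear A B : linear_rel (minimal_jacobi A B).
Proof. exact/closure_linear_rel/preminimal_linear. Qed.

Lemma minimal_closed A B : closure (minimal_jacobi A B) `<=` minimal_jacobi A B.
Proof. exact: closed_closure. Qed.

Lemma jacobi_action_fin A B (f : nat -> 'cV[C]_p) :
  finitely_supported f -> finitely_supported (jacobi_action A B f).
Proof.
move=> [N fN]; exists N.+1 => -[//|n Nn]; rewrite /jacobi_action /=.
by rewrite !fN ?mulmx0 ?addr0 ?(leqW (leqW _))// ltnW// ltnW.
Qed.

Lemma preminimal_exists A B f : finitely_supported f ->
  exists g, preminimal_jacobi A B (f, g).
Proof. by move=> ff; exists (fin_l2 (jacobi_action_fin A B ff)). Qed.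

(** Summation by parts.  The contributions of the diagonal cancel because the [A n] are
    hermitian, and those of the links telescope. *)
Lemma jacobi_green A B (f u : nat -> 'cV[C]_p) L : (forall n, (A n)^t* = A n) ->
  \sum_(n < L) (vdot (jacobi_action A B f n) (u n) - vdot (f n) (jacobi_action A B u n)) =
  vdot (Bpred B L *m f L) (u L.-1) - vdot (f L.-1) (Bpred B L *m u L).
Proof.
move=> hA; elim: L => [|L IH].
  by rewrite big_ord0 /= !mul0mx vdot0l vdot0r subrr.
rewrite big_ord_recr /= IH {IH} /jacobi_action !vdotDl !vdotDr.
rewrite (vdot_mulmxl (A L)) hA (vdot_mulmxl (_^t*)) trmxCK.
rewrite (vdot_mulmxr (_^t*)) trmxCK.
set a := vdot (Bpred B L *m f L) _; set b := vdot _ (Bpred B L *m u L).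
set d := vdot (f L) (A L *m u L); set x := vdot (B L *m _) _; set y := vdot _ (B L *m _).
ring.
Qed.

Lemma preminimal_green A B f g u N : (forall n, (A n)^t* = A n) ->
  (forall n, (N <= n)%N -> f n = 0) -> (forall n, g n = jacobi_action A B f n) ->
  l2dot g u = \sum_(n < N.+1) vdot (f n) (jacobi_action A B u n).
Proof.
move=> hA fN fg.
have gN n : (N.+1 <= n)%N -> g n = 0.
  case: n => // n; rewrite ltnS => Nn; rewrite (fg n.+1) /jacobi_action /=.
  by rewrite (fN n Nn) (fN n.+1 (leqW Nn)) (fN n.+2 (leqW (leqW Nn))) !mulmx0 !addr0.
rewrite (@l2dot_fin _ _ g u N.+1) => [|n Nn]; last by rewrite gN// vdot0l.
apply/eqP; rewrite -subr_eq0 -sumrB; apply/eqP.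
apply: (etrans _ (etrans (jacobi_green B f u N.+1 hA) _)).
  by apply: eq_bigr => n _; rewrite (fg n).
by rewrite /= (fN _ (leqnn N)) (fN _ (leqnSn N)) mulmx0 !vdot0l subrr.
Qed.

(** Each component of the action involves only three sites, hence is continuous. *)
Lemma maximal_closed A B : closure (maximal_jacobi A B) `<=` maximal_jacobi A B.
Proof.
suff h (f g : H) : closure (maximal_jacobi A B) (f, g) ->
  forall n, g n = jacobi_action A B f n by move=> [f g]; exact: h.
move=> /closure_pairP fg n; apply/eqP; rewrite -subr_eq0; apply/eqP/vnorm_eq0.
apply/eqP; rewrite eq_le vnorm_ge0 andbT; apply: le_of_eps => e e0; rewrite add0r.
pose k := 1 + (opnorm ((Bpred B n)^t*) + opnorm (A n) + opnorm (B n)).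
have k0 : 0 < k by rewrite ltr_wpDr// !addr_ge0// opnorm_ge0.
have [[f' g'] [fg' /= ff gg]] := fg (e / k) (divr_gt0 e0 k0).
have -> : g n - jacobi_action A B f n = (g - g') n - jacobi_action A B (f - f') n.
  by rewrite jacobi_actionB l2_subE -(fg' n) opprB addrA subrK.
have cb m : vnorm ((f - f') m) <= e / k.
  exact: le_trans (vnorm_le_norm _ _) (ltW ff).
have gb : vnorm ((g - g') n) <= e / k by exact: le_trans (vnorm_le_norm _ _) (ltW gg).
have Mb (M : 'M[C]_p) m : vnorm (M *m (f - f') m) <= opnorm M * (e / k).
  apply: le_trans (vnorm_mulmx _ _) _; apply: ler_wpM2l (cb m); exact: opnorm_ge0.
apply: le_trans (vnormD _ _) _; rewrite vnormN.
have -> : e = e / k + (opnorm ((Bpred B n)^t*) * (e / k) + opnorm (A n) * (e / k) + opnorm (B n) * (e / k)).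
  by rewrite -!mulrDl -[X in X + _]mul1r -mulrDl -/k mulrC divfK// gt_eqF.
apply: lerD gb _; rewrite /jacobi_action.
apply: le_trans (vnormD _ _) _; apply: lerD (Mb _ _).
by apply: le_trans (vnormD _ _) _; apply: lerD (Mb _ _) (Mb _ _).
Qed.

Lemma minimal_sub_maximal A B : minimal_jacobi A B `<=` maximal_jacobi A B.
Proof.
apply: subset_trans (@maximal_closed A B); apply: closure_subset.
by move=> z [].
Qed.

Lemma normc_small (z : C) : (forall e : R, 0 < e -> normc z <= e) -> z = 0.
Proof.
move=> h; apply: eq0_normc; apply/eqP; rewrite eq_le; apply/andP; split.
  by apply: le_of_eps => e e0; rewrite add0r h.
by case: (z) => a b; exact: sqrtr_ge0.
Qed.

Lemma l2dot_closure (G : set (H * H)) u w :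
  (forall f g, G (f, g) -> l2dot g u = l2dot f w) ->
  forall f g, closure G (f, g) -> l2dot g u = l2dot f w.
Proof.
move=> Guw f g /closure_pairP Gf.
suff : l2dot g u - l2dot f w = 0 by move/eqP; rewrite subr_eq0 => /eqP.
suff h : forall e : R, 0 < e -> normc (l2dot g u - l2dot f w) <= e.
  exact: normc_small h.
move=> e e0.
have k0 : 0 < `|u| + `|w| + 1 by rewrite ltr_wpDl// addr_ge0.
have d0 : 0 < e / (`|u| + `|w| + 1) by rewrite divr_gt0.
have [[f' g'] [Gf' ff gg]] := Gf _ d0.
have E : l2dot g u - l2dot f w = l2dot (g - g') u - l2dot (f - f') w.
  by rewrite !l2dotBl (Guw _ _ Gf') opprB addrA subrK.
have tri (x y : C) : normc (x - y) <= normc x + normc y.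
  by rewrite -(normcN y); exact: le_normcD.
rewrite E.
apply: le_trans (tri _ _) _.
apply: (@le_trans _ _ (e / (`|u| + `|w| + 1) * `|u| + e / (`|u| + `|w| + 1) * `|w|)).
  apply: lerD.
    apply: le_trans (normc_l2dot_le _ _) _.
    by apply: ler_wpM2r (ltW gg); exact: normr_ge0.
  apply: le_trans (normc_l2dot_le _ _) _.
  by apply: ler_wpM2r (ltW ff); exact: normr_ge0.
rewrite -mulrDr mulrAC ler_pdivrMr// ler_wpM2l ?(ltW e0)//.
by rewrite lerDl.
Qed.

(** Testing an element of the adjoint on sequences supported at a single site gives the
    recurrence; conversely the boundary terms vanish on finitely supported sequences. *)
Lemma adjoint_minimal A B : (forall n, (A n)^t* = A n) ->
  op_adjoint (minimal_jacobi A B) = maximal_jacobi A B.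
Proof.
move=> hA; apply/seteqP; split=> -[u' w']; move: (u' : H) (w' : H) => {u' w'} u w.
  move=> /= uw n; apply: vdot_ext => v.
  have [g fg] := @preminimal_exists A B (unit_l2 n v) (single_fin n v).
  have /= := uw (unit_l2 n v, g) (subset_closure fg).
  rewrite l2dot_unitl => <-.
  rewrite (@preminimal_green A B _ g u n.+1 hA _ fg.2); last first.
    by move=> m nm; rewrite unit_l2E gtn_eqF.
  have n2 : (n < n.+2)%N by exact: ltnW.
  apply: (etrans (@sum_single _ _ _ (Ordinal n2) _)); last by rewrite unit_l2E eqxx.
  move=> k kn; rewrite unit_l2E; case: (eqVneq (k : nat) n) => [e|_]; last by rewrite vdot0l.
  by move: kn => /eqP; case; apply/val_inj.
move=> uw [f0 g0] fg /=; move: (f0 : H) (g0 : H) fg => {f0 g0} f g fg.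
apply: (l2dot_closure _ fg) => f' g' [[N fN] fg'].
rewrite (preminimal_green _ hA fN fg') (@l2dot_fin _ _ f' w N.+1).
  by apply: eq_bigr => n _; rewrite -(uw n).
by move=> n Nn; rewrite fN ?vdot0l// ltnW.
Qed.

End Jacobi.

(** * Dominated three-term inequalities *)

Section RealRecursions.
Variable R : realType.

(** Here [q n] stands for the diagonal term of a form and [(l n q n + r (n+1) q (n+1)) / 2]
    for half the estimate of the link between [n] and [n+1], which enters both [t n] and
    [t (n+1)].  In a partial sum the last link has entered only once, which explains the
    boundary terms. *)
Lemma dominated_sum_ge (t q l r : nat -> R) : (forall n, 0 <= q n) ->
  (forall n, 0 <= l n) -> (forall n, 0 <= r n) ->
  (forall n, t n >= q n - (l n * q n + r n.+1 * q n.+1) / 2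
     - (if n is m.+1 then l m * q m + r n * q n else 0) / 2) ->
  forall L, \sum_(n < L) t n >= \sum_(n < L) (q n - l n * q n - r n * q n)
     + (if L is m.+1 then l m * q m + r L * q L else 0) / 2 - r L * q L.
Proof.
move=> q0 l0 r0 ht; elim=> [|L IH].
  by rewrite !big_ord0 mul0r !add0r oppr_le0 mulr_ge0.
rewrite !big_ord_recr /=; have := ht L; move: IH.
move: (\sum_(n < L) t n) (\sum_(n < L) _) (match L with 0 => _ | m.+1 => _ end) => x y z.
have := mulr_ge0 (r0 L.+1) (q0 L.+1).
lra.
Qed.

(** Each use of the inequality multiplies a uniform bound of [u] by [c]. *)
Lemma row_dominated_eq0 (u x y : nat -> R) (c b : R) : c < 1 ->
  (forall n, 0 <= u n) -> (forall n, 0 <= x n) -> (forall n, 0 <= y n) ->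
  (forall n, x n + y n <= c) -> (forall n, u n <= b) ->
  (forall n, u n <= x n * u n.+1 + y n * u n.-1) -> forall n, u n = 0.
Proof.
move=> c1 u0 x0 y0 xyc ub ux n.
have c0 : 0 <= c by apply: le_trans (xyc 0%N); rewrite addr_ge0.
have b0 : 0 <= b by apply: le_trans (ub 0%N).
have step B : 0 <= B -> (forall n, u n <= B) -> forall n, u n <= c * B.
  move=> B0 uB m; apply: (le_trans (ux m)).
  apply: (@le_trans _ _ ((x m + y m) * B)); last by rewrite ler_wpM2r.
  by rewrite mulrDl lerD// ler_wpM2l.
have ck k : forall n, u n <= c ^+ k * b.
  elim: k => [m|k IH m]; first by rewrite expr0 mul1r.
  by rewrite exprS -mulrA; apply: step => //; rewrite mulr_ge0// exprn_ge0.
apply/eqP; rewrite eq_le u0 andbT.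
have cv : (fun k => c ^+ k * b) @ \oo --> (0 : R).
  rewrite -(mul0r b); apply: cvgMl; apply: cvg_expr.
  by rewrite ger0_norm.
have lim0 : limn (fun k => c ^+ k * b) = 0 by apply/cvg_lim.
rewrite -lim0; apply: limr_ge; first by apply/cvg_ex; exists 0.
by apply: nearW => k; exact: ck.
Qed.

(** Summing the inequality over [n <= L], column dominance gives
    [(1 - c) * (u 0 + ... + u L) <= u L.+1], and the right-hand side tends to [0]. *)
Lemma column_dominated_eq0 (u x y : nat -> R) (c : R) : c < 1 ->
  (forall n, 0 <= u n) -> (forall n, 0 <= x n) -> (forall n, 0 <= y n) ->
  y 0%N = 0 -> y 1%N <= c -> (forall n, x n + y n.+2 <= c) ->
  (forall e, 0 < e -> exists2 k0, (forall k, (k0 <= k)%N -> u k < e) & True) ->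
  (forall n, u n <= x n * u n.+1 + y n * u n.-1) -> forall n, u n = 0.
Proof.
move=> c1 u0 x0 y0 y00 y1 xyc u_lim ux n.
have xc m : x m <= c by apply: le_trans (xyc m); rewrite lerDl.
have c0 : 0 <= c by apply: le_trans (xc 0%N).
have key L : \sum_(k < L.+1) u k <= c * \sum_(k < L) u k + (c - y L.+1) * u L
      + x L * u L.+1.
  elim: L => [|L IH].
    rewrite big_ord_recr !big_ord0 /= mulr0 !add0r.
    have := ux 0%N; rewrite y00 mul0r addr0 => h; apply: (le_trans h).
    by rewrite lerDr mulr_ge0// subr_ge0.
  rewrite big_ord_recr /= [\sum_(k < L.+1) u k]big_ord_recr /=.
  rewrite [\sum_(k < L.+1) u k]big_ord_recr /= in IH.
  have := ux L.+1; rewrite /=; have := mulr_ge0 (u0 L.+1) (_ : 0 <= c - x L - y L.+2).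
  have -> : 0 <= c - x L - y L.+2 by have := xyc L; lra.
  move=> /(_ isT); move: IH; move: (\sum_(k < L) u k) => s; lra.
have bound L : (1 - c) * \sum_(k < L.+1) u k <= u L.+1.
  have h : \sum_(k < L.+1) u k <= c * \sum_(k < L.+1) u k + c * u L.+1.
    apply: (le_trans (key L)); rewrite [in leRHS]big_ord_recr /= mulrDr.
    rewrite -!addrA lerD2l; apply: lerD; last by rewrite ler_wpM2r.
    by rewrite ler_wpM2r// gerBl.
  have : c * u L.+1 <= u L.+1 by rewrite ler_piMl// ltW.
  lra.
apply/eqP; rewrite eq_le u0 andbT leNgt; apply/negP => un.
have e0 : 0 < (1 - c) * u n by rewrite mulr_gt0// subr_gt0.
have [k0 k0P _] := u_lim _ e0.
have := k0P (maxn k0 n).+1 (leqW (leq_maxl _ _)).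
rewrite ltNge => /negP; apply; apply: le_trans (bound _).
apply: ler_wpM2l; first by rewrite subr_ge0 ltW.
apply: le_trans (@sum_le_widen R u n.+1 (maxn k0 n).+1 u0 _); last by rewrite ltnS leq_maxr.
by rewrite big_ord_recr /= lerDr sumr_ge0.
Qed.

(** The form bound for an approximating pair, with norms [G'] and [F'], carries over to
    the limit when all quantities are known up to multiples of [e]. *)
Lemma limit_quadratic (k X G F a : R) : 0 <= k -> 0 <= X -> 0 <= G -> 0 <= F -> 0 <= a ->
  (forall e, 0 < e -> exists X' G' F', [/\ 0 <= X' /\ 0 <= G', 0 <= F' /\ X <= X' + a * e,
     G' <= G + e, F' <= F + e & k * X' ^+ 2 <= G' * F']) -> k * X ^+ 2 <= G * F.
Proof.
move=> k0 X0 G0 F0 a0 h; apply: le_of_eps => d d0.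
pose S := G + F + 1 + 2 * (k * (a * X)).
have S0 : 0 < S by rewrite /S; have := mulr_ge0 k0 (mulr_ge0 a0 X0); lra.
pose e := Num.min 1 (d / S).
have e0 : 0 < e by rewrite lt_min ltr01 divr_gt0.
have e1 : e <= 1 by rewrite ge_min lexx.
have eS : e * S <= d by rewrite -ler_pdivlMr// ge_min lexx orbT.
have [X' [G' [F' [[X'0 G'0] [F'0 XX] GG FF kX]]]] := h e e0.
have h1 : k * (X ^+ 2 - 2 * (a * e * X)) <= k * X' ^+ 2.
  apply: ler_wpM2l => //; have ae : 0 <= a * e by rewrite mulr_ge0// ltW.
  have [aX|aX] := leP (a * e) X.
    have : (X - a * e) ^+ 2 <= X' ^+ 2 by rewrite ler_pXn2r ?nnegrE ?subr_ge0//; lra.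
    by have := sqr_ge0 (a * e); rewrite sqrrB -mulrnAr; move: (a * e) => z; nra.
  apply: (@le_trans _ _ 0); last exact: sqr_ge0.
  have : X * X <= (a * e) * X by rewrite ler_wpM2r// ltW.
  have : 0 <= a * e * X by rewrite mulr_ge0.
  by rewrite expr2; lra.
have h2 : G' * F' <= (G + e) * (F + e) by rewrite ler_pM.
have e2 : e * e <= e by rewrite ler_piMr// ltW.
move: eS; rewrite /S; move: h1 h2 kX e2; clear.
have -> : k * (X ^+ 2 - 2 * (a * e * X)) = k * X ^+ 2 - 2 * (e * (k * (a * X))) by ring.
have -> : (G + e) * (F + e) = G * F + e * G + e * F + e * e by ring.
have -> : e * (G + F + 1 + 2 * (k * (a * X))) = e * G + e * F + e + 2 * (e * (k * (a * X))) by ring.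
by lra.
Qed.

End RealRecursions.

(** * The form bound and selfadjointness under dominance *)

Section BlockDiagonal.
Variables (R : realType) (p : nat).
Local Notation C := R[i].
Local Notation H := (l2 R p).
Implicit Types (f g h u w : H) (c : C) (D : nat -> 'M[C]_p).

Definition block_fun D M (f : nat -> 'cV[C]_p) n : 'cV[C]_p :=
  if (n < M)%N then D n *m f n else 0.

Lemma block_fin D M f : finitely_supported (block_fun D M f).
Proof. by exists M => n; rewrite /block_fun leqNgt; case: ltnP. Qed.

Definition block_diag D M f : H := fin_l2 (block_fin D M f).

Lemma block_diagE D M f n : block_diag D M f n = if (n < M)%N then D n *m f n else 0.
Proof. by []. Qed.

Lemma block_diagB D M f g : block_diag D M (f - g) = block_diag D M f - block_diag D M g.
Proof.
apply: l2_ext => n; rewrite l2_subE !block_diagE; case: ifP => _.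
  by rewrite l2_subE mulmxBr.
by rewrite subr0.
Qed.

Lemma block_diag_bounded D M : exists2 a : R, 0 <= a & forall f, `|block_diag D M f| <= a * `|f|.
Proof.
have a0 : 0 <= \sum_(n < M) opnorm (D n) by rewrite sumr_ge0// => n _; exact: opnorm_ge0.
exists (\sum_(n < M) opnorm (D n)) => // f.
set a := \sum_(n < M) _ in a0 *.
have af : 0 <= a * `|f| by rewrite mulr_ge0.
rewrite -(@ler_pXn2r _ 2%N) ?nnegrE//; apply: norm_le_partial => L.
rewrite exprMn; apply: (@le_trans _ _ (\sum_(n < L) a ^+ 2 * vnorm (f n) ^+ 2)); last first.
  by rewrite -mulr_sumr; apply: ler_wpM2l (partial_le_norm f L); exact: sqr_ge0.
apply: ler_sum => n _; rewrite -exprMn.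
have an : 0 <= a * vnorm (f n) by rewrite mulr_ge0// vnorm_ge0.
rewrite ler_pXn2r ?nnegrE ?vnorm_ge0// block_diagE; case: ifP => [nM|_]; last by rewrite vnorm0.
apply: le_trans (vnorm_mulmx _ _) _; apply: ler_wpM2r; first exact: vnorm_ge0.
rewrite /a (bigD1 (Ordinal nM))//= lerDl sumr_ge0// => k _; exact: opnorm_ge0.
Qed.

Lemma sqr_norm_block_diag D M f :
  `|block_diag D M f| ^+ 2 = \sum_(n < M) vnorm (D n *m f n) ^+ 2.
Proof.
apply/eqP; rewrite eq_le; apply/andP; split.
  apply: norm_le_partial => L.
  apply: le_trans (@sum_le_widen R (fun n => vnorm (block_diag D M f n) ^+ 2) L (maxn M L) _ (leq_maxr _ _)) _.
    by move=> n; exact: sqr_ge0.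
  rewrite (@sum_vanish R (fun n => vnorm (block_diag D M f n) ^+ 2) M (maxn M L)) ?leq_maxl//.
    by apply: ler_sum => n _; rewrite block_diagE ltn_ord.
  by move=> n Mn; rewrite block_diagE ltnNge Mn /= vnorm0 expr0n.
apply: le_trans (partial_le_norm _ M).
by apply: ler_sum => n _; rewrite block_diagE ltn_ord.
Qed.

End BlockDiagonal.

Section Dominated.
Variables (R : realType) (p : nat).
Local Notation C := R[i].
Local Notation H := (l2 R p).
Implicit Types (f g h u w : H).
Variables (A B : nat -> 'M[C]_p) (x y : nat -> R) (c : R).
Hypothesis hA : forall n, (A n)^t* = A n.
Hypothesis uA : forall n, A n \in unitmx.
Hypothesis c1 : c < 1.
Hypothesis x0 : forall n, 0 <= x n.
Hypothesis y0 : forall n, 0 <= y n.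
Hypothesis hx : forall n (u : 'cV[C]_p), vnorm (invmx (A n) *m (B n *m u)) <= x n * vnorm u.
Hypothesis hy : forall n (u : 'cV[C]_p), vnorm (invmx (A n) *m ((Bpred B n)^t* *m u)) <= y n * vnorm u.
Hypothesis y00 : y 0%N = 0.
Hypothesis hdom : (forall n, x n + y n <= c) \/
  (y 1%N <= c /\ forall n, x n + y n.+2 <= c).

Local Notation S := (fun n => sgmx (A n)).
Local Notation D := (fun n => absqrt (A n)).

(** The estimate of the link between [n] and [n+1] is the geometric mean of [x n] and
    [y n.+1].  Under row dominance these are given as weights to [n] and [n+1]; under
    column dominance they are exchanged, so that the weights at one site come from one
    column. *)
Lemma dominated_weights : exists (l r : nat -> R),
  [/\ forall n, 0 <= l n, forall n, 0 <= r n, forall n, x n * y n.+1 = l n * r n.+1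
    & forall n, l n + r n <= c].
Proof.
case: hdom => [xyc|[y1c xyc]]; first by exists x, y.
exists (fun n => y n.+1), (fun n => if n is m.+1 then x m else 0); split=> //.
- by case.
- by move=> n; rewrite mulrC.
- by case=> [|n]; rewrite ?addr0// addrC.
Qed.

Lemma sqrt_amgm (l r a b : R) : 0 <= l -> 0 <= r ->
  Num.sqrt (l * r) * b * a <= (l * a ^+ 2 + r * b ^+ 2) / 2.
Proof.
move=> l0 r0; rewrite sqrtrM//.
have := sqr_ge0 (Num.sqrt l * a - Num.sqrt r * b).
have := sqr_sqrtr r0; have := sqr_sqrtr l0.
by move: (Num.sqrt l) (Num.sqrt r) => s t <- <-; lra.
Qed.

Lemma Re_vdot_add3 (P Q T s : 'cV[C]_p) : complex.Re (vdot (P + Q + T) s) =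
  complex.Re (vdot P s) + complex.Re (vdot Q s) + complex.Re (vdot T s).
Proof. by rewrite !vdotDl !ReD. Qed.

Lemma add_bounds (a u v P Q : R) : - u <= Q -> - v <= P -> a - u - v <= P + a + Q.
Proof. by lra. Qed.

Lemma link_le n (f g : 'cV[C]_p) : complex.Re (vdot (B n *m f) g) <=
  Num.sqrt (x n * y n.+1) * vnorm (D n.+1 *m f) * vnorm (D n *m g).
Proof.
exact: Re_vdot_absqrt_le (hA n) (uA n) (hA n.+1) (uA n.+1) (x0 n) (y0 n.+1) (hx n) (hy n.+1) f g.
Qed.

Lemma link_ge n (f g : 'cV[C]_p) : - (Num.sqrt (x n * y n.+1) * vnorm (D n.+1 *m f)
  * vnorm (D n *m g)) <= complex.Re (vdot (B n *m f) g).
Proof.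
have := link_le n (- f) g; rewrite !mulmxN vnormN vdotNl ReN; lra.
Qed.

(** Take the real part of the inner product of [J f] with [sgn A f]: the diagonal gives
    the form of [|A|], and the links are absorbed by the dominance. *)
Lemma preminimal_form (f g : H) M : preminimal_jacobi A B (f, g) ->
  (1 - c) * \sum_(n < M) vnorm (D n *m f n) ^+ 2 <= `|g| * `|f|.
Proof.
move=> [[N fN] fg]; have [l [r [l0 r0 xylr lrc]]] := dominated_weights.
pose q n := vnorm (D n *m f n) ^+ 2.
pose t n := complex.Re (vdot (g n) (S n *m f n)).
have q0 n : 0 <= q n by exact: sqr_ge0.
have ht n : t n >= q n - (l n * q n + r n.+1 * q n.+1) / 2
     - (if n is m.+1 then l m * q m + r n * q n else 0) / 2.
  have main : complex.Re (vdot (A n *m f n) (S n *m f n)) = q n by exact: Re_vdot_sgmx.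
  have up := link_ge n (f n.+1) (S n *m f n).
  rewrite (vnorm_absqrt_sgmx (hA n) (uA n)) xylr in up.
  have {}up := le_trans _ up.
  have {}up : - ((l n * q n + r n.+1 * q n.+1) / 2) <=
      complex.Re (vdot (B n *m f n.+1) (S n *m f n)).
    by apply: up; rewrite lerN2; exact: sqrt_amgm.
  have low : - ((if n is m.+1 then l m * q m + r n * q n else 0) / 2) <=
      complex.Re (vdot ((Bpred B n)^t* *m f n.-1) (S n *m f n)).
    case: n {main up} => [|n] /=.
      by rewrite trmx0 map_mx0 mul0mx vdot0l mul0r oppr0.
    rewrite vdot_mulmxl trmxCK vdotC ReJ.
    have lo := link_ge n (S n.+1 *m f n.+1) (f n).
    rewrite (vnorm_absqrt_sgmx (hA n.+1) (uA n.+1)) xylr in lo.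
    by apply: le_trans lo; rewrite lerN2; exact: sqrt_amgm.
  rewrite /t (fg n) Re_vdot_add3 main; exact: add_bounds up low.
pose L := maxn M N.
have qL : q L = 0 by rewrite /q fN ?leq_maxr// mulmx0 vnorm0 expr0n.
have := dominated_sum_ge q0 l0 r0 ht L; rewrite qL mulr0 subr0 => h.
have h1 : (1 - c) * \sum_(n < L) q n <= \sum_(n < L) t n.
  apply: le_trans h; rewrite mulr_sumr; apply: ler_wpDr.
    rewrite divr_ge0//; case: (L) => // m; rewrite addr_ge0// mulr_ge0//.
  apply: ler_sum => n _; have := ler_wpM2r (q0 n) (lrc n).
  by move: (q n) => z; lra.
have h2 : \sum_(n < L) t n <= `|g| * `|f|.
  apply: le_trans (sum_vnormM_le g f L); apply: ler_sum => n _.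
  by apply: le_trans (Re_vdot_le _ _) _; rewrite vnorm_sgmx.
apply: le_trans h2; apply: le_trans h1; apply: ler_wpM2l; first by rewrite subr_ge0 ltW.
exact: (@sum_le_widen R q M L q0 (leq_maxl _ _)).
Qed.

(** The lower bound passes from finitely supported sequences to the domain of
    the closure, the truncated forms being continuous. *)
Lemma minimal_form (f g : H) M : minimal_jacobi A B (f, g) ->
  (1 - c) * \sum_(n < M) vnorm (D n *m f n) ^+ 2 <= `|g| * `|f|.
Proof.
move=> /closure_pairP fg.
have [a a0 Da] := block_diag_bounded D M.
have /= <- := sqr_norm_block_diag D M f; apply: (limit_quadratic _ _ _ _ a0).
- by rewrite subr_ge0 ltW.
- exact: normr_ge0.
- exact: normr_ge0.
- exact: normr_ge0.
move=> e e0; have [[f' g'] [fg' ff gg]] := fg e e0.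
have close (h h' : H) : `|h - h'| < e -> `|h'| <= `|h| + e.
  move=> hh; rewrite -{1}(subrK h h') addrC; apply: le_trans (ler_normD _ _) _.
  by rewrite lerD2l distrC; exact: ltW.
exists `|block_diag D M f'|, `|g'|, `|f'|; split.
- by split; exact: normr_ge0.
- split; first exact: normr_ge0.
  rewrite -{1}(subrK (block_diag D M f') (block_diag D M f)) addrC.
  apply: le_trans (ler_normD _ _) _; rewrite lerD2l -block_diagB.
  by apply: le_trans (Da _) _; apply: ler_wpM2l a0 _ _ (ltW ff).
- exact: close gg.
- exact: close ff.
- by rewrite (sqr_norm_block_diag D M f'); exact: preminimal_form.
Qed.

(** Solve the recurrence for [u n] and take norms; the scalar inequality has only the
    zero solution among sequences that tend to [0]. *)
Lemma maximal_kernel (u : H) : maximal_jacobi A B (u, 0) -> u = 0.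
Proof.
move=> hu; pose v n := vnorm (u n).
have v0 n : 0 <= v n by exact: vnorm_ge0.
have vb n : v n <= `|u| by exact: vnorm_le_norm.
have vE n : v n <= x n * v n.+1 + y n * v n.-1.
  have e : u n = - (invmx (A n) *m (B n *m u n.+1) + invmx (A n) *m ((Bpred B n)^t* *m u n.-1)).
    have hn : (0 : H) n = jacobi_action A B u n := hu n.
    move: hn; rewrite l2_0E /jacobi_action => /(congr1 (mulmx (invmx (A n)))).
    rewrite mulmx0 !mulmxDr (mulmxA _ (A n)) mulVmx// mul1mx => /esym h.
    by apply/eqP; rewrite -addr_eq0 [X in _ + X]addrC addrA [X in X + _]addrC h.
  rewrite /v e vnormN; apply: le_trans (vnormD _ _) _; apply: lerD; [exact: hx|exact: hy].
have vz : forall n, v n = 0.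
  case: hdom => [xyc|[y1c xyc]].
    exact: (row_dominated_eq0 c1 v0 x0 y0 xyc vb vE).
  apply: (column_dominated_eq0 c1 v0 x0 y0 y00 y1c xyc _ vE) => e e0.
  have e2 : 0 < (e / 2) ^+ 2 by rewrite exprn_gt0// divr_gt0.
  have [m mP] := l2_tail u e2; exists m => // k mk.
  have := mP k.+1; rewrite big_nat_recr //= => h.
  have : v k ^+ 2 <= (e / 2) ^+ 2.
    by apply: le_trans h; rewrite lerDr sumr_ge0// => n _; exact: sqr_ge0.
  have e20 : 0 <= e / 2 by rewrite divr_ge0 ?ltW.
  rewrite ler_pXn2r ?nnegrE// => h'; apply: le_lt_trans h' _; lra.
by apply: l2_ext => n; apply: vnorm_eq0; exact: vz.
Qed.

Hypothesis hdiv : forall t : R, exists m, forall n, (m <= n)%N ->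
  forall v, t * vnorm v ^+ 2 <= vnorm (D n *m v) ^+ 2.

(** The form bound controls the form of [|A|], whose blocks tend to infinity. *)
Lemma minimal_tight : tight_rel (minimal_jacobi A B).
Proof.
move=> b e e0; have cc : 0 < 1 - c by rewrite subr_gt0.
have [m mP] := hdiv ((b ^+ 2 / (1 - c)) / e).
exists m => f [g [fg fb gb]] M.
have b0 : 0 <= b by apply: le_trans fb; exact: normr_ge0.
have [Mm|mM] := leqP M m; first by rewrite big_geq// ltW.
have h1 : \sum_(n < M) vnorm (D n *m f n) ^+ 2 <= b ^+ 2 / (1 - c).
  rewrite ler_pdivlMr// mulrC; apply: le_trans (minimal_form M fg) _.
  by rewrite expr2; apply: ler_pM gb fb; exact: normr_ge0.
have h2 : \sum_(m <= n < M) vnorm (D n *m f n) ^+ 2 <= b ^+ 2 / (1 - c).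
  apply: le_trans h1; rewrite (@sum_split_nat R (fun n => vnorm (D n *m f n) ^+ 2) m M (ltnW mM)).
  by rewrite lerDr sumr_ge0// => n _; exact: sqr_ge0.
have h3 : (b ^+ 2 / (1 - c)) / e * \sum_(m <= n < M) vnorm (f n) ^+ 2 <= b ^+ 2 / (1 - c).
  by apply: le_trans h2; rewrite mulr_sumr; apply: sum_tail_le => n mn; exact: mP.
have [k0|k0] := eqVneq (b ^+ 2 / (1 - c)) 0.
  have bz : b = 0.
    by move/eqP: k0; rewrite mulf_eq0 invr_eq0 sqrf_eq0 (gt_eqF cc) orbF => /eqP.
  rewrite big1_seq ?(ltW e0)// => n _; have := vnorm_le_norm f n.
  move=> /le_trans /(_ fb); rewrite bz => vz; apply/eqP; rewrite sqrf_eq0.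
  by rewrite eq_le vz vnorm_ge0.
have kp : 0 < b ^+ 2 / (1 - c).
  by rewrite lt_neqAle eq_sym k0 divr_ge0 ?sqr_ge0// ltW.
have := h3; rewrite mulrAC -mulrA ger_pMr// mulrC ler_pdivrMl//.
by rewrite mulr1.
Qed.

(** The minimal operator is onto: its range is dense, as an orthogonal vector is in the
    kernel of the adjoint, and it has a bounded inverse.  An element of the maximal domain
    differs from a preimage of its image by an element of the kernel. *)
Theorem minimal_eq_maximal : minimal_jacobi A B = maximal_jacobi A B.
Proof.
apply/seteqP; split; first exact: minimal_sub_maximal.
have minj f : minimal_jacobi A B (f, 0) -> f = 0.
  by move=> /minimal_sub_maximal; exact: maximal_kernel.
have [b b0 bP] := apriori_bound (minimal_linear A B) (@minimal_closed _ _ A B) minimal_tight minj.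
have full : forall h, exists f, minimal_jacobi A B (f, h).
  apply: (range_full b0 (minimal_linear A B) (@minimal_closed _ _ A B) bP) => u hu.
  apply: maximal_kernel; rewrite -(adjoint_minimal B hA) => -[f g] fg /=.
  by rewrite l2dot0r; exact: hu fg.
move=> [u0 w0]; move: (u0 : H) (w0 : H) => {u0 w0} u w uw.
have [v vw] := full w.
suff -> : u = v by [].
apply/eqP; rewrite -subr_eq0; apply/eqP/maximal_kernel.
by rewrite -(subrr w); apply: linear_relB (maximal_linear A B) uw (minimal_sub_maximal vw).
Qed.

End Dominated.

(** * Reduction of the five conditions to dominance *)

Section Conditions.
Variables (R : realType) (p : nat).
Implicit Types (A B : nat -> 'M[R[i]]_p) (u : nat -> R).

Lemma le_supge N u n : (N <= n)%N -> ((u n)%:E <= supge N u)%E.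
Proof. by move=> Nn; apply: ereal_sup_ubound; exists n. Qed.

Lemma supge_ltP N u (t : R) : (supge N u < t%:E)%E ->
  exists2 c, c < t & forall n, (N <= n)%N -> u n <= c.
Proof.
move=> ut; have uN := @le_supge N u N (leqnn N).
have fin : supge N u \is a fin_num.
  rewrite fin_numElt (lt_le_trans _ uN) ?ltNyr//=.
  by apply: lt_trans ut _; exact: ltry.
exists (fine (supge N u)); first by rewrite -lte_fin fineK.
by move=> n Nn; rewrite -lee_fin fineK//; exact: le_supge.
Qed.

Lemma half_powR (s : R) : 1 <= s -> (2 `^ (s - 1))^-1 / 2 = 2^-1 `^ s :> R.
Proof.
move=> s1; have h : 2^-1 `^ s * 2 `^ s = 1 :> R.
  by rewrite -powRM ?invr_ge0// mulVf// powR1.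
have h2 : 2 `^ s = 2 `^ (s - 1) * 2 :> R.
  by rewrite -{3}(powRr1 (ltW (ltr0Sn R 1))) -powRD ?subrK// pnatr_eq0 implybT.
have p0 : 0 < 2 `^ s :> R by rewrite powR_gt0.
rewrite -invfM -h2; apply: (mulIf (lt0r_neq0 p0)).
by rewrite mulVf ?h// gt_eqF.
Qed.

(** By convexity [((a + b) / 2)^s <= (a^s + b^s) / 2 <= c0 / 2], and the bound on [c0]
    says that [c0 / 2 < (1/2)^s]. *)
Lemma power_mean (s c0 : R) : 1 <= s -> c0 < (2 `^ (s - 1))^-1 ->
  exists2 c, c < 1 & forall a b : R, 0 <= a -> 0 <= b -> a `^ s + b `^ s <= c0 ->
    a + b <= c.
Proof.
move=> s1 c0s; have s0 : 0 < s by apply: lt_le_trans s1.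
have [c00|c00] := ltP c0 0.
  exists 0 => // a b a0 b0 h; exfalso; move: c00; rewrite ltNge => /negP; apply.
  by apply: le_trans h; rewrite addr_ge0// powR_ge0.
pose w := (c0 / 2) `^ s^-1.
have w0 : 0 <= w by exact: powR_ge0.
have ws : w `^ s = c0 / 2.
  by rewrite /w -powRrM mulVf ?gt_eqF// powRr1// divr_ge0.
have w2 : w < 2^-1.
  rewrite ltNge; apply/negP => h.
  have := ge0_ler_powR (ltW s0) _ _ h; rewrite !nnegrE invr_ge0 => /(_ (ler0n _ 2) w0).
  rewrite ws -half_powR// ler_pM2r ?invr_gt0// leNgt c0s //.
exists (2 * w) => [|a b a0 b0 h]; first by lra.
rewrite leNgt; apply/negP => ab.
have v0 : 0 <= 2^-1 * a + 2^-1 * b by rewrite addr_ge0// mulr_ge0// invr_ge0.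
have wv : w < 2^-1 * a + 2^-1 * b by lra.
have := gt0_ltr_powR s0 w0 v0 wv; rewrite ws ltNge => /negP; apply.
have i1 : (0 <= (2^-1 : R) <= 1) by rewrite invr_ge0 ler0n invf_le1 ?ler1n.
have cvx : (2^-1 * a + 2^-1 * b) `^ s <= 2^-1 * a `^ s + 2^-1 * b `^ s.
  have [i10 i11] := andP i1.
  rewrite {2 4}(_ : 2^-1 = 1 - 2^-1); last by field.
  by apply: (convex_powR s1 (Itv01 i10 i11)); rewrite inE /= in_itv /= ?a0 ?b0.
by apply: (le_trans cvx); lra.
Qed.

(** In (i) and (ii) both suprema cannot be at least [1]; in (iii) and (iv) use power means;
    in (v) add the two bounds. *)
Lemma conditions_dominated A B :
  cond_i A B \/ cond_ii A B \/ cond_iii A B \/ cond_iv A B \/ cond_v A B ->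
  exists N c, c < 1 /\
    ((forall n, (N <= n)%N -> nAB A B n + nABpred A B n <= c) \/
     (forall n, (N <= n)%N -> nAB A B n + nABpred A B n.+2 <= c)).
Proof.
have row N : (a1 A B N < 1)%E -> exists N c, c < 1 /\
    ((forall n, (N <= n)%N -> nAB A B n + nABpred A B n <= c) \/
     (forall n, (N <= n)%N -> nAB A B n + nABpred A B n.+2 <= c)).
  by move=> /supge_ltP[c c1 h]; exists N, c; split=> //; left.
have col N : (a2 A B N < 1)%E -> exists N c, c < 1 /\
    ((forall n, (N <= n)%N -> nAB A B n + nABpred A B n <= c) \/
     (forall n, (N <= n)%N -> nAB A B n + nABpred A B n.+2 <= c)).
  by move=> /supge_ltP[c c1 h]; exists N, c; split=> //; right.
move=> [[N [f1 f2 h]]|[[N [[_ h]|[h _]]]|[[N [s [s1 /supge_ltP[c0 c0s h]]]]|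
  [[N [s [s1 /supge_ltP[c0 c0s h]]]]|[N [/supge_ltP[c1 c1h h1] /supge_ltP[c2 c2h h2]]]]]]].
- have [a1l|a1g] := ltP (a1 A B N) 1%E; first exact: row a1l.
  have [a2l|a2g] := ltP (a2 A B N) 1%E; first exact: col a2l.
  exfalso; move: h; rewrite ltNge => /negP; apply.
  have := lee_pmul (@lee01 R) (@lee01 R) a1g a2g; rewrite mule1; exact.
- exact: col h.
- exact: row h.
- have [c c1 ab] := power_mean s1 c0s; exists N, c; split=> //; left=> n Nn.
  by apply: ab (h n Nn); exact: opnorm_ge0.
- have [c c1 ab] := power_mean s1 c0s; exists N, c; split=> //; right=> n Nn.
  by apply: ab (h n Nn); exact: opnorm_ge0.
- exists N, (c1 + c2); split; first lra.
  by left=> n Nn; exact: lerD (h1 n Nn) (h2 n Nn).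
Qed.

End Conditions.

(** * Finite perturbations of the diagonal and resolvents *)

Section Perturbation.
Variables (R : realType) (p : nat).
Local Notation C := R[i].
Local Notation H := (l2 R p).
Implicit Types (f g h u w : H) (A B : nat -> 'M[C]_p).

Lemma add_replace (V : zmodType) (x y a a' : V) : x + a + y = x + a' + y + (a - a').
Proof. by rewrite [X in _ = X + _]addrAC addrA [X in _ = X - _]addrAC addrK addrAC. Qed.

Lemma jacobi_action_perturb A A' B f N n :
  (forall k, (N <= k)%N -> A k = A' k) ->
  jacobi_action A B f n =
  jacobi_action A' B f n + block_diag (fun k => A k - A' k) N f n.
Proof.
move=> AA'; rewrite block_diagE /jacobi_action; case: ltnP => nN.
  by rewrite mulmxBl; exact: add_replace.
by rewrite AA'// addr0.
Qed.

(** The perturbation is a bounded operator, so it commutes with the closure. *)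
Lemma minimal_perturb A A' B N f g : (forall k, (N <= k)%N -> A k = A' k) ->
  minimal_jacobi A' B (f, g) ->
  minimal_jacobi A B (f, g + block_diag (fun k => A k - A' k) N f).
Proof.
move=> AA' /closure_pairP fg; apply/closure_pairP => e e0.
set P := block_diag _ N; have [b b0 Pb] := block_diag_bounded (fun k => A k - A' k) N.
have b1 : 0 < b + 1 by lra.
have d0 : 0 < e / (b + 1) / 2 by rewrite !divr_gt0.
have de : e / (b + 1) / 2 < e.
  rewrite -mulrA gtr_pMr// -invfM invf_lt1 ?mulr_gt0//; lra.
have [[f' g'] [[ff fg'] fe ge]] := fg _ d0.
exists (f', g' + P f'); split.
- by split=> // n; rewrite (jacobi_action_perturb B _ n AA') -(fg' n).
- exact: lt_trans fe de.
rewrite /= opprD addrACA -block_diagB; apply: le_lt_trans (ler_normD _ _) _.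
have h1 : `|P (f - f')| <= b * (e / (b + 1) / 2).
  by apply: le_trans (Pb _) _; apply: ler_wpM2l b0 _ _ (ltW fe).
apply: (@lt_le_trans _ _ (e / (b + 1) / 2 + b * (e / (b + 1) / 2))).
  exact: ltr_leD ge h1.
have -> : e / (b + 1) / 2 + b * (e / (b + 1) / 2) = e / 2.
  by field; rewrite gt_eqF.
by rewrite ler_pdivrMr// ler_pMr// ler1n.
Qed.

Lemma maximal_perturb A A' B N f g : (forall k, (N <= k)%N -> A k = A' k) ->
  maximal_jacobi A' B (f, g) ->
  maximal_jacobi A B (f, g + block_diag (fun k => A k - A' k) N f).
Proof.
by move=> AA' fg n; rewrite (jacobi_action_perturb B _ n AA') -(fg n).
Qed.

Lemma block_diag_opp A A' N f :
  block_diag (fun k => A k - A' k) N f = - block_diag (fun k => A' k - A k) N f.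
Proof.
apply: l2_ext => n; rewrite l2_oppE !block_diagE; case: ifP => _; last by rewrite oppr0.
by rewrite -opprB mulNmx.
Qed.

Lemma minimal_eq_maximal_perturb A A' B N : (forall k, (N <= k)%N -> A k = A' k) ->
  minimal_jacobi A' B = maximal_jacobi A' B -> minimal_jacobi A B = maximal_jacobi A B.
Proof.
move=> AA' e; have A'A k : (N <= k)%N -> A' k = A k by move=> /AA' ->.
apply/seteqP; split; first exact: minimal_sub_maximal.
move=> [f0 g0]; move: (f0 : H) (g0 : H) => {f0 g0} f g fg.
have := maximal_perturb A'A fg; rewrite -e => /(minimal_perturb AA').
by rewrite (block_diag_opp A A' N f) addrK.
Qed.

Lemma minimal_tight_perturb A A' B N : (forall k, (N <= k)%N -> A k = A' k) ->
  tight_rel (minimal_jacobi A' B) -> tight_rel (minimal_jacobi A B).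
Proof.
move=> AA' At b e e0; have A'A k : (N <= k)%N -> A' k = A k by move=> /AA' ->.
have [a a0 Pa] := block_diag_bounded (fun k => A' k - A k) N.
have [m mP] := At (b + a * b) e e0; exists m => f [g [fg fb gb]] M; apply: mP.
have b0 : 0 <= b by apply: le_trans fb; exact: normr_ge0.
have ab : 0 <= a * b by rewrite mulr_ge0.
exists (g + block_diag (fun k => A' k - A k) N f); split.
- exact: minimal_perturb A'A fg.
- by apply: le_trans fb _; rewrite lerDl.
- apply: le_trans (ler_normD _ _) _; apply: lerD gb _; apply: le_trans (Pa f) _.
  exact: ler_wpM2l a0 _ _ fb.
Qed.

Lemma op_shift_linear (G : set (H * H)) (z : C) : linear_rel G -> linear_rel (op_shift G z).
Proof.
move=> [G0 Gl]; split; first by rewrite /op_shift /= scaler0 addr0.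
move=> c f g f' g'; rewrite /op_shift /= => fg fg'.
have -> : g + c *: g' + z *: (f + c *: f') = (g + z *: f) + c *: (g' + z *: f').
  by rewrite !scalerDr addrACA !scalerA (mulrC z c).
exact: Gl fg fg'.
Qed.

Lemma op_shift_closed (G : set (H * H)) (z : C) : closure G `<=` G ->
  closure (op_shift G z) `<=` op_shift G z.
Proof.
move=> Gc [f0 g0]; move: (f0 : H) (g0 : H) => {f0 g0} f g /closure_pairP fg.
rewrite /op_shift /=; apply: Gc; apply/closure_pairP => e e0.
have n0 : 0 <= normc z by case: (z) => a b; exact: sqrtr_ge0.
have b1 : 0 < normc z + 1 by lra.
have d0 : 0 < e / (normc z + 1) / 2 by rewrite !divr_gt0.
have de : e / (normc z + 1) / 2 < e.
  rewrite -mulrA gtr_pMr// -invfM invf_lt1 ?mulr_gt0//; lra.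
have [[f' g'] [fg' fe ge]] := fg _ d0.
exists (f', g' + z *: f'); split; first exact: fg'.
- exact: lt_trans fe de.
rewrite /= opprD addrACA -scalerBr; apply: le_lt_trans (ler_normD _ _) _.
have h1 : `|z *: (f - f')| <= normc z * (e / (normc z + 1) / 2).
  by rewrite (l2_normZ z (f - f')); apply: ler_wpM2l n0 _ _ (ltW fe).
apply: (@lt_le_trans _ _ (e / (normc z + 1) / 2 + normc z * (e / (normc z + 1) / 2))).
  exact: ltr_leD ge h1.
have -> : e / (normc z + 1) / 2 + normc z * (e / (normc z + 1) / 2) = e / 2.
  by field; rewrite gt_eqF.
by rewrite ler_pdivrMr// ler_pMr// ler1n.
Qed.

Lemma op_shift_tight (G : set (H * H)) (z : C) : tight_rel G -> tight_rel (op_shift G z).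
Proof.
move=> Gt b e e0; have n0 : 0 <= normc z by case: (z) => a b'; exact: sqrtr_ge0.
have [m mP] := Gt (b + normc z * b) e e0; exists m => f [g [fg fb gb]] M; apply: mP.
have b0 : 0 <= b by apply: le_trans fb; exact: normr_ge0.
have zb : 0 <= normc z * b by rewrite mulr_ge0.
exists (g + z *: f); split; first exact: fg.
- by apply: le_trans fb _; rewrite lerDl.
- apply: le_trans (ler_normD _ _) _; apply: lerD gb _; rewrite (l2_normZ z f).
  exact: ler_wpM2l n0 _ _ fb.
Qed.

(** If [G - z] is injective, so is [G] minus the conjugate of [z]: for real [z] they are
    the same, and for non-real [z] by selfadjointness.  This makes the ranges of both
    dense, and their inverses are adjoint to each other. *)
Lemma selfadjoint_resolvent (G : set (H * H)) (z : C) :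
  linear_rel G -> closure G `<=` G -> tight_rel G -> op_adjoint G = G ->
  (forall f, op_shift G z (f, 0) -> f = 0) ->
  exists (K K' : {linear H -> H}) (b : R),
    [/\ op_inverse (op_shift G z) = op_graph K, compact_operator K,
        forall h, op_shift G z (K h, h),
        forall h, `|K h| <= b * `|h| /\ `|K' h| <= b * `|h|
      & forall f g, l2dot (K f) g = l2dot f (K' g)].
Proof.
move=> Gl Gc Gt Gsa Ginj.
have sym f g f' g' : G (f, g) -> G (f', g') -> l2dot g f' = l2dot f g'.
  by move=> fg; rewrite -{1}Gsa => /(_ _ fg).
have Ginj' : forall f, op_shift G z^*%R (f, 0) -> f = 0.
  have [z0|z0] := eqVneq (complex.Im z) 0.
    have -> : z^*%R = z by case: (z) z0 => a b /= ->; rewrite /Num.conj /= oppr0.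
    exact: Ginj.
  move=> f; rewrite /op_shift /= add0r => fg.
  have := sym _ _ _ _ fg fg; rewrite l2dotZl l2dotZr conjCK l2dotxx => h.
  have : complex.Im (z^*%R * (`|f| ^+ 2)%:C) = complex.Im (z * (`|f| ^+ 2)%:C) by rewrite h.
  have -> : complex.Im (z^*%R * (`|f| ^+ 2)%:C) = - (complex.Im z * `|f| ^+ 2).
    by move: (`|f| ^+ 2) => t; case: (z) => a b /=; ring.
  have -> : complex.Im (z * (`|f| ^+ 2)%:C) = complex.Im z * `|f| ^+ 2.
    by move: (`|f| ^+ 2) => t; case: (z) => a b /=; ring.
  move=> h2; have : complex.Im z * `|f| ^+ 2 = 0 by lra.
  move/eqP; rewrite mulf_eq0 (negbTE z0) /= sqrf_eq0 normr_eq0 => /eqP; exact.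
have orth (t : C) : (forall f, op_shift G t^*%R (f, 0) -> f = 0) ->
    forall u, (forall f g, op_shift G t (f, g) -> l2dot g u = 0) -> u = 0.
  move=> tinj u hu; apply: tinj; rewrite /op_shift /= add0r -Gsa => -[f0 g0].
  move: (f0 : H) (g0 : H) => {f0 g0} f g fg.
  have := hu f (g - t *: f); rewrite /op_shift /= subrK => /(_ fg).
  rewrite l2dotBl l2dotZl l2dotZr conjCK => /eqP; rewrite subr_eq0 => /eqP; exact.
have [K [b [KE KG Kb Kc]]] := compact_inverse (op_shift_linear z Gl)
  (@op_shift_closed G z Gc) (op_shift_tight z Gt) Ginj (orth _ Ginj').
have Ginj2 : forall f, op_shift G (z^*%R)^*%R (f, 0) -> f = 0 by rewrite conjCK.
have [K' [b' [_ KG' Kb' _]]] := compact_inverse (op_shift_linear z^*%R Gl)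
  (@op_shift_closed G z^*%R Gc) (op_shift_tight z^*%R Gt) Ginj' (orth _ Ginj2).
exists K, K', (Num.max b b'); split; [exact: KE|exact: Kc|exact: KG| |].
  move=> h; split.
    by apply: le_trans (Kb h) _; apply: ler_wpM2r; [exact: normr_ge0|rewrite le_max lexx].
  by apply: le_trans (Kb' h) _; apply: ler_wpM2r; [exact: normr_ge0|rewrite le_max lexx orbT].
move=> f g; have := sym _ _ _ _ (KG f) (KG' g).
rewrite /= l2dotDl l2dotDr l2dotZl l2dotZr conjCK => /addIr ->.
by [].
Qed.

End Perturbation.

(** * Comparison of singular values *)

Section SumComparison.
Variable R : realType.

Lemma sum_uniq_le (a : nat -> R) (t : seq nat) : (forall i, 0 <= a i) -> uniq t ->
  exists L, \sum_(i <- t) a i <= \sum_(i < L) a i.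
Proof.
move=> a0 ut; have [L tL] : exists L, forall i, i \in t -> (i < L)%N.
  elim: t {ut} => [|j t [L IH]]; first by exists 0%N.
  exists (maxn L j.+1) => i; rewrite inE => /orP[/eqP->|/IH iL].
    exact: leq_maxr.
  exact: leq_trans iL (leq_maxl _ _).
exists L; rewrite -(big_mkord xpredT a) /index_iota subn0.
have /(perm_big _)-> : perm_eq t [seq i <- iota 0 L | i \in t].
  apply: uniq_perm => //; first by rewrite filter_uniq// iota_uniq.
  move=> i; rewrite mem_filter mem_iota /= add0n.
  by case: (boolP (i \in t)) => //= /tL ->.
rewrite big_filter big_mkcond; apply: ler_sum => i _.
by case: ifP.
Qed.

(** Applied to the set [t] of indices used so far, the hypothesis provides a new index
    for the next term of [s]; so the terms of [s] from index [m] on are matched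
    injectively with terms of [sg] that dominate them up to the factor [k]. *)
Lemma injective_domination (s sg : nat -> R) (r k : R) (m : nat) : 0 < r -> 0 < k ->
  (forall n, 0 <= s n) -> (forall n, 0 <= sg n) ->
  (forall t : seq nat, uniq t -> exists2 i, i \notin t & k * s (m + size t)%N <= sg i) ->
  (\sum_(0 <= n <oo) (sg n `^ r)%:E < +oo)%E -> (\sum_(0 <= n <oo) (s n `^ r)%:E < +oo)%E.
Proof.
move=> r0 k0 s0 sg0 claim fin.
have p0 (a : R) : 0 <= a `^ r by exact: powR_ge0.
have [S SE] : exists S : R, forall L, \sum_(i < L) sg i `^ r <= S.
  exists (fine (\sum_(0 <= n <oo) (sg n `^ r)%:E)%E) => L.
  rewrite -lee_fin fineK; last first.
    rewrite ge0_fin_numE//; apply: nneseries_ge0 => n _ _; by rewrite lee_fin.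
  rewrite -sumEFin -(big_mkord xpredT (fun n => (sg n `^ r)%:E)).
  by apply: nneseries_lim_ge => n _ _; rewrite lee_fin.
have match_n n : exists2 t : seq nat, uniq t /\ size t = n &
    \sum_(i < n) (k * s (m + i)%N) `^ r <= \sum_(i <- t) sg i `^ r.
  elim: n => [|n [t [ut st] IH]]; first by exists [::] => //; rewrite big_ord0 big_nil.
  have [i it ki] := claim t ut; exists (i :: t); first by rewrite /= it ut st.
  rewrite big_ord_recr big_cons addrC lerD// ge0_ler_powR ?nnegrE ?(ltW r0)//.
    by rewrite mulr_ge0// ltW.
  by rewrite -st.
have kr : 0 < k `^ r by rewrite powR_gt0.
pose T := \sum_(i < m) s i `^ r + (k `^ r)^-1 * S.
have sT M : \sum_(i < M) s i `^ r <= T.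
  apply: le_trans (@sum_le_widen R (fun i => s i `^ r) M (m + M) _ (leq_addl _ _)) _ => //.
  rewrite big_split_ord /= lerD2l ler_pdivlMl// mulr_sumr.
  have [t [ut _] h] := match_n M; have [L hL] := @sum_uniq_le (fun i => sg i `^ r) t (fun i => p0 _) ut.
  apply: le_trans (SE L); apply: le_trans hL; apply: le_trans h; apply: ler_sum => i _.
  by rewrite powRM// ltW.
apply: (@le_lt_trans _ _ T%:E); last exact: ltry.
apply: lime_le; first by apply: is_cvg_nneseries => n _ _; rewrite lee_fin.
by apply: nearW => M; rewrite sumEFin lee_fin big_mkord.
Qed.

End SumComparison.

Section Diagonal.
Variables (R : realType) (p : nat).
Local Notation C := R[i].
Local Notation H := (l2 R p).
Implicit Types (f g h u w : H).

Lemma singular_kernel (M : 'M[C]_p) : M \notin unitmx ->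
  exists2 v : 'cV[C]_p, v != 0 & M *m v = 0.
Proof.
rewrite -unitmx_tr -row_free_unit -kermx_eq0 => /rowV0Pn[u /sub_kermxP uM u0].
exists u^T; first by rewrite trmx_eq0.
by apply: trmx_inj; rewrite trmx_mul trmxK uM trmx0.
Qed.

Variable A : nat -> 'M[C]_p.
Hypothesis hA : forall n, (A n)^t* = A n.

Lemma unit_l2_inj n (v : 'cV[C]_p) : unit_l2 n v = 0 -> v = 0.
Proof. by move=> /(congr1 (fun f : H => f n)); rewrite unit_l2E eqxx. Qed.

Lemma diag_unitmx : op_kernel (diag_operator A) = [set 0] -> forall n, A n \in unitmx.
Proof.
move=> hker n; apply: contrapT => /negP /singular_kernel[v v0 Av].
have : op_kernel (diag_operator A) (unit_l2 n v).
  have e k : (0 : H) k = A k *m unit_l2 n v k.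
    by rewrite l2_0E unit_l2E; case: eqP => [->|_]; rewrite ?Av// mulmx0.
  exact: e.
rewrite hker => /unit_l2_inj v00; by rewrite v00 eqxx in v0.
Qed.

Hypothesis uA : forall n, A n \in unitmx.
Variable KA : {linear H -> H}.
Hypothesis hKA : op_inverse (diag_operator A) = op_graph KA.

Lemma diag_inverseE f n : KA f n = invmx (A n) *m f n.
Proof.
have : op_graph KA (f, KA f) by [].
rewrite -hKA => /(_ n) /= ->; by rewrite mulmxA mulVmx// mul1mx.
Qed.

Lemma diag_inverse_inj f : KA f = 0 -> f = 0.
Proof.
move=> f0; apply: l2_ext => n; have := diag_inverseE f n.
rewrite f0 !l2_0E => /esym /(congr1 (mulmx (A n))).
by rewrite mulmxA mulmxV// mul1mx mulmx0.
Qed.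

Local Notation ev n j := (eigval (A n) j).
Local Notation vec n j := (eigvec (A n) j).

Lemma invmx_eigvec n j : invmx (A n) *m vec n j = ((ev n j)^-1)%:C *: vec n j.
Proof.
have a0 := eigval_neq0 j (hA n) (uA n).
apply: (can_inj (mulKmx (uA n))); rewrite mulmxA mulmxV// mul1mx -scalemxAr.
by rewrite (mulmx_eigvec j (hA n)) scalerA -rmorphM /= mulVf// rmorph1 scale1r.
Qed.

Lemma diag_inverse_eigvec n j :
  KA (unit_l2 n (vec n j)) = unit_l2 n (((ev n j)^-1)%:C *: vec n j).
Proof.
apply: l2_ext => k; rewrite diag_inverseE !unit_l2E; case: eqP => [->|_].
  exact: invmx_eigvec.
by rewrite mulmx0.
Qed.

(** The eigenvectors with [|eigenvalue| < T] are mapped by the compact inverse to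
    an orthogonal family bounded away from [0]. *)
Lemma eigval_diverge (T : R) : compact_operator KA ->
  exists m, forall n, (m <= n)%N -> forall j, T <= `|ev n j|.
Proof.
move=> Kc; apply: contrapT => hm.
have bad m : exists z : nat * 'I_p, (m <= z.1)%N /\ `|ev z.1 z.2| < T.
  apply: contrapT => hz; apply: hm; exists m => n mn j; rewrite leNgt; apply/negP => h.
  by apply: hz; exists (n, j).
have /choice[z zP] := bad.
have T0 : 0 < T by have [_] := zP 0%N; apply: le_lt_trans.
pose u k := KA (unit_l2 (z k).1 (vec (z k).1 (z k).2)).
have uE k : u k = unit_l2 (z k).1 (((ev (z k).1 (z k).2)^-1)%:C *: vec (z k).1 (z k).2).
  exact: diag_inverse_eigvec.
have Su k : [set KA h | h in [set h : H | `|h| <= 1]] (u k).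
  by exists (unit_l2 (z k).1 (vec (z k).1 (z k).2)) => //; rewrite /= norm_unit vnorm_eigvec.
have [y yP] := precompact_cluster Kc Su.
have d0 : 0 < T^-1 / 2 by rewrite divr_gt0// invr_gt0.
have [k1 _ h1] := yP _ 0%N d0.
have [k2 k12 h2] := yP _ (z k1).1.+1 d0.
have z12 : (z k1).1 != (z k2).1.
  by rewrite neq_ltn (leq_trans k12)// (zP k2).1.
have small : `|u k1 - u k2| < T^-1.
  rewrite [ltRHS]splitr; apply: le_lt_trans (ler_distD y _ _) _.
  by apply: ltrD; [exact: h1|rewrite distrC; exact: h2].
have := le_lt_trans (vnorm_le_norm _ (z k1).1) small.
rewrite l2_subE (uE k1) (uE k2) !unit_l2E eqxx (negbTE z12) subr0.
rewrite vnormZ vnorm_eigvec mulr1 /= expr0n addr0 sqrtr_sqr normfV ltf_pV2 ?posrE//.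
  by rewrite ltNge => /negP; apply; apply: ltW; exact: (zP k1).2.
by rewrite normr_gt0; exact: eigval_neq0.
Qed.

Lemma absqrt_diverge : compact_operator KA ->
  forall t : R, exists m, forall n, (m <= n)%N ->
  forall v, t * vnorm v ^+ 2 <= vnorm (absqrt (A n) *m v) ^+ 2.
Proof.
move=> Kc t; have [m mP] := eigval_diverge t Kc; exists m => n mn v.
by apply: vnorm_absqrt_ge => j; left; exact: mP.
Qed.

Variables (eps : nat -> H) (sg : nat -> R).
Hypothesis eps_orth : Defs.orthonormal eps.
Hypothesis sg0 : forall n, 0 <= sg n.
Hypothesis eps_eig : forall n,
  op_adjoint (op_graph KA) (KA (eps n), (sg n ^+ 2)%:C *: eps n).
Hypothesis eps_complete : forall f, (forall n, l2dot f (eps n) = 0) -> KA f = 0.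

(** Both vectors are eigenvectors of the square of the inverse of the diagonal operator,
    with the different eigenvalues [|ev n j|^-2] and [sg k ^+ 2]. *)
Lemma eigvec_orthogonal n j k : sg k < `|ev n j|^-1 -> vdot (vec n j) (eps k n) = 0.
Proof.
move=> sk; have a0 := eigval_neq0 j (hA n) (uA n).
have := eps_eig k (_ : op_graph KA (unit_l2 n (vec n j), KA (unit_l2 n (vec n j)))).
move=> /(_ erefl) /=; rewrite diag_inverse_eigvec l2dotZr !l2dot_unitl vdotZl.
rewrite diag_inverseE vdot_mulmxr.
have -> : (invmx (A n))^t* = invmx (A n).
  by rewrite trmx_inv map_invmx hA.
rewrite invmx_eigvec vdotZl mulrA; set X := vdot _ _ => h.
have : (((ev n j)^-1) ^+ 2 - sg k ^+ 2)%:C * X = 0.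
  apply/eqP; rewrite rmorphB mulrBl expr2 rmorphM /= h subr_eq0; apply/eqP.
  by congr (_ * _); apply/eqP; rewrite eq_complex /= oppr0 !eqxx.
move/eqP; rewrite mulf_eq0 => /orP[|/eqP//] /eqP /complexI /eqP.
rewrite subr_eq0 -real_normK ?num_real// normfV eqrXn2 ?invr_ge0// => /eqP e.
by move: sk; rewrite e ltxx.
Qed.

(** The eigenvector, put at site [n], is orthogonal to all [eps i] with [i] outside [t]
    and hence, by completeness, a combination of those with [i \in t]. *)
Lemma eigvec_span n j (t : seq nat) g : uniq t ->
  (forall i, i \notin t -> sg i < `|ev n j|^-1) ->
  (forall i, i \in t -> l2dot g (eps i) = 0) -> vdot (g n) (vec n j) = 0.
Proof.
move=> ut st gt; pose v := unit_l2 n (vec n j).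
pose w := v - \sum_(i <- t) l2dot v (eps i) *: eps i.
have w0 : w = 0.
  apply/diag_inverse_inj/eps_complete => k; rewrite /w l2dotBl l2dot_suml.
  have [kt|kt] := boolP (k \in t).
    rewrite (bigD1_seq k)//= l2dotZl eps_orth eqxx mulr1 big1 ?addr0 ?subrr// => i ik.
    by rewrite l2dotZl eps_orth (negbTE ik) mulr0.
  rewrite l2dot_unitl eigvec_orthogonal ?st// sub0r big_seq big1 ?oppr0// => i it.
  rewrite l2dotZl eps_orth; case: eqP => [ik|_]; last by rewrite mulr0.
  by move: kt; rewrite -ik it.
have : l2dot g v = 0.
  have -> : v = \sum_(i <- t) l2dot v (eps i) *: eps i by apply/eqP; rewrite -subr_eq0 -/w w0.
  by rewrite l2dot_sumr big_seq big1// => i it; rewrite l2dotZr gt// mulr0.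
by rewrite l2dotC l2dot_unitl -vdotC.
Qed.

End Diagonal.

Section Counting.
Variables (R : realType) (p : nat).
Local Notation C := R[i].
Local Notation H := (l2 R p).
Implicit Types (f g h u w : H).

(** Serves both for the singular vectors and for their images, which are orthogonal but
    not normalized. *)
Lemma sqr_norm_comb n (v : nat -> H) (a : nat -> R) (u : 'I_n -> C) :
  (forall j k, l2dot (v j) (v k) = (if j == k then a j else 0)%:C) ->
  `|\sum_(k < n) u k *: v k| ^+ 2 = \sum_(k < n) sqmod (u k) * a k.
Proof.
move=> va; apply: complexI; rewrite -l2dotxx l2dot_suml rmorph_sum; apply: eq_bigr => k _.
rewrite l2dotZl l2dot_sumr (@sum_single _ _ _ k) => [|j jk].
  rewrite l2dotZr va eqxx; case: (u k) => x y; apply/eqP; rewrite eq_complex /sqmod /=.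
  by apply/andP; split; apply/eqP; ring.
rewrite l2dotZr va; case: eqP => [kj|_]; last by rewrite mulr0.
by move/eqP: jk; case; apply/val_inj.
Qed.

Variables (A : nat -> 'M[C]_p).
Hypothesis hA : forall n, (A n)^t* = A n.
Hypothesis uA : forall n, A n \in unitmx.
Variable KA : {linear H -> H}.
Hypothesis hKA : op_inverse (diag_operator A) = op_graph KA.
Variables (eps : nat -> H) (sg : nat -> R).
Hypothesis eps_orth : Defs.orthonormal eps.
Hypothesis sg0 : forall n, 0 <= sg n.
Hypothesis eps_eig : forall n,
  op_adjoint (op_graph KA) (KA (eps n), (sg n ^+ 2)%:C *: eps n).
Hypothesis eps_complete : forall f, (forall n, l2dot f (eps n) = 0) -> KA f = 0.

Variables (G : set (H * H)) (c : R) (N : nat) (z : C) (K : {linear H -> H}).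
Hypothesis c1 : c < 1.
Hypothesis Gform : forall f g, G (f, g) -> (forall n, (n < N)%N -> f n = 0) ->
  forall M, (1 - c) * \sum_(n < M) vnorm (absqrt (A n) *m f n) ^+ 2 <= `|g| * `|f|.
Hypothesis GK : forall h, op_shift G z (K h, h).
Variables (e : nat -> H) (s : nat -> R).
Hypothesis e_orth : Defs.orthonormal e.
Hypothesis Ke_orth : forall j k, l2dot (K (e j)) (K (e k)) = (if j == k then s j ^+ 2 else 0)%:C.
Hypothesis s_gt0 : forall n, 0 < s n.
Hypothesis s_noninc : forall n, s n.+1 <= s n.

Lemma s_antitone m n : (m <= n)%N -> s n <= s m.
Proof.
move=> /subnK <-; elim: (n - m)%N => [//|k IH]; rewrite addSn.
exact: le_trans (s_noninc _) IH.
Qed.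

(** Relates the singular values of [K] to those of the diagonal inverse; the
    factor [1 + |z| s 0] pays for the shift by [z], and the [2] makes the final
    comparison strict. *)
Let kap := (1 - c) / (2 * (1 + normc z * s 0%N)).

Lemma kap_gt0 : 0 < kap.
Proof.
have n0 : 0 <= normc z by case: (z) => a b; exact: sqrtr_ge0.
rewrite /kap divr_gt0 ?subr_gt0// mulr_gt0//.
by rewrite ltr_pwDl// mulr_ge0// ltW.
Qed.

(** Since [kap * tau] is half of [(1 - c) / (1 / tau + |z|)] or less, the left-hand side of
    the last inequality is at least twice the right-hand side. *)
Lemma form_arith (tau nz F g : R) : 0 < tau -> tau <= s 0%N -> 0 <= nz -> nz = normc z ->
  0 < g -> tau * F <= g -> 0 <= F ->
  (1 - c) * ((kap * tau)^-1 * g ^+ 2) <= (F + nz * g) * g -> False.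
Proof.
move=> t0 ts nz0 nzE g0 Fg F0.
set d := 1 + normc z * s 0%N; have d0 : 0 < d by rewrite ltr_pwDl// mulr_ge0 -?nzE// ltW.
have cc : 0 < 1 - c by rewrite subr_gt0.
have -> : (1 - c) * ((kap * tau)^-1 * g ^+ 2) = (2 * d / tau * g) * g.
  by rewrite /kap -/d; field; rewrite !gt_eqF.
rewrite ler_pM2r// => h.
have : tau * (2 * d / tau * g) <= tau * (F + nz * g) by rewrite ler_pM2l.
have -> : tau * (2 * d / tau * g) = 2 * (1 + nz * s 0%N) * g.
  by rewrite /d nzE; field; rewrite gt_eqF.
have h1 : nz * g * tau <= nz * g * s 0%N by rewrite ler_wpM2l// mulr_ge0// ltW.
have h2 : 0 <= nz * g * s 0%N by rewrite !mulr_ge0// ltW.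
by move: (s 0%N) h1 h2 Fg g0 => S h1 h2 Fg g0; lra.
Qed.

(** The first [N * p + size t + 1] singular values of [K] are at least [tau].  Some
    combination of the corresponding images vanishes on the first [N] sites and is
    orthogonal to the [eps i] with [i \in t].  If all [sg i] with [i] outside [t] were
    below [kap * tau], it would only involve eigenvectors of the diagonal with
    eigenvalues at least [1 / (kap * tau)], against the form bound. *)
Lemma singular_value_counting (t : seq nat) : uniq t ->
  exists2 i, i \notin t & kap * s (N * p + size t)%N <= sg i.
Proof.
move=> ut; apply: contrapT => hn.
set tau := s (N * p + size t)%N in hn *.
have st i : i \notin t -> sg i < kap * tau.
  by move=> it; rewrite ltNge; apply/negP => h; apply: hn; exists i.
have t0 : 0 < tau by exact: s_gt0.
have k0 : 0 < kap * tau by rewrite mulr_gt0// kap_gt0.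
pose l1 : seq H := [seq unit_l2 q.1 (delta_mx q.2 0) | q <- [seq (j, i) | j <- iota 0 N, i <- enum 'I_p]].
pose l := l1 ++ map eps t.
have sl : size l = (N * p + size t)%N.
  by rewrite size_cat !size_map size_allpairs size_iota -cardT card_ord.
have [u u0 ul] := orthogonal_to_list (fun k => K (e k)) l.
pose f := \sum_(k < (size l).+1) u 0 k *: e k.
have KfE : \sum_(k < (size l).+1) u 0 k *: K (e k) = K f.
  by rewrite /f linear_sum; apply: eq_bigr => k _; rewrite linearZ.
rewrite KfE in ul.
have fE : `|f| ^+ 2 = \sum_(k < (size l).+1) sqmod (u 0 k) * 1.
  apply: (@sqr_norm_comb _ e (fun=> 1)) => j k; rewrite e_orth.
  by case: eqP.
have KE : `|K f| ^+ 2 = \sum_(k < (size l).+1) sqmod (u 0 k) * s k ^+ 2.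
  by rewrite -KfE; exact: (@sqr_norm_comb _ (fun k => K (e k)) (fun k => s k ^+ 2)).
have f0 : 0 < `|f|.
  rewrite normr_gt0; apply: contra u0 => /eqP f0.
  move: fE; rewrite f0 normr0 expr0n => /esym/eqP.
  rewrite psumr_eq0 => [/allP h|k _]; last by rewrite mulr1 sqmod_ge0.
  apply/eqP/rowP => k; have := h k (mem_index_enum _); rewrite /= mulr1 mxE.
  case: (u 0 k) => x y; rewrite /sqmod /= paddr_eq0 ?sqr_ge0// !sqrf_eq0.
  by move=> /andP[/eqP -> /eqP ->].
have Kf : tau * `|f| <= `|K f|.
  have tf : 0 <= tau * `|f| by rewrite mulr_ge0// ltW.
  rewrite -(@ler_pXn2r _ 2%N) ?nnegrE// exprMn fE KE mulr_sumr; apply: ler_sum => k _.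
  rewrite mulr1 mulrC; apply: ler_wpM2l; first exact: sqmod_ge0.
  have kl : (k <= N * p + size t)%N by rewrite -sl -ltnS.
  apply: lerXn2r (s_antitone kl); rewrite nnegrE; apply: ltW; exact: s_gt0.
have Kf0 : 0 < `|K f| by apply: lt_le_trans Kf; rewrite mulr_gt0.
have gN n : (n < N)%N -> K f n = 0.
  move=> nN; apply/colP => i; rewrite mxE.
  have : l2dot (K f) (unit_l2 n (delta_mx i 0)) = 0.
    apply: ul; rewrite mem_cat; apply/orP; left; apply/mapP; exists (n, i) => //.
    by apply/allpairsP; exists (n, i); rewrite mem_iota mem_enum.
  rewrite l2dotC l2dot_unitl -vdotC /vdot (@sum_single _ _ _ i) => [|j ji].
    by rewrite [delta_mx _ _ _ _]mxE !eqxx rmorph1 mulr1.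
  by rewrite [delta_mx _ _ _ _]mxE (negbTE ji) rmorph0 mulr0.
have geps i : i \in t -> l2dot (K f) (eps i) = 0.
  by move=> it; apply: ul; rewrite mem_cat map_f ?orbT.
have := GK f; rewrite /op_shift /= => /Gform /(_ gN) form.
have lower M : (kap * tau)^-1 * \sum_(n < M) vnorm (K f n) ^+ 2 <=
    \sum_(n < M) vnorm (absqrt (A n) *m K f n) ^+ 2.
  rewrite mulr_sumr; apply: ler_sum => n _; apply: vnorm_absqrt_ge => j.
  have [h|h] := leP (kap * tau)^-1 `|eigval (A n) j|; [by left|right].
  apply: (eigvec_span hA uA hKA eps_orth sg0 eps_eig eps_complete ut) => // i it.
  apply: lt_trans (st i it) _; rewrite -[ltLHS]invrK ltf_pV2 ?posrE ?invr_gt0//.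
  by rewrite normr_gt0; exact: eigval_neq0.
have cc : 0 < 1 - c by rewrite subr_gt0.
have n0 : 0 <= normc z by case: (z) => a b; exact: sqrtr_ge0.
have total : (1 - c) * ((kap * tau)^-1 * `|K f| ^+ 2) <= (`|f| + normc z * `|K f|) * `|K f|.
  have q0 : 0 < (1 - c) * (kap * tau)^-1 by rewrite mulr_gt0// invr_gt0.
  rewrite mulrA -ler_pdivlMl//; apply: norm_le_partial => M; rewrite ler_pdivlMl//.
  rewrite -mulrA; apply: le_trans (_ : (1 - c) * \sum_(n < M) vnorm (absqrt (A n) *m K f n) ^+ 2 <= _).
    by apply: ler_wpM2l (ltW cc) _ _ (lower M).
  apply: le_trans (form M) _; apply: ler_wpM2r; first exact: normr_ge0.
  by apply: le_trans (ler_normD _ _) _; rewrite (l2_normZ z (K f)).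
apply: (form_arith t0 _ n0 erefl Kf0 Kf (ltW f0) total).
exact: s_antitone.
Qed.

End Counting.

(** * Dominance from the first index on *)

Section HeadBound.
Variable R : realType.

Definition head_bound (N : nat) (t : R) (b b' : nat -> R) n : R :=
  if (n < N)%N then b n / t else b' n.

Lemma head_bound_ge0 N t (b b' : nat -> R) n : 0 < t ->
  (forall n, 0 <= b n) -> (forall n, 0 <= b' n) -> 0 <= head_bound N t b b' n.
Proof. by move=> t0 b0 b'0; rewrite /head_bound; case: ifP => _ //; rewrite divr_ge0// ltW. Qed.

(** Column dominance from [N] on does not restrict [w] at [N] and [N.+1], whence the
    two additional indices. *)
Lemma head_bound_dominated (b b' v w : nat -> R) (N : nat) (c : R) :
  (forall n, 0 <= b n) -> (forall n, 0 <= b' n) -> (forall n, 0 <= v n) ->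
  (forall n, 0 <= w n) -> b' 0%N = 0 -> c < 1 ->
  ((forall n, (N <= n)%N -> v n + w n <= c) \/
   (forall n, (N <= n)%N -> v n + w n.+2 <= c)) ->
  exists t c', [/\ 0 < t, c' < 1, head_bound N.+2 t b' w 0%N = 0 &
    (forall n, head_bound N.+2 t b v n + head_bound N.+2 t b' w n <= c') \/
    (head_bound N.+2 t b' w 1%N <= c' /\
      forall n, head_bound N.+2 t b v n + head_bound N.+2 t b' w n.+2 <= c')].
Proof.
move=> b0 b'0 v0 w0 b'00 c1 dom.
have c0 : 0 <= c.
  by case: dom => h; apply: le_trans (h N (leqnn N)); rewrite addr_ge0.
(* Small enough for both [2 * ep] and [c + ep] to stay below the new bound
   [(1 + c) / 2]. *)
pose ep := (1 - c) / 4; have ep0 : 0 < ep by rewrite divr_gt0// subr_gt0.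
pose S := \sum_(n < N.+2) (b n + b' n).
have S0 : 0 <= S by rewrite sumr_ge0// => n _; rewrite addr_ge0.
pose t := (S + 1) / ep; have t0 : 0 < t by rewrite divr_gt0// ltr_wpDl.
pose x := head_bound N.+2 t b v; pose y := head_bound N.+2 t b' w.
have small (k : nat) (a : R) : (k < N.+2)%N -> a <= b k + b' k -> a / t <= ep.
  move=> kN vb; rewrite ler_pdivrMr// /t mulrC divfK ?gt_eqF//.
  apply: (le_trans vb); apply: (@le_trans _ _ S); last by rewrite lerDl.
  by rewrite /S (bigD1 (Ordinal kN))//= lerDl sumr_ge0// => i _; rewrite addr_ge0.
have xs n : (n < N.+2)%N -> x n <= ep.
  by move=> nN; rewrite /x /head_bound nN; apply: (small n) => //; rewrite lerDl.
have ys n : (n < N.+2)%N -> y n <= ep.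
  by move=> nN; rewrite /y /head_bound nN; apply: (small n) => //; rewrite lerDr.
have xl n : (N.+2 <= n)%N -> x n = v n by move=> Nn; rewrite /x /head_bound ltnNge Nn.
have yl n : (N.+2 <= n)%N -> y n = w n by move=> Nn; rewrite /y /head_bound ltnNge Nn.
have epE : ep = (1 - c) / 4 by [].
exists t, ((1 + c) / 2); split=> //.
- lra.
- by rewrite /head_bound /= b'00 mul0r.
rewrite -/x -/y; clearbody x y ep.
case: dom => dom; [left|right].
  move=> n; have [nN|Nn] := ltnP n N.+2.
    by have := xs n nN; have := ys n nN; lra.
  by rewrite xl// yl//; have := dom n (ltnW (ltnW Nn)); lra.
split; first by have := ys 1%N isT; lra.
move=> n; have [nN|Nn] := ltnP n N.
  have := xs n (ltn_trans nN (leqnSn N.+1)); have : y n.+2 <= ep by exact: ys.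
  lra.
have yE : y n.+2 = w n.+2 by rewrite yl.
have := dom n Nn; rewrite yE; have [nN|Nn2] := ltnP n N.+2.
  by have := xs n nN; have := v0 n; lra.
by rewrite xl//; lra.
Qed.

End HeadBound.

Section Comparison.
Variables (R : realType) (p : nat).
Local Notation C := R[i].
Local Notation H := (l2 R p).
Implicit Types (f g h u w : H).

Lemma opnorm0 : opnorm (0 : 'M[C]_p) = 0.
Proof.
apply/eqP; rewrite eq_le opnorm_ge0 andbT; apply: ge_sup; first exact: (opnorm_has_sup _).1.
by move=> _ [u _ <-]; rewrite mul0mx vnorm0.
Qed.

Variables (A B : nat -> 'M[C]_p).
Hypothesis hA : forall n, (A n)^t* = A n.
Hypothesis uA : forall n, A n \in unitmx.

Definition scalar_head (N : nat) (t : R) n : 'M[C]_p := if (n < N)%N then (t%:C)%:M else A n.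

Section Head.
Variables (N : nat) (t : R).
Hypothesis t0 : 0 < t.

Lemma scalar_head_herm n : (scalar_head N t n)^t* = scalar_head N t n.
Proof.
rewrite /scalar_head; case: ifP => _ //.
by rewrite tr_scalar_mx map_scalar_mx; congr (_%:M); exact: conjc_real.
Qed.

Lemma scalar_head_unit n : scalar_head N t n \in unitmx.
Proof.
rewrite /scalar_head; case: ifP => _ //.
rewrite unitmxE det_scalar unitrX// unitfE; apply/eqP => /complexI t00.
by have := t0; rewrite t00 ltxx.
Qed.

Lemma scalar_head_eq n : (N <= n)%N -> A n = scalar_head N t n.
Proof. by rewrite /scalar_head ltnNge => ->. Qed.

Lemma scalar_head_bound (D : nat -> 'M[C]_p) n (u : 'cV[C]_p) :
  vnorm (invmx (scalar_head N t n) *m (D n *m u)) <=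
  head_bound N t (fun n => opnorm (D n)) (fun n => opnorm (invmx (A n) *m D n)) n * vnorm u.
Proof.
rewrite /scalar_head /head_bound; case: ifP => _; last by rewrite mulmxA vnorm_mulmx.
rewrite invmx_scalar mul_scalar_mx vnormZ.
have -> : normc (t%:C^-1 : C) = t^-1.
  by rewrite normcV /= expr0n addr0 sqrtr_sqr gtr0_norm.
rewrite [opnorm _ / t]mulrC -mulrA; apply: ler_wpM2l (vnorm_mulmx _ _).
by rewrite invr_ge0 ltW.
Qed.

End Head.

(** Replacing finitely many diagonal blocks by a large multiple of the identity
    makes the dominance hold from the first index on. *)
Lemma scalar_head_dominated (N : nat) (c : R) : c < 1 ->
  ((forall n, (N <= n)%N -> nAB A B n + nABpred A B n <= c) \/
   (forall n, (N <= n)%N -> nAB A B n + nABpred A B n.+2 <= c)) ->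
  exists (t : R) (x y : nat -> R) (c' : R), [/\ 0 < t, c' < 1,
    (forall n, 0 <= x n) /\ (forall n, 0 <= y n),
    (forall n (u : 'cV[C]_p),
       vnorm (invmx (scalar_head N.+2 t n) *m (B n *m u)) <= x n * vnorm u) /\
    (forall n (u : 'cV[C]_p),
       vnorm (invmx (scalar_head N.+2 t n) *m ((Bpred B n)^t* *m u)) <= y n * vnorm u)
    & y 0%N = 0 /\
      ((forall n, x n + y n <= c') \/ (y 1%N <= c' /\ forall n, x n + y n.+2 <= c'))].
Proof.
move=> c1 dom.
have b0 n : 0 <= opnorm (B n) by exact: opnorm_ge0.
have b'0 n : 0 <= opnorm ((Bpred B n)^t*) by exact: opnorm_ge0.
have x0 n : 0 <= nAB A B n by exact: opnorm_ge0.
have y0 n : 0 <= nABpred A B n by exact: opnorm_ge0.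
have b'00 : opnorm ((Bpred B 0%N)^t*) = 0.
  by rewrite /= (_ : (0 : 'M[C]_p)^t* = 0) ?opnorm0// trmx0 map_mx0.
have [t [c' [t0 c'1 y00 dom']]] := head_bound_dominated b0 b'0 x0 y0 b'00 c1 dom.
exists t, (head_bound N.+2 t (fun n => opnorm (B n)) (nAB A B)),
  (head_bound N.+2 t (fun n => opnorm ((Bpred B n)^t*)) (nABpred A B)), c'.
split; [exact: t0|exact: c'1| | |by split].
  split=> n; first exact: head_bound_ge0 t0 b0 x0.
  exact: head_bound_ge0 t0 b'0 y0.
split=> n u; first exact: (@scalar_head_bound N.+2 t t0 B n u).
exact: (@scalar_head_bound N.+2 t t0 (fun n => (Bpred B n)^t*) n u).
Qed.

Lemma dense_domain : dense (op_domain (minimal_jacobi A B)).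
Proof.
move=> O [f0 Of0] oO; move: (f0 : H) Of0 => {f0} f Of.
have /nbhs_ballP[e e0 eO] := open_nbhs_nbhs (conj oO Of).
have [M fM] := trunc_approx f e0.
exists (trunc f M); split; first by apply: eO; rewrite ball_l2E.
have [g fg] := @preminimal_exists _ _ A B (trunc f M) (trunc_fin f M).
by exists g; exact: subset_closure.
Qed.

End Comparison.

(* Since the conditions only concern n >= N, the finitely many remaining entries
   can be chosen so that 0 is an eigenvalue of J. Hence J^-1 in S_q is asserted
   when J is injective, and (J - z)^-1 in S_q for every z for which J - z is
   injective, in particular for every non-real z. *)
Theorem theorem3p2 (R : realType) (p : nat) (hp : (0 < p)%N)
    (A B : nat -> 'M[R[i]]_p)
    (hA : forall n, (A n)^t* = A n)
    (hB : forall n, B n \in unitmx)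
    (hker : op_kernel (diag_operator A) = [set 0])
    (q : \bar R) (hq : (0 < q)%E)
    (hAq : in_schatten q (op_inverse (diag_operator A)))
    (hcond : cond_i A B \/ cond_ii A B \/ cond_iii A B \/ cond_iv A B \/
             cond_v A B) :
  [/\ selfadjoint (minimal_jacobi A B),
      op_kernel (minimal_jacobi A B) = [set 0] ->
        in_schatten q (op_inverse (minimal_jacobi A B)) &
      forall z : R[i], op_kernel (op_shift (minimal_jacobi A B) z) = [set 0] ->
        in_schatten q (op_inverse (op_shift (minimal_jacobi A B) z))].
Proof.
have uA := diag_unitmx hker.
case: hAq => KA hKA [KAc KAq].
have [N [c [c1 dom]]] := conditions_dominated hcond.
have [t [x [y [c' [t0 c'1 [x0 y0] [hx hy] [y00 hdom]]]]]] := scalar_head_dominated c1 dom.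
set A' := scalar_head A N.+2 t in hx hy.
have A'h n : (A' n)^t* = A' n by exact: scalar_head_herm.
have A'u n : A' n \in unitmx by exact: scalar_head_unit.
have AA' k : (N.+2 <= k)%N -> A k = A' k by exact: scalar_head_eq.
have A'A k : (N.+2 <= k)%N -> A' k = A k by move=> /AA' ->.
clearbody A'.
have hdiv T : exists m, forall n, (m <= n)%N ->
    forall v, T * vnorm v ^+ 2 <= vnorm (absqrt (A' n) *m v) ^+ 2.
  have [m mP] := absqrt_diverge hA uA hKA KAc T; exists (maxn m N.+2) => n.
  by rewrite geq_max => /andP[mn Nn] v; rewrite A'A//; exact: mP.
have A'mm := minimal_eq_maximal A'h A'u c'1 x0 y0 hx hy y00 hdom hdiv.
have mm : minimal_jacobi A B = maximal_jacobi A B := minimal_eq_maximal_perturb AA' A'mm.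
have sa : op_adjoint (minimal_jacobi A B) = minimal_jacobi A B.
  by rewrite (adjoint_minimal B hA) mm.
have tg : tight_rel (minimal_jacobi A B).
  apply: (minimal_tight_perturb AA').
  exact: minimal_tight A'h A'u c'1 x0 y0 hx hy hdom hdiv.
have form f g : minimal_jacobi A B (f, g) -> (forall n, (n < N.+2)%N -> f n = 0) ->
    forall M, (1 - c') * \sum_(n < M) vnorm (absqrt (A n) *m f n) ^+ 2 <= `|g| * `|f|.
  move=> fg fN M; have := minimal_perturb A'A fg.
  have -> : block_diag (fun k => A' k - A k) N.+2 f = 0.
    by apply: l2_ext => n; rewrite block_diagE l2_0E; case: ifP => // /fN ->; rewrite mulmx0.
  rewrite addr0 => /(minimal_form A'h A'u c'1 x0 y0 hx hy hdom M) h.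
  suff -> : \sum_(n < M) vnorm (absqrt (A n) *m f n) ^+ 2 =
    \sum_(n < M) vnorm (absqrt (A' n) *m f n) ^+ 2 by exact: h.
  apply: eq_bigr => n _; have [nN|Nn] := ltnP n N.+2; last by rewrite (A'A _ Nn).
  by rewrite (fN n nN) (mulmx0 _ (absqrt (A n))) (mulmx0 _ (absqrt (A' n))).
have main z : op_kernel (op_shift (minimal_jacobi A B) z) = [set 0] ->
    in_schatten q (op_inverse (op_shift (minimal_jacobi A B) z)).
  move=> kz; have zinj f : op_shift (minimal_jacobi A B) z (f, 0) -> f = 0.
    move=> fz; have : op_kernel (op_shift (minimal_jacobi A B) z) f by [].
    by rewrite kz.
  have [K [K' [b [KE Kc GK Kb KK']]]] := selfadjoint_resolvent (minimal_linear A B)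
    (@minimal_closed _ _ A B) tg sa zinj.
  exists K => //; split => //.
  case: q hq KAq => [r|//|//] r0 [sg [eps [eps_o sg0 eps_e eps_c]] sg_sum].
  rewrite lte_fin in r0.
  have Kinj f : K f = 0 -> f = 0.
    move=> Kf; have := minimal_sub_maximal (GK f); rewrite /= Kf scaler0 addr0 => h.
    apply: l2_ext => n; have -> : f n = jacobi_action A B (0 : l2 R p) n by exact: (h n).
    by rewrite /jacobi_action !l2_0E !mulmx0 !addr0.
  have [e [s [e_o s0 s_mono Te e_c]]] := spectral_sequence hp KK'
    (fun h => proj1 (Kb h)) (fun h => proj2 (Kb h)) Kinj Kc.
  have Keo j k : l2dot (K (e j)) (K (e k)) = (if j == k then s j ^+ 2 else 0)%:C.
    rewrite KK' Te l2dotZr e_o; case: eqP => [->|_]; last by rewrite mulr0.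
    by rewrite mulr1; exact: conjc_real.
  exists s.
    exists e; split=> //.
    - by move=> n; exact: ltW.
    - by move=> n w /= ->; rewrite KK' Te.
    - by move=> f /e_c ->; rewrite linear0.
  apply: (@injective_domination R s sg r _ (N.+2 * p) r0 (kap_gt0 z c'1 s0) (fun n => ltW (s0 n)) sg0 _ sg_sum) => tt ut.
  have := (singular_value_counting hA uA hKA eps_o sg0 eps_e eps_c c'1 form GK e_o Keo s0 s_mono ut).
  exact.
split=> //.
- by split=> //; exact: dense_domain.
have shift0 : op_shift (minimal_jacobi A B) 0 = minimal_jacobi A B.
  apply/seteqP; split=> -[f g]; rewrite /op_shift /= scale0r addr0 //.
by move=> k0; have := main 0; rewrite shift0; exact.
Qed.
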